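(* Let $\Bbbk$ be an algebraically closed field of characteristic $p>0$ and let $H$ be a nonsemisimple Hopf algebra of dimension $p^n$ over $\Bbbk$ for some integer $n\ge 1$. If $|G(H^* )|=p^{n-1}$, then the dual Hopf algebra $H^*$ is pointed.
   Context: For a finite-dimensional Hopf algebra $H$, $H^*$ is the dual Hopf algebra and $G(H^* )$ is its group of group-like elements, i.e. the group of algebra homomorphisms $H\to\Bbbk$. $H$ is semisimple if it is semisimple as an algebra. A Hopf algebra $L$ is pointed if its coradical $L_0$ (the sum of all simple subcoalgebras) equals $\Bbbk[G(L)]$. *)

(* Defs.v *)
From HB Require Import structures.
From mathcomp Require Import all_boot all_order all_algebra all_field.

Set Implicit Arguments.
Unset Strict Implicit.
Unset Printing Implicit Defensive.

Import GRing.Theory.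
Local Open Scope ring_scope.

Reserved Notation "v \ox w" (at level 40, left associativity).

(* A model of the tensor product: the matrix M stands for                     *)
(* \sum_(i, j) M i j *: (v_i (x) w_j), with (v_i) and (w_j) the library bases *)
(* of V and W. The lemmas tens_linearl, tens_linearr, tliftE and tlift_uniq   *)
(* say that it has the universal property, so nothing depends on the bases.   *)
Section TensorDef.
Variables (K : fieldType) (V W : vectType K).

Definition tensor := 'M[K]_(\dim {:V}, \dim {:W}).

HB.instance Definition _ := Vector.copy tensor 'M[K]_(\dim {:V}, \dim {:W}).

Definition tens (v : V) (w : W) : tensor :=
  \matrix_(i, j) (coord (vbasis {:V}) i v * coord (vbasis {:W}) j w).

(* For bilinear f, tlift f is the induced linear map on the tensor product:   *)
(* tlift (fun a b => f a b) (comul x) is the Sweedler sum of f(x_1, x_2).     *)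
Definition tlift (U : vectType K) (f : V -> W -> U) (x : tensor) : U :=
  \sum_i \sum_j x i j *: f (vbasis {:V})`_i (vbasis {:W})`_j.

End TensorDef.

Notation "v \ox w" := (tens v w) : ring_scope.

Section TensorTheory.
Variables (K : fieldType) (V W : vectType K).

Lemma tens_linearl (w : W) : linear (fun v : V => v \ox w).
Proof.
move=> a u v; apply/matrixP=> i j.
by rewrite !mxE linearP /= mulrDl mulrA.
Qed.

Lemma tens_linearr (v : V) : linear (fun w : W => v \ox w).
Proof.
move=> a u w; apply/matrixP=> i j.
by rewrite !mxE linearP /= mulrDr mulrCA.
Qed.

Lemma tlift_is_linear (U : vectType K) (f : V -> W -> U) : linear (tlift f).
Proof.
move=> a x y; rewrite /tlift scaler_sumr -big_split; apply: eq_bigr => i _.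
rewrite scaler_sumr -big_split; apply: eq_bigr => j _ /=.
by rewrite !mxE scalerDl scalerA.
Qed.

HB.instance Definition _ (U : vectType K) (f : V -> W -> U) :=
  GRing.isLinear.Build K (tensor V W) U _ (tlift f) (tlift_is_linear f).

Lemma eq_tlift (U : vectType K) (f g : V -> W -> U) (x : tensor V W) :
  (forall a b, f a b = g a b) -> tlift f x = tlift g x.
Proof. by move=> fg; apply: eq_bigr => i _; apply: eq_bigr => j _; rewrite fg. Qed.

Lemma tliftE (U : vectType K) (f : V -> W -> U) v w :
  (forall b, linear (f^~ b)) -> (forall a, linear (f a)) ->
  tlift f (v \ox w) = f v w.
Proof.
move=> fl fr.
pose Fl b := GRing.isLinear.Build K V U _ (f^~ b) (fl b).
pose FL b : {linear V -> U} := HB.pack (f^~ b) (Fl b).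
pose Fr a := GRing.isLinear.Build K W U _ (f a) (fr a).
pose FR a : {linear W -> U} := HB.pack (f a) (Fr a).
rewrite {2}(coord_vbasis (memvf v)) -[RHS]/(FL w _) linear_sum.
apply: eq_bigr => i _; rewrite linearZ /=.
rewrite [in RHS](coord_vbasis (memvf w)) -[f _ _]/(FR _ _) linear_sum scaler_sumr.
by apply: eq_bigr => j _; rewrite linearZ /= scalerA mxE.
Qed.

Lemma tlift_lin (U U' : vectType K) (g : {linear U -> U'}) (f : V -> W -> U) x :
  g (tlift f x) = tlift (fun a b => g (f a b)) x.
Proof.
rewrite /tlift linear_sum; apply: eq_bigr => i _.
by rewrite linear_sum; apply: eq_bigr => j _; rewrite linearZ.
Qed.

Lemma tlift_tens (x : tensor V W) : tlift (@tens K V W) x = x.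
Proof.
apply/matrixP=> k l; rewrite /tlift summxE (bigD1 k) //= summxE (bigD1 l) //=.
have fV := basis_free (vbasisP {:V}); have fW := basis_free (vbasisP {:W}).
rewrite !mxE !coord_free // !eqxx !mulr1 !big1 ?addr0 //.
- move=> i ik; rewrite summxE big1 // => j _.
  by rewrite !mxE coord_free // (negPf ik) mul0r mulr0.
- by move=> j jl; rewrite !mxE !coord_free // (negPf jl) !mulr0.
Qed.

Lemma tlift_uniq (U : vectType K) (g : {linear tensor V W -> U}) x :
  g x = tlift (fun v w => g (v \ox w)) x.
Proof. by rewrite -{1}[x]tlift_tens tlift_lin. Qed.

Lemma tlift_sumE (I : finType) (U : vectType K) (f : I -> V -> W -> U) x :
  tlift (fun a b => \sum_k f k a b) x = \sum_k tlift (f k) x.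
Proof.
rewrite /tlift [RHS]exchange_big; apply: eq_bigr => i _; rewrite [RHS]exchange_big.
by apply: eq_bigr => j _; rewrite scaler_sumr.
Qed.

Lemma tliftZ (U : vectType K) a (f : V -> W -> U) x :
  tlift (fun v w => a *: f v w) x = a *: tlift f x.
Proof.
rewrite /tlift scaler_sumr; apply: eq_bigr => i _.
by rewrite scaler_sumr; apply: eq_bigr => j _; rewrite !scalerA mulrC.
Qed.

Lemma tliftD (U : vectType K) (f g : V -> W -> U) x :
  tlift (fun v w => f v w + g v w) x = tlift f x + tlift g x.
Proof.
rewrite /tlift -big_split; apply: eq_bigr => i _; rewrite -big_split.
by apply: eq_bigr => j _; rewrite scalerDr.
Qed.

End TensorTheory.

Lemma tlift_exchange (K : fieldType) (V W V' W' U : vectType K)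
    (f : V -> W -> V' -> W' -> U) x y :
  tlift (fun a b => tlift (f a b) y) x =
  tlift (fun c d => tlift (fun a b => f a b c d) x) y.
Proof.
transitivity (tlift (fun a b => \sum_i \sum_j y i j *:
  f a b (vbasis {:V'})`_i (vbasis {:W'})`_j) x); first by [].
rewrite tlift_sumE; apply: eq_bigr => i _.
by rewrite tlift_sumE; apply: eq_bigr => j _; rewrite tliftZ.
Qed.

HB.mixin Record isCoalgebra (K : fieldType) C of Vector K C := {
  comul : {linear C -> tensor C C};
  counit : {linear C -> K^o};
  comulA : forall x : C,
    tlift (fun a b => tlift (fun a1 a2 => a1 \ox (a2 \ox b)) (comul a))
      (comul x) =
    tlift (fun a b => a \ox comul b) (comul x);
  comul1r : forall x : C, tlift (fun a b => (counit a : K) *: b) (comul x) = x;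
  comulr1 : forall x : C, tlift (fun a b => (counit b : K) *: a) (comul x) = x
}.

#[short(type="coalgType")]
HB.structure Definition Coalgebra (K : fieldType) :=
  { C of isCoalgebra K C & Vector K C }.

Definition tmul (K : fieldType) (A : falgType K) (x y : tensor A A) :
    tensor A A :=
  tlift (fun a b => tlift (fun c d => (a * c) \ox (b * d)) y) x.

HB.mixin Record isHopf (K : fieldType) H of Coalgebra K H & Falgebra K H := {
  comul_mul : forall x y : H, comul (x * y) = tmul (comul x) (comul y);
  comul_one : comul (1 : H) = 1 \ox 1;
  counit_mul : forall x y : H, counit (x * y) = (counit x : K) * counit y;
  counit_one : counit (1 : H) = 1;
  antipode : {linear H -> H};
  antipodel : forall x : H,
    tlift (fun a b => antipode a * b) (comul x) = (counit x : K) *: 1;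
  antipoder : forall x : H,
    tlift (fun a b => a * antipode b) (comul x) = (counit x : K) *: 1
}.

#[short(type="hopfAlgType")]
HB.structure Definition Hopf (K : fieldType) :=
  { H of isHopf K H & Coalgebra K H & Falgebra K H }.

Lemma tlift_linP (K : fieldType) (V W U U' : vectType K) (g : U -> U')
    (f : V -> W -> U) x :
  linear g -> g (tlift f x) = tlift (fun a b => g (f a b)) x.
Proof.
move=> gl; pose G : {linear U -> U'} := HB.pack g (GRing.isLinear.Build K U U' _ g gl).
exact: (tlift_lin G).
Qed.

Lemma tlift_scall (K : fieldType) (V W : vectType K) (k : K) (f : V -> W -> K^o) x :
  tlift (fun a b => k * f a b : K^o) x = k * tlift f x.
Proof. exact: tliftZ. Qed.

Lemma tlift_scalr (K : fieldType) (V W : vectType K) (k : K) (f : V -> W -> K^o) x :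
  tlift (fun a b => f a b * k : K^o) x = tlift f x * k.
Proof.
rewrite [RHS](@mulrC K) -[RHS](tlift_scall k f x).
by apply: eq_tlift => a b; exact: mulrC.
Qed.

Definition hopf_dual (K : fieldType) (H : hopfAlgType K) := 'Hom(H, K^o).

Section Dual.
Variables (K : fieldType) (H : hopfAlgType K).

Local Notation D := (hopf_dual H).

HB.instance Definition _ := Vector.copy D 'Hom(H, K^o).

(* Convolution: (f * g)(x) is the Sweedler sum of f(x_1) g(x_2).              *)
Definition dual_mul_fun (f g : D) (x : H) : K^o :=
  tlift (fun a b => f a * g b : K^o) (comul x).

Lemma dual_mul_fun_linear f g : linear (dual_mul_fun f g).
Proof. by move=> a x y; rewrite /dual_mul_fun linearP linearP. Qed.

HB.instance Definition _ f g :=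
  GRing.isLinear.Build K H K^o _ (dual_mul_fun f g) (dual_mul_fun_linear f g).

Definition dual_mul (f g : D) : D := linfun (dual_mul_fun f g).
Definition dual_one : D := linfun (@counit K H).

Lemma dual_mulE f g x :
  dual_mul f g x = tlift (fun a b => f a * g b : K^o) (comul x).
Proof. by rewrite lfunE. Qed.

Lemma dual_oneE x : dual_one x = counit x.
Proof. by rewrite lfunE. Qed.

Lemma dualDE (f g : D) x : (f + g) x = f x + g x.
Proof. exact: add_lfunE. Qed.

Lemma dualZE a (f : D) x : (a *: f) x = a * f x.
Proof. exact: scale_lfunE. Qed.

Lemma dual_mulA : associative dual_mul.
Proof.
move=> f g k; apply/lfunP=> x; rewrite !dual_mulE.
pose T2 (y : tensor H H) : K^o := tlift (fun b c => g b * k c : K^o) y.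
pose T (y : tensor H (tensor H H)) : K^o := tlift (fun a z => f a * T2 z : K^o) y.
have TE a z : T (a \ox z) = f a * T2 z.
  rewrite /T tliftE // => [b c u v | b c u v].
  - by rewrite linearP /= mulrDl -scalerAl.
  - by rewrite /T2 linearP /= mulrDr -scalerAr.
have T2E b c : T2 (b \ox c) = g b * k c.
  rewrite /T2 tliftE // => [z d u v | z d u v].
  - by rewrite linearP /= mulrDl -scalerAl.
  - by rewrite linearP /= mulrDr -scalerAr.
have Tl : linear T by move=> c y z; rewrite /T linearP.
have /(congr1 T) := comulA x; rewrite !(tlift_linP _ _ Tl) => E.
transitivity (tlift (fun a b => T (a \ox comul b)) (comul x)).
  by apply: eq_tlift => a b; rewrite TE /T2 dual_mulE.
rewrite -E; apply: eq_tlift => a b; rewrite dual_mulE (tlift_linP _ _ Tl).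
by rewrite -tlift_scalr; apply: eq_tlift => c d; rewrite TE T2E mulrA.
Qed.

Lemma dual_mul1l : left_id dual_one dual_mul.
Proof.
move=> f; apply/lfunP=> x; rewrite dual_mulE -[in RHS](comul1r x) tlift_lin.
by apply: eq_tlift => a b; rewrite linearZ dual_oneE.
Qed.

Lemma dual_mul1r : right_id dual_one dual_mul.
Proof.
move=> f; apply/lfunP=> x; rewrite dual_mulE -[in RHS](comulr1 x) tlift_lin.
by apply: eq_tlift => a b; rewrite linearZ dual_oneE; exact: mulrC.
Qed.

Lemma dual_mulDl : left_distributive dual_mul +%R.
Proof.
move=> f g k; apply/lfunP=> x; rewrite dualDE !dual_mulE -tliftD.
by apply: eq_tlift => a b; rewrite dualDE mulrDl.
Qed.

Lemma dual_mulDr : right_distributive dual_mul +%R.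
Proof.
move=> f g k; apply/lfunP=> x; rewrite dualDE !dual_mulE -tliftD.
by apply: eq_tlift => a b; rewrite dualDE mulrDr.
Qed.

Lemma dual_one_neq0 : dual_one != 0.
Proof.
apply/eqP=> /lfunP/(_ 1); rewrite dual_oneE counit_one zero_lfunE.
by move/eqP; rewrite oner_eq0.
Qed.

HB.instance Definition _ := GRing.Zmodule_isNzRing.Build D
  dual_mulA dual_mul1l dual_mul1r dual_mulDl dual_mulDr dual_one_neq0.

Lemma dual_scaleAl a (f g : D) : a *: (f * g) = (a *: f) * g.
Proof.
apply/lfunP=> x; rewrite dualZE !dual_mulE -tlift_scall.
by apply: eq_tlift => b c; rewrite dualZE mulrA.
Qed.

HB.instance Definition _ := GRing.Lmodule_isLalgebra.Build K D dual_scaleAl.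

Lemma dual_scaleAr a (f g : D) : a *: (f * g) = f * (a *: g).
Proof.
apply/lfunP=> x; rewrite dualZE !dual_mulE -tlift_scall.
by apply: eq_tlift => b c; rewrite dualZE; exact: mulrCA.
Qed.

HB.instance Definition _ := GRing.Lalgebra_isAlgebra.Build K D dual_scaleAr.
HB.instance Definition _ := Algebra_isFalgebra.Build K D.

Local Notation e i := (vbasis {:H})`_i.

Definition dual_basis (i : 'I_(\dim {:H})) : D :=
  linfun (coord (vbasis {:H}) i : H -> K^o).

(* The coproduct dual to the product: by dual_comulE below, the Sweedler sum  *)
(* of f_1(a) f_2(b) is f(a * b).                                              *)
Definition dual_comul (f : D) : tensor D D :=
  \sum_(i < \dim {:H}) \sum_(j < \dim {:H}) f (e i * e j) *: (dual_basis i \ox dual_basis j).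

Lemma dual_comul_linear : linear dual_comul.
Proof.
move=> a f g; rewrite /dual_comul scaler_sumr -big_split; apply: eq_bigr => i _.
rewrite scaler_sumr -big_split; apply: eq_bigr => j _ /=.
by rewrite dualDE dualZE scalerDl scalerA.
Qed.

HB.instance Definition _ :=
  GRing.isLinear.Build K D (tensor D D) _ dual_comul dual_comul_linear.

Definition dual_counit (f : D) : K^o := f 1.

Lemma dual_counit_linear : linear dual_counit.
Proof. by move=> a f g; rewrite /dual_counit dualDE dualZE. Qed.

HB.instance Definition _ :=
  GRing.isLinear.Build K D K^o _ dual_counit dual_counit_linear.

Definition dual_eval2 (a b : H) (F : tensor D D) : K^o :=
  tlift (fun f g : D => f a * g b : K^o) F.

Lemma dual_eval2_linear a b : linear (dual_eval2 a b).
Proof. by move=> c F G; rewrite /dual_eval2 linearP. Qed.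

Lemma dual_eval2E a b (f g : D) : dual_eval2 a b (f \ox g) = f a * g b.
Proof.
rewrite /dual_eval2 tliftE // => [h c u v | h c u v].
- by rewrite dualDE dualZE mulrDl -scalerAl.
- by rewrite dualDE dualZE mulrDr -scalerAr.
Qed.

Lemma dual_comulE (f : D) a b : dual_eval2 a b (dual_comul f) = f (a * b).
Proof.
rewrite [in RHS](coord_vbasis (memvf a)) mulr_suml linear_sum.
pose E : {linear tensor D D -> K^o} := HB.pack (dual_eval2 a b)
  (GRing.isLinear.Build K (tensor D D) K^o _ _ (dual_eval2_linear a b)).
rewrite -[dual_eval2 a b]/(E : _ -> _) linear_sum; apply: eq_bigr => i _.
rewrite linear_sum [in RHS](coord_vbasis (memvf b)) mulr_sumr linear_sum.
apply: eq_bigr => j _; rewrite linearZ /= dual_eval2E !lfunE /=.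
rewrite -scalerAl -scalerAr !linearZ /=.
by congr (_ *: _); exact: mulrC.
Qed.

Lemma dual_basisE (f : D) : f = \sum_(i < \dim {:H}) f (e i) *: dual_basis i.
Proof.
apply/lfunP=> x; rewrite {1}(coord_vbasis (memvf x)) linear_sum sum_lfunE.
by apply: eq_bigr => i _; rewrite linearZ dualZE lfunE; exact: mulrC.
Qed.

Lemma dual_tensor_sep (W : vectType K) (F G : tensor D W) :
  (forall a, tlift (fun (f : D) w => f a *: w) F =
     tlift (fun (f : D) w => f a *: w) G) ->
  F = G.
Proof.
move=> FG.
suffices E X : X = \sum_(i < \dim {:H}) dual_basis i \ox tlift (fun (f : D) (w : W) => f (e i) *: w) X.
  by rewrite (E F) (E G); apply: eq_bigr => i _; rewrite FG.
rewrite -[LHS]tlift_tens.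
transitivity (tlift (fun (f : D) (w : W) => \sum_(i < \dim {:H}) dual_basis i \ox (f (e i) *: w)) X).
  apply: eq_tlift => f w.
  pose L : {linear D -> tensor D W} := HB.pack (fun v : D => v \ox w)
    (GRing.isLinear.Build K D (tensor D W) _ _ (tens_linearl w)).
  rewrite {1}(dual_basisE f) -[LHS]/(L _) linear_sum; apply: eq_bigr => i _.
  pose R : {linear W -> tensor D W} := HB.pack (fun w : W => dual_basis i \ox w)
    (GRing.isLinear.Build K W (tensor D W) _ _ (tens_linearr (dual_basis i))).
  by rewrite linearZ /= -[RHS]/(R _) linearZ.
rewrite tlift_sumE; apply: eq_bigr => i _; symmetry.
exact: tlift_linP (tens_linearr _).
Qed.

Lemma dual_tensor2_sep (F G : tensor D D) :
  (forall a b, dual_eval2 a b F = dual_eval2 a b G) -> F = G.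
Proof.
move=> FG; apply: dual_tensor_sep => a; apply/lfunP => b.
have ab X : (tlift (fun f g : D => f a *: g) X) b = dual_eval2 a b X.
  rewrite (tlift_linP (g := fun h : D => h b : K^o)).
    by apply: eq_tlift => f g; rewrite dualZE.
  by move=> c f g; rewrite dualDE dualZE.
by rewrite !ab.
Qed.

Lemma dual_comulA (f : D) :
  tlift (fun g h => tlift (fun g1 g2 => g1 \ox (g2 \ox h)) (dual_comul g))
    (dual_comul f) =
  tlift (fun g h => g \ox dual_comul h) (dual_comul f).
Proof.
apply: dual_tensor_sep => a; apply: dual_tensor2_sep => b c.
pose L (X : tensor D (tensor D D)) : K^o :=
  dual_eval2 b c (tlift (fun (f : D) w => f a *: w) X).
have Ll : linear L by move=> k X Y; rewrite /L linearP dual_eval2_linear.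
have LE (g : D) X : L (g \ox X) = g a *: dual_eval2 b c X.
  rewrite /L tliftE => [|w k u v|h k u v].
  - by rewrite /dual_eval2 linearZ.
  - by rewrite dualDE dualZE scalerDl scalerA.
  - by rewrite scalerDr !scalerA mulrC.
rewrite -/(L _) -[RHS]/(L _) !(tlift_linP _ _ Ll).
transitivity (f ((a * b) * c)); last first.
  rewrite -mulrA -dual_comulE; apply: eq_tlift => g h.
  by rewrite LE dual_comulE.
rewrite -dual_comulE; apply: eq_tlift => g h.
rewrite (tlift_linP _ _ Ll) -dual_comulE -tlift_scalr.
by apply: eq_tlift => g1 g2; rewrite LE dual_eval2E; exact: mulrA.
Qed.

Lemma dual_comul1r (f : D) :
  tlift (fun g h => (dual_counit g : K) *: h) (dual_comul f) = f.
Proof.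
apply/lfunP=> a; rewrite (tlift_linP (g := fun h : D => h a : K^o)).
  by rewrite -[in RHS](mul1r a) -dual_comulE; apply: eq_tlift => g h; rewrite dualZE.
by move=> c g h; rewrite dualDE dualZE.
Qed.

Lemma dual_comulr1 (f : D) :
  tlift (fun g h => (dual_counit h : K) *: g) (dual_comul f) = f.
Proof.
apply/lfunP=> a; rewrite (tlift_linP (g := fun h : D => h a : K^o)).
  rewrite -[in RHS](mulr1 a) -dual_comulE; apply: eq_tlift => g h.
  by rewrite dualZE; exact: mulrC.
by move=> c g h; rewrite dualDE dualZE.
Qed.

HB.instance Definition _ :=
  isCoalgebra.Build K D dual_comulA dual_comul1r dual_comulr1.

Lemma dual_comul_mul (f g : D) : comul (f * g) = tmul (comul f) (comul g).
Proof.
apply: dual_tensor2_sep => a b; rewrite dual_comulE dual_mulE comul_mul.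
pose L (X : tensor H H) : K^o := tlift (fun x y => f x * g y : K^o) X.
have Ll : linear L by move=> k X Y; rewrite /L linearP.
have LE x y : L (x \ox y) = f x * g y.
  rewrite /L tliftE // => [z d u v | z d u v].
  - by rewrite linearP /= mulrDl -scalerAl.
  - by rewrite linearP /= mulrDr -scalerAr.
rewrite -/(L _) (tlift_linP _ _ Ll) [RHS](tlift_linP _ _ (dual_eval2_linear a b)).
transitivity (tlift (fun a1 a2 => tlift (fun b1 b2 =>
    f (a1 * b1) * g (a2 * b2) : K^o) (comul b)) (comul a)).
  apply: eq_tlift => a1 a2; rewrite (tlift_linP _ _ Ll).
  by apply: eq_tlift => b1 b2; rewrite LE.
transitivity (tlift (fun f1 f2 : D => tlift (fun a1 a2 =>
    tlift (fun b1 b2 => f1 a1 * f2 b1 * g (a2 * b2) : K^o) (comul b))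
    (comul a)) (comul f)).
  rewrite [RHS]tlift_exchange; apply: eq_tlift => a1 a2.
  rewrite [RHS]tlift_exchange; apply: eq_tlift => b1 b2.
  by rewrite tlift_scalr -[f _]dual_comulE.
apply: eq_tlift => f1 f2; rewrite [RHS](tlift_linP _ _ (dual_eval2_linear a b)).
transitivity (tlift (fun g1 g2 : D => tlift (fun a1 a2 =>
    tlift (fun b1 b2 => f1 a1 * f2 b1 * (g1 a2 * g2 b2) : K^o) (comul b))
    (comul a)) (comul g)).
  rewrite [RHS]tlift_exchange; apply: eq_tlift => a1 a2.
  rewrite [RHS]tlift_exchange; apply: eq_tlift => b1 b2.
  by rewrite tlift_scall -[g _]dual_comulE.
apply: eq_tlift => g1 g2; rewrite dual_eval2E !dual_mulE -tlift_scalr.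
apply: eq_tlift => a1 a2; symmetry.
transitivity (tlift (fun x y => f1 a1 * g1 a2 * (f2 x * g2 y) : K^o) (comul b)).
  by rewrite tlift_scall.
by apply: eq_tlift => b1 b2; exact: mulrACA.
Qed.

Lemma dual_comul_one : comul (1 : D) = 1 \ox 1.
Proof.
apply: dual_tensor2_sep => a b.
by rewrite dual_comulE dual_eval2E !dual_oneE counit_mul.
Qed.

Lemma dual_counit_mul (f g : D) : counit (f * g) = (counit f : K) * counit g.
Proof.
rewrite -[LHS]/((f * g) 1) dual_mulE comul_one tliftE // => [z d u v | z d u v].
- by rewrite linearP /= mulrDl -scalerAl.
- by rewrite linearP /= mulrDr -scalerAr.
Qed.

Lemma dual_counit_one : counit (1 : D) = 1.
Proof. by rewrite -[LHS]/((1 : D) 1) dual_oneE counit_one. Qed.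

Definition dual_antipode (f : D) : D := linfun (f \o @antipode K H).

Lemma dual_antipodeE f x : dual_antipode f x = f (antipode x).
Proof. by rewrite lfunE. Qed.

Lemma dual_antipode_linear : linear dual_antipode.
Proof.
move=> a f g; apply/lfunP=> x.
by rewrite dualDE dualZE !dual_antipodeE dualDE dualZE.
Qed.

HB.instance Definition _ :=
  GRing.isLinear.Build K D D _ dual_antipode dual_antipode_linear.

Lemma dual_antipodel (f : D) :
  tlift (fun g h => dual_antipode g * h) (comul f) = (counit f : K) *: 1.
Proof.
apply/lfunP=> a; rewrite (tlift_linP (g := fun h : D => h a : K^o)); last first.
  by move=> c g h; rewrite dualDE dualZE.
rewrite dualZE dual_oneE -[counit f]/(f 1).
transitivity (f ((counit a : K) *: 1)); last by rewrite linearZ; exact: mulrC.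
rewrite -antipodel tlift_lin.
under eq_tlift => g h do rewrite dual_mulE.
rewrite tlift_exchange; apply: eq_tlift => a1 a2.
rewrite -[RHS]dual_comulE.
by apply: eq_tlift => g h; rewrite dual_antipodeE.
Qed.

Lemma dual_antipoder (f : D) :
  tlift (fun g h => g * dual_antipode h) (comul f) = (counit f : K) *: 1.
Proof.
apply/lfunP=> a; rewrite (tlift_linP (g := fun h : D => h a : K^o)); last first.
  by move=> c g h; rewrite dualDE dualZE.
rewrite dualZE dual_oneE -[counit f]/(f 1).
transitivity (f ((counit a : K) *: 1)); last by rewrite linearZ; exact: mulrC.
rewrite -antipoder tlift_lin.
under eq_tlift => g h do rewrite dual_mulE.
rewrite tlift_exchange; apply: eq_tlift => a1 a2.
rewrite -[RHS]dual_comulE.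
by apply: eq_tlift => g h; rewrite dual_antipodeE.
Qed.

HB.instance Definition _ := isHopf.Build K D dual_comul_mul dual_comul_one
  dual_counit_mul dual_counit_one dual_antipodel dual_antipoder.

End Dual.

Section CoalgebraNotions.
Variables (K : fieldType) (C : coalgType K).

Definition grouplike (g : C) := (comul g == g \ox g) && (counit g == 1).

Definition grouplike_order (m : nat) :=
  exists s : seq C, [/\ uniq s, forall g, (g \in s) = grouplike g & size s = m].

Definition in_grouplike_span (x : C) :=
  exists2 s : seq C, all grouplike s & x \in <<s>>%VS.

Definition tensv (U V : {vspace C}) : {vspace tensor C C} :=
  <<[seq u \ox v | u <- vbasis U, v <- vbasis V]>>%VS.

Definition subcoalgebra (D : {vspace C}) :=
  forall x, x \in D -> comul x \in tensv D D.

Definition simple_subcoalgebra (D : {vspace C}) :=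
  [/\ subcoalgebra D, D != 0%VS &
      forall E : {vspace C}, subcoalgebra E -> (E <= D)%VS ->
        E = 0%VS \/ E = D].

(* The sum of the family of all simple subcoalgebras: the elements lying in   *)
(* some finite partial sum.                                                   *)
Definition in_coradical (x : C) :=
  exists2 s : seq {vspace C},
    (forall D, D \in s -> simple_subcoalgebra D) & x \in (\sum_(D <- s) D)%VS.

Definition pointed := forall x : C, in_coradical x <-> in_grouplike_span x.

End CoalgebraNotions.

Section SemisimpleAlgebra.
Variables (K : fieldType) (A : falgType K).

Definition left_ideal (I : {vspace A}) := forall a x, x \in I -> a * x \in I.

Definition simple_left_ideal (I : {vspace A}) :=
  [/\ left_ideal I, I != 0%VS &
      forall J : {vspace A}, left_ideal J -> (J <= I)%VS -> J = 0%VS \/ J = I].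

(* The left regular module is a direct sum of simple submodules.              *)
Definition semisimple_algebra :=
  exists m (I : 'I_m -> {vspace A}),
    [/\ forall i, simple_left_ideal (I i), directv (\sum_(i < m) I i)%VS &
        (\sum_(i < m) I i)%VS = fullv].

End SemisimpleAlgebra.

Lemma tensv_mem (K : fieldType) (C : coalgType K) (U V : {vspace C}) u v :
  u \in U -> v \in V -> u \ox v \in tensv U V.
Proof.
move=> /coord_vbasis-> /coord_vbasis->.
pose L w : {linear C -> tensor C C} := HB.pack (fun v : C => v \ox w)
  (GRing.isLinear.Build K C (tensor C C) _ _ (tens_linearl w)).
pose R w : {linear C -> tensor C C} := HB.pack (fun v : C => w \ox v)
  (GRing.isLinear.Build K C (tensor C C) _ _ (tens_linearr w)).
rewrite -[_ \ox _]/(L _ _) linear_sum; apply: memv_suml => i _.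
rewrite linearZ memvZ //= -[_ \ox _]/(R _ _) linear_sum.
apply: memv_suml => j _; rewrite linearZ memvZ //= memv_span //.
by apply: allpairs_f; rewrite mem_nth ?size_tuple.
Qed.

(* Group-like elements of the dual are the algebra homomorphisms to K.        *)
Lemma grouplike_dualP (K : fieldType) (H : hopfAlgType K) (f : hopf_dual H) :
  grouplike f <-> f 1 = 1 /\ (forall a b, f (a * b) = f a * f b).
Proof.
rewrite /grouplike -[counit f]/(f 1); split=> [/andP[/eqP E /eqP f1]|[f1 fM]].
  by split=> // a b; rewrite -dual_comulE -[dual_comul f]/(comul f) E dual_eval2E.
rewrite f1 eqxx andbT; apply/eqP/dual_tensor2_sep => a b.
by rewrite dual_comulE dual_eval2E.
Qed.

(* Main.v *)
(* Put q = p^(n-1), A = H^* and G = G(A), a p-group of order q. By a           *)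
(* Nichols-Zoeller argument A is free over kG, so the algebra R of elements of *)
(* H invariant under the translations x |-> chi(x_1) x_2 (chi in G) has        *)
(* dimension p, and 1 is an average over G. As H is not semisimple, Radford's  *)
(* trace element shows that x |-> chi(x_1) S^2(x_2) c has trace 0 on H; summed *)
(* over G this says that y |-> S^2(y r) has trace 0 on R for every r in R.     *)
(* Group-like elements of a Hopf algebra of dimension p^n have order a power   *)
(* of p, so by Radford's formula S^4 has such an order as well. Hence S^2 has  *)
(* eigenvalues 1 and -1 on R, and since dim R = p the vanishing of its trace   *)
(* makes it unipotent. For a minimal idempotent e of R with eps(e) = 1 the map *)
(* y |-> S^2(y e) e is then unipotent on R e, so p divides dim R e, R e = R and*)
(* the augmentation ideal of R is nil. Thus every simple subcoalgebra D of A   *)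
(* contains some f <> 0 with f(r y) = eps(r) f(y) for r in R; such an f lies   *)
(* in kG, and D is spanned by an element of G.                                 *)

From HB Require Import structures.
Require Import Defs.
From Stdlib Require Import Classical.
From mathcomp Require Import all_boot all_order all_fingroup all_algebra all_solvable all_field all_character.

Set Implicit Arguments.
Unset Strict Implicit.
Unset Printing Implicit Defensive.

Import GRing.Theory.
Local Open Scope ring_scope.

(** * Sweedler notation *)

(** Write A for the dual, G for its group of group-likes, and R = [coinv iota] for the subalgebra of
    H fixed by G. By [pointed_of_simple] it is enough that each simple subcoalgebra D of A is a line
    spanned by a group-like. D is stable under f |-> f(y _) for y in H. If the augmentation ideal of
    R is nil, D contains some f <> 0 on which R acts by the counit ([nil_augmentation_invariant]).
    Such an f lies in the span of G ([invariant_grouplike_span]), and a suitable y isolates one g in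
    G, so D is the line of g ([simple_subcoalgebra_grouplike]).

    It remains to see that the augmentation ideal is nil ([coinv_nil]). The order of G enters
    through [grouplike_free]: A is free over kG of rank p, so dim R = p ([coinv_coframe]). An
    idempotent endomorphism of R with trace 0 is therefore 0 or 1, because p divides its rank
    ([rank_pchar_idempotent]). Nonsemisimplicity supplies vanishing traces: a nonzero trace in
    [antipode2_trace] would be the counit of an integral, against [maschke]. Summation over G gives
    trace 0 for y |-> S^2(y c) on R ([coinv_trace]).

    To use this, S must have finite order. Radford's formula [radford_S4] expresses S^4 by
    group-likes of H and A, whose orders divide p^n by an eigenvalue count ([grouplike_pchar_exp]).
    Then S^2 is unipotent on R ([trace0_unipotent]), and the vanishing traces force a minimal
    idempotent of augmentation 1 in R to be 1. *)

Definition sw (K : fieldType) (C : coalgType K) (U : vectType K)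
    (F : C -> C -> U) (x : C) : U := tlift F (comul x).

Section Linearity.
Variables (K : fieldType) (V U W : vectType K).

Lemma lin_id : linear (fun x : V => x).
Proof. by []. Qed.

Lemma lin_comp (g : {linear U -> W}) (f : V -> U) :
  linear f -> linear (fun x => g (f x)).
Proof. by move=> fl a x y; rewrite fl linearP. Qed.

Lemma lin_lfun (g : 'Hom(U, W)) (f : V -> U) :
  linear f -> linear (fun x => g (f x)).
Proof. by move=> fl a x y; rewrite fl linearP. Qed.

Lemma lin_eval (f : V -> 'Hom(U, W)) (y : U) :
  linear f -> linear (fun x => f x y).
Proof. by move=> fl a x z; rewrite fl add_lfunE scale_lfunE. Qed.

Lemma lin_scaler c (f : V -> U) : linear f -> linear (fun x => c *: f x).
Proof. by move=> fl a x y; rewrite fl scalerDr !scalerA mulrC. Qed.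

Lemma lin_scalel (f : V -> K^o) (u : U) :
  linear f -> linear (fun x => (f x : K) *: u).
Proof. by move=> fl a x y; rewrite fl scalerDl scalerA. Qed.

Lemma lin_sum (I : finType) (f : I -> V -> U) :
  (forall i, linear (f i)) -> linear (fun x => \sum_i f i x).
Proof.
move=> fl a x y; rewrite scaler_sumr -big_split.
by apply: eq_bigr => i _; rewrite fl.
Qed.

Lemma lin_smull (f : V -> K^o) (c : K) :
  linear f -> linear (fun x => (f x : K) * c : K^o).
Proof. by move=> fl a x y; rewrite fl mulrDl; congr (_ + _); exact/esym/mulrA. Qed.

Lemma lin_smulr (f : V -> K^o) (c : K) :
  linear f -> linear (fun x => c * (f x : K) : K^o).
Proof. by move=> fl a x y; rewrite fl mulrDr; congr (_ + _); exact: mulrCA. Qed.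

Lemma lin_tensl (f : V -> U) (w : W) : linear f -> linear (fun x => f x \ox w).
Proof. by move=> fl a x y; rewrite fl tens_linearl. Qed.

Lemma lin_tensr (f : V -> W) (u : U) : linear f -> linear (fun x => u \ox f x).
Proof. by move=> fl a x y; rewrite fl tens_linearr. Qed.

Lemma lin_tlift (V' : vectType K) (F : V -> U -> V' -> W) y :
  (forall a b, linear (fun x => F x a b)) -> linear (fun x => tlift (F x) y).
Proof.
move=> Fl a x z; rewrite -tliftZ -tliftD.
by apply: eq_tlift => b c; rewrite Fl.
Qed.

Lemma lin_tlift_arg (V' : vectType K) (F : U -> V' -> W) (f : V -> tensor U V') :
  linear f -> linear (fun x => tlift F (f x)).
Proof. by move=> fl a x y; rewrite fl linearP. Qed.
End Linearity.

Lemma linZ (K : fieldType) (V U : vectType K) (f : V -> U) c x :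
  linear f -> f (c *: x) = c *: f x.
Proof.
by move=> fl; rewrite (GRing.scalable_linear fl).
Qed.

Lemma lin_mull (K : fieldType) (V : vectType K) (A : falgType K) (f : V -> A) c :
  linear f -> linear (fun x => f x * c).
Proof. by move=> fl a x y; rewrite fl mulrDl -scalerAl. Qed.

Lemma lin_mulr (K : fieldType) (V : vectType K) (A : falgType K) (f : V -> A) c :
  linear f -> linear (fun x => c * f x).
Proof. by move=> fl a x y; rewrite fl mulrDr -scalerAr. Qed.

Lemma lin_sw (K : fieldType) (V U : vectType K) (C : coalgType K)
    (F : V -> C -> C -> U) y :
  (forall a b, linear (fun x => F x a b)) -> linear (fun x => sw (F x) y).
Proof. exact: lin_tlift. Qed.

Lemma lin_sw_arg (K : fieldType) (V U : vectType K) (C : coalgType K)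
    (F : C -> C -> U) (f : V -> C) :
  linear f -> linear (fun x => sw F (f x)).
Proof. by move=> fl; apply: lin_tlift_arg; apply: lin_comp. Qed.

Ltac lin1 := first
  [ assumption | exact: lin_id
  | apply: lin_sw_arg | apply: lin_sw => ? ?
  | apply: lin_mull | apply: lin_mulr | apply: lin_smull | apply: lin_smulr
  | apply: lin_scaler | apply: lin_scalel
  | apply: lin_tensl | apply: lin_tensr
  | apply: lin_lfun | apply: lin_comp | apply: lin_eval
  | apply: lin_tlift_arg | apply: lin_tlift => ? ?
  | apply: lin_sum => ? ].
Ltac lin := move=> *; repeat lin1.

Section Sweedler.
Variables (K : fieldType) (C : coalgType K).
Implicit Types (U : vectType K) (x y : C).

Lemma eq_sw U (F G : C -> C -> U) x : (forall a b, F a b = G a b) -> sw F x = sw G x.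
Proof. exact: eq_tlift. Qed.

Lemma sw_lin U U' (g : U -> U') (F : C -> C -> U) x :
  linear g -> g (sw F x) = sw (fun a b => g (F a b)) x.
Proof. exact: tlift_linP. Qed.

Lemma sw_sum (I : finType) U (F : I -> C -> C -> U) x :
  sw (fun a b => \sum_i F i a b) x = \sum_i sw (F i) x.
Proof. exact: tlift_sumE. Qed.

Lemma swZ U c (F : C -> C -> U) x : sw (fun a b => c *: F a b) x = c *: sw F x.
Proof. exact: tliftZ. Qed.

Lemma sw_exchange U (C' : coalgType K) (F : C -> C -> C' -> C' -> U) x (y : C') :
  sw (fun a b => sw (F a b) y) x = sw (fun c d => sw (fun a b => F a b c d) x) y.
Proof. exact: tlift_exchange. Qed.

(* No linearity of F is required, because tlift evaluates only on basis       *)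
(* vectors.                                                                   *)
Lemma sw_assoc U (F : C -> C -> C -> U) x :
  sw (fun a b => sw (fun a1 a2 => F a1 a2 b) a) x =
  sw (fun a b => sw (fun b1 b2 => F a b1 b2) b) x.
Proof.
pose e i := (vbasis {:C})`_i.
pose F' a b c : U := \sum_i \sum_j \sum_k
  (coord (vbasis {:C}) i a * coord (vbasis {:C}) j b * coord (vbasis {:C}) k c)
    *: F (e i) (e j) (e k).
have cE (i j : 'I_(\dim {:C})) : coord (vbasis {:C}) j (e i) = (i == j)%:R.
  by rewrite coord_free ?(basis_free (vbasisP _)).
have F'E (i j k : 'I_(\dim {:C})) : F' (e i) (e j) (e k) = F (e i) (e j) (e k).
  rewrite /F' (bigD1 i) //= (bigD1 j) //= (bigD1 k) //= !cE !eqxx !mulr1 scale1r.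
  rewrite !big1 ?addr0 // => l /negPf nl.
  - rewrite big1 // => m _; rewrite big1 // => r _.
    by rewrite !cE (eq_sym i) nl !mul0r scale0r.
  - by rewrite big1 // => m _; rewrite !cE (eq_sym j) nl mulr0 mul0r scale0r.
  - by rewrite !cE (eq_sym k) nl mulr0 scale0r.
have l1 b c : linear (fun a => F' a b c).
  apply: lin_sum => i; apply: lin_sum => j; apply: lin_sum => k.
  apply: lin_scalel; do 2!apply: lin_smull; by move=> r u v; rewrite linearP.
have l2 a c : linear (fun b => F' a b c).
  apply: lin_sum => i; apply: lin_sum => j; apply: lin_sum => k.
  apply: lin_scalel; apply: lin_smull; apply: lin_smulr; by move=> r u v; rewrite linearP.
have l3 a b : linear (F' a b).
  apply: lin_sum => i; apply: lin_sum => j; apply: lin_sum => k.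
  apply: lin_scalel; apply: lin_smulr; by move=> r u v; rewrite linearP.
pose T (z : tensor C (tensor C C)) : U := tlift (fun a w => tlift (F' a) w) z.
have TE a w : T (a \ox w) = tlift (F' a) w.
  rewrite /T tliftE // => [w'|a'].
    by apply: lin_tlift => b c; exact: l1.
  by apply: lin_tlift_arg; exact: lin_id.
have Tl : linear T by apply: lin_tlift_arg; exact: lin_id.
have /(congr1 T) := comulA x; rewrite !(tlift_linP _ _ Tl) => E.
transitivity (tlift (fun a b => tlift (fun a1 a2 => F' a1 a2 b) (comul a)) (comul x)).
  rewrite /sw /tlift; apply: eq_bigr => i _; apply: eq_bigr => j _; congr (_ *: _).
  by apply: eq_bigr => k _; apply: eq_bigr => l _; rewrite F'E.
transitivity (tlift (fun a b => tlift (fun b1 b2 => F' a b1 b2) (comul b)) (comul x)).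
  transitivity (tlift (fun a b => T (a \ox comul b)) (comul x)).
    rewrite -E; apply: eq_tlift => a b; rewrite (tlift_linP _ _ Tl).
    by apply: eq_tlift => c d; rewrite TE tliftE //; exact: l2.
  by apply: eq_tlift => a b; rewrite TE.
rewrite /sw /tlift; apply: eq_bigr => i _; apply: eq_bigr => j _; congr (_ *: _).
by apply: eq_bigr => k _; apply: eq_bigr => l _; rewrite F'E.
Qed.

Lemma sw_counitl U (f : C -> U) x :
  linear f -> sw (fun a b => (counit a : K) *: f b) x = f x.
Proof.
move=> fl; rewrite -[in RHS](comul1r x) (tlift_linP _ _ fl).
by apply: eq_tlift => a b; rewrite (linZ _ _ fl).
Qed.

Lemma sw_counitr U (f : C -> U) x :
  linear f -> sw (fun a b => (counit b : K) *: f a) x = f x.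
Proof.
move=> fl; rewrite -[in RHS](comulr1 x) (tlift_linP _ _ fl).
by apply: eq_tlift => a b; rewrite (linZ _ _ fl).
Qed.

End Sweedler.

(** * The antipode reverses products and coproducts *)

Section HopfSweedler.
Variables (K : fieldType) (H : hopfAlgType K).
Implicit Types (U : vectType K) (x y : H).

Lemma swM U (F : H -> H -> U) x y :
  (forall b, linear (F^~ b)) -> (forall a, linear (F a)) ->
  sw F (x * y) = sw (fun a b => sw (fun c d => F (a * c) (b * d)) y) x.
Proof.
move=> F1 F2; rewrite /sw comul_mul /tmul.
have Fl : linear (tlift F) by apply: lin_tlift_arg; exact: lin_id.
rewrite (tlift_linP _ _ Fl); apply: eq_tlift => a b.
by rewrite (tlift_linP _ _ Fl); apply: eq_tlift => c d; rewrite tliftE.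
Qed.

Lemma sw1 U (F : H -> H -> U) :
  (forall b, linear (F^~ b)) -> (forall a, linear (F a)) -> sw F 1 = F 1 1.
Proof. by move=> F1 F2; rewrite /sw comul_one tliftE. Qed.

Lemma sw_antipodel U (f : H -> U) x :
  linear f -> sw (fun a b => f (antipode a * b)) x = (counit x : K) *: f 1.
Proof. by move=> fl; rewrite -(linZ _ _ fl) -antipodel (tlift_linP _ _ fl). Qed.

Lemma sw_antipoder U (f : H -> U) x :
  linear f -> sw (fun a b => f (a * antipode b)) x = (counit x : K) *: f 1.
Proof. by move=> fl; rewrite -(linZ _ _ fl) -antipoder (tlift_linP _ _ fl). Qed.

Lemma sw_grouplike U (F : H -> H -> U) g : grouplike g ->
  (forall b, linear (F^~ b)) -> (forall a, linear (F a)) -> sw F g = F g g.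
Proof. by case/andP=> /eqP E _ F1 F2; rewrite /sw E tliftE. Qed.

(** S(xy) and S(y)S(x) are both convolution inverse to the multiplication: S(x_1 y_1) x_2 y_2 S(y_3)
    S(x_3) reduces to the one or the other, according to which factors are cancelled first. *)
Lemma antipodeM x y : antipode (x * y) = antipode y * antipode x.
Proof.
pose F (a b c d e f : H) := antipode (a * d) * ((b * e) * (antipode f * antipode c)).
transitivity (sw (fun a b => sw (fun b1 b2 => sw (fun c d =>
    sw (fun d1 d2 => F a b1 b2 c d1 d2) d) y) b) x).
  transitivity (sw (fun a b => (counit b : K) *: antipode (a * y)) x).
    by rewrite (sw_counitr (f := fun a => antipode (a * y))) //; lin.
  apply: eq_sw => a b.
  transitivity (sw (fun b1 b2 => antipode (a * y) * (b1 * antipode b2)) b).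
    by rewrite (sw_antipoder (f := fun z => antipode (a * y) * z)) ?mulr1 //; lin.
  apply: eq_sw => b1 b2.
  rewrite -(sw_counitr (f := fun c => antipode (a * c) * (b1 * antipode b2))); last by lin.
  apply: eq_sw => c d; rewrite /F.
  rewrite -[in LHS](mulr1 b1).
  rewrite -(sw_antipoder (f := fun z => antipode (a * c) * (b1 * z * antipode b2))); last by lin.
  by apply: eq_sw => d1 d2; rewrite !mulrA.
rewrite -(sw_assoc (fun a b1 b2 => sw (fun c d => sw (fun d1 d2 => F a b1 b2 c d1 d2) d) y)).
transitivity (sw (fun a b => (counit a : K) *: (antipode y * antipode b)) x); last first.
  by rewrite (sw_counitl (f := fun b => antipode y * antipode b)) //; lin.
apply: eq_sw => a b.
under eq_sw => a1 a2 do rewrite -sw_assoc.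
rewrite sw_exchange.
transitivity (sw (fun c d => (counit (a * c) : K) *: (antipode d * antipode b)) y).
  apply: eq_sw => c d; rewrite -[antipode d * _]mul1r.
  rewrite -(sw_antipodel (f := fun z => z * (antipode d * antipode b))); last by lin.
  rewrite swM; [|by lin|by lin].
  by apply: eq_sw => a1 a2; apply: eq_sw => c1 c2; rewrite /F !mulrA.
under eq_sw => c d do rewrite counit_mul -scalerA.
by rewrite swZ (sw_counitl (f := fun d => antipode d * antipode b)) //; lin.
Qed.

Lemma antipode1 : antipode (1 : H) = 1.
Proof.
have := antipodel (1 : H); rewrite -/(sw _ _) sw1; [|by lin|by lin].
by rewrite mulr1 counit_one scale1r.
Qed.

Lemma counit_antipode x : counit (antipode x) = counit x.
Proof.
have : counit (sw (fun a b => antipode a * b) x) = counit x.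
  by rewrite /sw antipodel linearZ /= counit_one; exact: mulr1.
rewrite (sw_lin _ _ (g := counit)); last by lin.
move=> <-; rewrite -[LHS](sw_counitr (f := fun a => counit (antipode a))); last by lin.
by apply: eq_sw => a b; rewrite counit_mul [LHS]mulrC.
Qed.

End HopfSweedler.

Section DualSweedler.
Variables (K : fieldType) (H : hopfAlgType K).
Local Notation A := (hopf_dual H).
Implicit Types (f g : A) (x y : H).

Lemma dualM f g x : (f * g) x = sw (fun a b => f a * g b : K^o) x.
Proof. exact: dual_mulE. Qed.

Lemma dual1 x : (1 : A) x = counit x.
Proof. exact: dual_oneE. Qed.

Lemma dualZ c f x : (c *: f) x = c * f x.
Proof. exact: dualZE. Qed.

Lemma dualD f g x : (f + g) x = f x + g x.
Proof. exact: dualDE. Qed.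

Lemma dualS f x : (antipode f : A) x = f (antipode x).
Proof. exact: dual_antipodeE. Qed.

Lemma dual_sw f x y : sw (fun g h : A => g x * h y : K^o) f = f (x * y).
Proof. exact: dual_comulE. Qed.

Lemma dual_eq0 x : (forall f : A, f x = 0) -> x = 0.
Proof.
move=> f0; rewrite (coord_vbasis (memvf x)) big1 // => i _.
by have := f0 (dual_basis i); rewrite lfunE /= => ->; rewrite scale0r.
Qed.

Lemma dual_inj x y : (forall f : A, f x = f y) -> x = y.
Proof.
by move=> fE; apply/eqP; rewrite -subr_eq0; apply/eqP/dual_eq0 => f; rewrite linearB /= fE subrr.
Qed.

Lemma tensor_dual_inj (X Y : tensor H H) :
  (forall f g : A, tlift (fun a b => f a * g b : K^o) X =
                   tlift (fun a b => f a * g b : K^o) Y) -> X = Y.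
Proof.
move=> XY; apply/matrixP => i j.
have E (Z : tensor H H) :
    tlift (fun a b => dual_basis i a * dual_basis j b : K^o) Z = Z i j.
  rewrite -[in RHS](tlift_tens Z).
  rewrite (tlift_linP (g := fun Z : tensor H H => Z i j : K^o)).
    by apply: eq_tlift => a b; rewrite !lfunE mxE.
  by move=> a u v; rewrite !mxE.
by rewrite -!E XY.
Qed.

(** Tested against f and g in the dual, the coproduct of S(x) becomes [antipodeM] for the dual Hopf
    algebra. *)
Lemma sw_antipode (U : vectType K) (F : H -> H -> U) x :
  (forall b, linear (F^~ b)) -> (forall a, linear (F a)) ->
  sw F (antipode x) = sw (fun a b => F (antipode b) (antipode a)) x.
Proof.
move=> F1 F2.
have E : comul (antipode x) = sw (fun a b => antipode b \ox antipode a) x.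
  apply: tensor_dual_inj => f g; rewrite -/(sw _ _) -dualM -dualS antipodeM dualM.
  rewrite /sw (tlift_linP (g := tlift (fun a b => f a * g b : K^o))); last by lin.
  apply: eq_tlift => a b; rewrite tliftE; [|by lin|by lin].
  by rewrite !dualS; exact: mulrC.
rewrite {1}/sw E (sw_lin _ _ (g := tlift F)); last by lin.
by apply: eq_sw => a b; rewrite tliftE.
Qed.

Lemma dual_dim : \dim {: A} = \dim {: H}.
Proof. by rewrite !dimvf /dim /= muln1. Qed.

End DualSweedler.

Lemma linfunE (K : fieldType) (V U : vectType K) (f : V -> U) x :
  linear f -> linfun f x = f x.
Proof.
move=> fl; pose F : {linear V -> U} := HB.pack f (GRing.isLinear.Build K V U _ f fl).
exact: (lfunE F).
Qed.

Lemma lin_fsum (K : fieldType) (V U : vectType K) (f : V -> U) (I : finType) (F : I -> V) :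
  linear f -> f (\sum_i F i) = \sum_i f (F i).
Proof.
move=> fl; pose L : {linear V -> U} := HB.pack f (GRing.isLinear.Build K V U _ f fl).
exact: (linear_sum L).
Qed.

Lemma linear_inj_surj (K : fieldType) (V U : vectType K) (f : V -> U) :
  linear f -> (forall x, f x = 0 -> x = 0) -> (\dim {:U} <= \dim {:V})%N ->
  forall u, exists x, f x = u.
Proof.
move=> fl fi dU u.
have ker0 : lker (linfun f) == 0%VS.
  by rewrite -subv0; apply/subvP=> x; rewrite memv_ker linfunE // memv0 => /eqP/fi ->.
have : limg (linfun f) = fullv.
  apply/eqP; rewrite eqEdim subvf /= limg_dim_eq //.
  by move/eqP: ker0 => ->; rewrite capv0.
move=> E; have : u \in limg (linfun f) by rewrite E memvf.
  case/memv_imgP=> x _ ->; by exists x; rewrite linfunE.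
Qed.

(** * Integrals *)

Section Integrals.
Variables (K : fieldType) (H : hopfAlgType K).
Local Notation A := (hopf_dual H).
Local Notation S := (@antipode K H).
Local Notation e i := (vbasis {:H})`_i.
Local Notation dim := (\dim {:H}).
Implicit Types (f g : A) (x y h : H) (U : vectType K).

(* H^* is a right H-Hopf module for the action ract; integral_proj projects it *)
(* onto its coinvariants, which are the left integrals.                       *)
Definition ract f h : A := linfun (fun x => f (x * S h) : K^o).
Definition rhit h f : A := linfun (fun x => f (x * h) : K^o).

Lemma ractE f h x : ract f h x = f (x * S h).
Proof. by rewrite linfunE //; lin. Qed.

Lemma rhitE f h x : rhit h f x = f (x * h).
Proof. by rewrite linfunE //; lin. Qed.

Lemma ract_linl h : linear (ract^~ h).
Proof. by move=> a f g; apply/lfunP=> x; rewrite !(ractE, dualD, dualZ). Qed.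

Lemma ract_linr f : linear (ract f).
Proof.
move=> a x y; apply/lfunP=> z; rewrite !(ractE, dualD, dualZ).
by rewrite linearP mulrDr -scalerAr linearP.
Qed.

Lemma rhit_linr f : linear (rhit^~ f).
Proof.
move=> a x y; apply/lfunP=> z; rewrite !(rhitE, dualD, dualZ).
by rewrite mulrDr -scalerAr linearP.
Qed.

Lemma lin_ractl (V : vectType K) (u : V -> A) h : linear u -> linear (fun v : V => ract (u v) h).
Proof. by move=> ul a x y; rewrite ul ract_linl. Qed.

Lemma lin_ractr (V : vectType K) (u : V -> H) f : linear u -> linear (fun v : V => ract f (u v)).
Proof. by move=> ul a x y; rewrite ul ract_linr. Qed.

Lemma lin_rhit (V : vectType K) (u : V -> H) f : linear u -> linear (fun v : V => rhit (u v) f).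
Proof. by move=> ul a x y; rewrite ul rhit_linr. Qed.

Ltac linr := move=> *; repeat first
  [apply: lin_ractl | apply: lin_ractr | apply: lin_rhit | lin1].

Lemma ract1 f : ract f 1 = f.
Proof. by apply/lfunP=> x; rewrite ractE antipode1 mulr1. Qed.

Lemma ractM f h k : ract (ract f h) k = ract f (h * k).
Proof. by apply/lfunP=> x; rewrite !ractE antipodeM mulrA. Qed.

Lemma basisE x : x = \sum_(i < dim) dual_basis i x *: e i.
Proof.
rewrite {1}(coord_vbasis (memvf x)); apply: eq_bigr => i _.
by rewrite lfunE.
Qed.

(** For the canonical element c = sum_k e^k (x) e_k, applying the coproduct to the second factor
    gives c_12 c_13. *)
Lemma dual_basisM U (B : A -> H -> H -> U) :
  (forall a b, linear (fun f => B f a b)) ->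
  \sum_(k < dim) sw (B (dual_basis k)) (e k) =
  \sum_(i < dim) \sum_(j < dim) B (dual_basis i * dual_basis j) (e i) (e j).
Proof.
move=> Bl; pose L a b : {linear A -> U} :=
  HB.pack (fun f => B f a b) (GRing.isLinear.Build K A U _ (fun f => B f a b) (Bl a b)).
rewrite /sw /tlift exchange_big; apply: eq_bigr => i _.
rewrite exchange_big; apply: eq_bigr => j _.
rewrite [in RHS](dual_basisE (dual_basis i * dual_basis j)).
rewrite -[RHS]/(L (e i) (e j) _) linear_sum; apply: eq_bigr => k _.
rewrite linearZ /=; congr (_ *: _).
rewrite dualM /sw /tlift (bigD1 i) //= (bigD1 j) //=.
have cE (r s : 'I_dim) : dual_basis r (e s) = (s == r)%:R.
  by rewrite lfunE /= coord_free ?(basis_free (vbasisP _)).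
rewrite !cE !eqxx !big1 => [|s /negPf si|s /negPf sj].
- by rewrite !addr0 mulr1; exact/esym/mulr1.
- by rewrite big1 // => t _; rewrite !cE si mul0r scaler0.
- by rewrite !cE sj mulr0 scaler0.
Qed.

(** The Hopf module compatibility of convolution with [ract]; it follows by inserting S(h_2) h_3
    into the argument of g. *)
Lemma mul_ract g f h : g * ract f h = sw (fun h1 h2 => ract (rhit h2 g * f) h1) h.
Proof.
apply/lfunP=> x.
rewrite (sw_lin _ _ (g := fun f : A => f x : K^o)); last by linr.
rewrite dualM.
transitivity (sw (fun a b => sw (fun h1 h2 => sw (fun k1 k2 =>
   g (a * S k2 * h2) * f (b * S k1) : K^o) h1) h) x).
  apply: eq_sw => a b; rewrite sw_assoc ractE.
  rewrite -(sw_counitr (f := fun h => g a * f (b * S h) : K^o)); last by lin.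
  apply: eq_sw => h1 h2.
  transitivity (sw (fun k1 k2 => g (a * (S k1 * k2)) * f (b * S h1) : K^o) h2).
    by rewrite (sw_antipodel (f := fun z => g (a * z) * f (b * S h1) : K^o)) ?mulr1 //; lin.
  by apply: eq_sw => k1 k2; rewrite mulrA.
rewrite sw_exchange; apply: eq_sw => h1 h2.
rewrite ractE dualM swM; [|by lin|by lin]; apply: eq_sw => a b.
rewrite sw_antipode; [|by linr|by linr].
by apply: eq_sw => k1 k2; rewrite rhitE.
Qed.

Definition integral_proj f : A := \sum_(k < dim) ract (dual_basis k * f) (S (e k)).

Definition left_integral (l : A) := forall g, g * l = (g 1 : K) *: l.

Lemma rhit_antipode_sum g : \sum_(i < dim) rhit (S (e i)) g * dual_basis i = (g 1 : K) *: (1 : A).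
Proof.
apply/lfunP=> y; rewrite sum_lfunE dualZ dual1.
transitivity (sw (fun a b => g (a * S b) : K^o) y); last first.
  rewrite (sw_antipoder (f := fun z => g z)); last by lin.
  exact: mulrC.
under eq_bigr => i _ do rewrite dualM.
rewrite -sw_sum; apply: eq_sw => a b.
rewrite [in RHS](basisE b) linear_sum mulr_sumr linear_sum; apply: eq_bigr => i _.
by rewrite rhitE linearZ -scalerAr linearZ /=; exact: mulrC.
Qed.

Lemma integral_proj_integral f : left_integral (integral_proj f).
Proof.
move=> g; rewrite /integral_proj mulr_sumr.
transitivity (\sum_(k < dim)
    sw (fun a b => ract (rhit (S a) g * (dual_basis k * f)) (S b)) (e k)).
  apply: eq_bigr => k _; rewrite mul_ract sw_antipode //; linr.
rewrite (dual_basisM (B := fun k a b => ract (rhit (S a) g * (k * f)) (S b))); last by linr.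
rewrite exchange_big scaler_sumr; apply: eq_bigr => j _.
transitivity (ract ((\sum_(i < dim) rhit (S (e i)) g * dual_basis i) * (dual_basis j * f)) (S (e j))).
  pose L : {linear A -> A} := HB.pack (ract^~ (S (e j)))
    (GRing.isLinear.Build K A A _ (ract^~ (S (e j))) (ract_linl _)).
  rewrite mulr_suml -[RHS]/(L _) linear_sum; apply: eq_bigr => i _.
  by rewrite /= !mulrA.
by rewrite rhit_antipode_sum -scalerAl mul1r (linZ _ _ (ract_linl _)).
Qed.

(** The decomposition in the structure theorem of Hopf modules: f is rebuilt from integrals, so
    these cannot all vanish. *)
Lemma integral_projK f : \sum_(k < dim) ract (integral_proj (dual_basis k * f)) (e k) = f.
Proof.
transitivity (\sum_(j < dim) \sum_(k < dim) ract (dual_basis j * dual_basis k * f) (S (e j) * e k)).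
  rewrite exchange_big; apply: eq_bigr => k _; rewrite /integral_proj.
  pose L : {linear A -> A} := HB.pack (ract^~ (e k))
    (GRing.isLinear.Build K A A _ (ract^~ (e k)) (ract_linl _)).
  rewrite -[LHS]/(L _) linear_sum; apply: eq_bigr => j _.
  by rewrite /= ractM mulrA.
rewrite -(dual_basisM (B := fun k a b => ract (k * f) (S a * b))); last by linr.
transitivity (\sum_(k < dim) (counit (e k) : K) *: (dual_basis k * f)).
  apply: eq_bigr => k _.
  by rewrite (sw_antipodel (f := ract (dual_basis k * f))) ?ract1 //; linr.
transitivity ((\sum_(k < dim) ((1 : A) (e k) : K) *: (dual_basis k : A) : A) * f); last first.
  by rewrite -dual_basisE mul1r.
by rewrite mulr_suml; apply: eq_bigr => k _; rewrite dual1 scalerAl.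
Qed.

Lemma left_integral_exists : exists2 l : A, l != 0 & left_integral l.
Proof.
have [k Ek] : exists k : 'I_dim, integral_proj (dual_basis k) != 0.
  apply/existsP; apply: contraT => /existsPn E0.
  have /eqP := oner_neq0 A; rewrite -[1]integral_projK big1 // => k _.
  have /negPn/eqP := E0 k; rewrite mulr1 => ->.
  by apply/lfunP=> x; rewrite ractE !zero_lfunE.
by exists (integral_proj (dual_basis k)) => //; exact: integral_proj_integral.
Qed.

Section LeftIntegral.
Variable l : A.
Hypotheses (l0 : l != 0) (lI : left_integral l).

Lemma basis_ract k h :
  dual_basis k * ract l h = sw (fun h1 h2 => dual_basis k h2 *: ract l h1) h.
Proof.
rewrite mul_ract; apply: eq_sw => h1 h2.
by rewrite lI rhitE mul1r (linZ _ _ (ract_linl _)).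
Qed.

Lemma integral_proj_ract h : integral_proj (ract l h) = (counit h : K) *: l.
Proof.
transitivity (sw (fun h1 h2 => ract l (h1 * S h2)) h).
  rewrite /integral_proj.
  transitivity (\sum_(k < dim) sw (fun h1 h2 => dual_basis k h2 *: ract l (h1 * S (e k))) h).
    apply: eq_bigr => k _; rewrite basis_ract.
    rewrite (sw_lin _ _ (ract_linl _)); apply: eq_sw => a b.
    by rewrite (linZ _ _ (ract_linl _)) ractM.
  rewrite -sw_sum; apply: eq_sw => a b.
  rewrite {2}(basisE b) linear_sum mulr_sumr.
  rewrite (lin_fsum _ (ract_linr l)); apply: eq_bigr => k _ /=.
  by rewrite linearZ -scalerAr (linZ _ _ (ract_linr l)).
by rewrite (sw_antipoder (f := ract l)) ?ract1 //; linr.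
Qed.

(** Projecting the product of e^k and [ract l h] onto the integrals returns e^k(h) l, so every
    coordinate of h can be recovered. *)
Lemma ract_integral_inj h : ract l h = 0 -> h = 0.
Proof.
move=> lh0; rewrite (basisE h) big1 // => k _.
suff -> : dual_basis k h = 0 by rewrite scale0r.
have : integral_proj (dual_basis k * ract l h) = dual_basis k h *: l.
  rewrite basis_ract.
  have El : linear integral_proj.
    by apply: lin_sum => j; apply: lin_ractl; apply: lin_mulr; exact: lin_id.
  rewrite (sw_lin _ _ El).
  transitivity (sw (fun h1 h2 => (counit h1 : K) *: (dual_basis k h2 *: l)) h).
    by apply: eq_sw => a b; rewrite (linZ _ _ El) integral_proj_ract !scalerA mulrC.
  by rewrite (sw_counitl (f := fun z => dual_basis k z *: l)) //; linr.
rewrite lh0 mulr0 /integral_proj big1 => [/esym/eqP|j _].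
  by rewrite scaler_eq0 (negPf l0) orbF => /eqP.
by rewrite mulr0; apply/lfunP=> x; rewrite ractE !zero_lfunE.
Qed.

Lemma ract_integral_surj f : exists h, ract l h = f.
Proof.
apply: linear_inj_surj; [exact: ract_linr | exact: ract_integral_inj |].
by rewrite dual_dim.
Qed.

End LeftIntegral.

Lemma left_integral_unique l m :
  l != 0 -> left_integral l -> left_integral m -> exists c, m = c *: l.
Proof.
move=> l0 lI mI; have [h hE] := ract_integral_surj l0 lI m.
exists (counit h : K); rewrite -integral_proj_ract // hE.
by rewrite -[m in integral_proj m]ract1 integral_proj_ract // counit_one scale1r.
Qed.

(** The injective map [ract l] factors through S. *)
Lemma antipode_inj x y : S x = S y -> x = y.
Proof.
move=> xy; apply/eqP; rewrite -subr_eq0; apply/eqP.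
have [l l0 lI] := left_integral_exists.
apply: (ract_integral_inj l0 lI); apply/lfunP=> z.
by rewrite ractE linearB /= xy subrr mulr0 linear0 zero_lfunE.
Qed.

Lemma antipode_surj y : exists x, S x = y.
Proof.
apply: linear_inj_surj => //; first by lin.
by move=> x Sx0; apply: antipode_inj; rewrite Sx0 linear0.
Qed.

Section Nondegenerate.
Variable l : A.
Hypotheses (l0 : l != 0) (lI : left_integral l).

Lemma integral_nondegr y : (forall x, l (x * y) = 0) -> y = 0.
Proof.
have [h <-] := antipode_surj y => h0; rewrite (ract_integral_inj l0 lI (h := h)) ?linear0 //.
by apply/lfunP=> x; rewrite ractE h0 zero_lfunE.
Qed.

Lemma integral_reprr f : exists y, forall x, l (x * y) = f x.
Proof. by have [h <-] := ract_integral_surj l0 lI f; exists (S h) => x; rewrite ractE. Qed.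

Lemma integral_nondegl x : (forall y, l (x * y) = 0) -> x = 0.
Proof.
move=> x0; apply: dual_eq0 => f; have [y <-] := integral_reprr f; exact: x0.
Qed.

Lemma integral_reprl f : exists x, forall y, l (x * y) = f y.
Proof.
pose T x : A := linfun (fun y => l (x * y) : K^o).
have TE x y : T x y = l (x * y) by rewrite linfunE //; lin.
have [||| x xE] := @linear_inj_surj _ _ _ T _ _ _ f.
- by move=> a x y; apply/lfunP=> z; rewrite dualD dualZ !TE mulrDl -scalerAl linearP.
- by move=> x x0; apply: integral_nondegl => y; rewrite -TE x0 zero_lfunE.
- by rewrite dual_dim.
by exists x => y; rewrite -TE xE.
Qed.

Lemma integral_sw x : sw (fun a b => (l b : K) *: a) x = (l x : K) *: 1.
Proof.
apply: dual_inj => f; have := lI f => /lfunP/(_ x).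
rewrite dualM dualZ => E; rewrite linearZ /= -[RHS]mulrC -E.
rewrite (sw_lin _ _ (g := f)); last by lin.
by apply: eq_sw => a b; rewrite linearZ; exact: mulrC.
Qed.

End Nondegenerate.
End Integrals.

(** * Group-like elements and winding maps *)

Section Grouplike.
Variables (K : fieldType) (H : hopfAlgType K).
Local Notation S := (@antipode K H).
Implicit Types (g h x y : H).

Lemma grouplike_counit g : grouplike g -> counit g = 1.
Proof. by case/andP=> _ /eqP. Qed.

Lemma grouplikeVl g : grouplike g -> S g * g = 1.
Proof.
move=> gg; have := antipodel g; rewrite -/(sw _ _) sw_grouplike //; [|by lin|by lin].
by rewrite grouplike_counit // scale1r.
Qed.

Lemma grouplikeVr g : grouplike g -> g * S g = 1.
Proof.
move=> gg; have := antipoder g; rewrite -/(sw _ _) sw_grouplike //; [|by lin|by lin].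
by rewrite grouplike_counit // scale1r.
Qed.

Lemma grouplike1 : grouplike (1 : H).
Proof. by rewrite /grouplike comul_one counit_one !eqxx. Qed.

Lemma grouplikeM g h : grouplike g -> grouplike h -> grouplike (g * h).
Proof.
move=> gg gh; rewrite /grouplike counit_mul !grouplike_counit // mul1r eqxx andbT.
have E x : comul x = sw (@tens K H H) x by rewrite /sw tlift_tens.
by rewrite E swM ?sw_grouplike //; lin.
Qed.

Lemma grouplikeS g : grouplike g -> grouplike (S g).
Proof.
move=> gg; rewrite /grouplike counit_antipode grouplike_counit // eqxx andbT.
have E x : comul x = sw (@tens K H H) x by rewrite /sw tlift_tens.
by rewrite E sw_antipode ?sw_grouplike //; lin.
Qed.

Lemma grouplikeX g n : grouplike g -> grouplike (g ^+ n).
Proof.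
move=> gg; elim: n => [|n IH]; first by rewrite expr0 grouplike1.
by rewrite exprS grouplikeM.
Qed.

Lemma grouplike_neq0 g : grouplike g -> g != 0.
Proof.
move=> gg; apply/eqP=> g0; have := grouplike_counit gg.
by rewrite g0 linear0 => /esym/eqP; rewrite oner_eq0.
Qed.

Lemma grouplike_antipodeK g : grouplike g -> S (S g) = g.
Proof.
move=> gg; rewrite -[S (S g)]mulr1 -(grouplikeVl gg) mulrA.
by rewrite grouplikeVl ?grouplikeS // mul1r.
Qed.
End Grouplike.

Section Winding.
Variables (K : fieldType) (H : hopfAlgType K).
Local Notation A := (hopf_dual H).
Local Notation S := (@antipode K H).
Implicit Types (f g : A) (x y : H).

(** [windl f] and [windr f] are the transposes of left and right multiplication by f on the dual, so
    composing the [windl] reverses products. *)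
Definition windl f x : H := sw (fun a b => (f a : K) *: b) x.
Definition windr f x : H := sw (fun a b => (f b : K) *: a) x.

Lemma windl_linear f : linear (windl f).
Proof. by rewrite /windl; lin. Qed.

Lemma windlE f g x : g (windl f x) = (f * g) x.
Proof.
rewrite dualM (sw_lin _ _ (g := fun z => g z)); last by lin.
by apply: eq_sw => a b; rewrite linearZ.
Qed.

Lemma windrE f g x : g (windr f x) = (g * f) x.
Proof.
rewrite dualM (sw_lin _ _ (g := fun z => g z)); last by lin.
by apply: eq_sw => a b; rewrite linearZ; exact: mulrC.
Qed.

Lemma windl_comp f g x : windl f (windl g x) = windl (g * f) x.
Proof. by apply: dual_inj => h; rewrite !windlE mulrA. Qed.

Lemma windr_comp f g x : windr f (windr g x) = windr (f * g) x.
Proof. by apply: dual_inj => h; rewrite !windrE mulrA. Qed.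

Lemma windlr f g x : windl f (windr g x) = windr g (windl f x).
Proof. by apply: dual_inj => h; rewrite !(windlE, windrE) mulrA. Qed.

Lemma windl1 x : windl 1 x = x.
Proof. by apply: dual_inj => h; rewrite windlE mul1r. Qed.

Lemma windr1 x : windr 1 x = x.
Proof. by apply: dual_inj => h; rewrite windrE mulr1. Qed.

Lemma iter_windl f n x : iter n (windl f) x = windl (f ^+ n) x.
Proof.
by elim: n => [|n IH] /=; rewrite ?expr0 ?windl1 // IH windl_comp exprSr.
Qed.

Lemma iter_windr f n x : iter n (windr f) x = windr (f ^+ n) x.
Proof.
by elim: n => [|n IH] /=; rewrite ?expr0 ?windr1 // IH windr_comp exprS.
Qed.

Lemma antipode2_windl f x : grouplike f -> S (S (windl f x)) = windl f (S (S x)).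
Proof.
move=> gf; apply: dual_inj => h.
by rewrite windlE -!dualS windlE !antipodeM (grouplike_antipodeK gf).
Qed.

Lemma antipode2_windr f x : grouplike f -> S (S (windr f x)) = windr f (S (S x)).
Proof.
move=> gf; apply: dual_inj => h.
by rewrite windrE -!dualS windrE !antipodeM (grouplike_antipodeK gf).
Qed.

Lemma grouplike_dualM f x y : grouplike f -> f (x * y) = f x * f y.
Proof. by case/grouplike_dualP. Qed.

Lemma grouplike_dual1 f : grouplike f -> f 1 = 1.
Proof. by case/grouplike_dualP. Qed.

End Winding.

(** * Radford's formula for the fourth power of the antipode *)

Section Radford.
Variables (K : fieldType) (H : hopfAlgType K).
Local Notation A := (hopf_dual H).
Local Notation S := (@antipode K H).
Variable l : A.
Hypotheses (l0 : l != 0) (lI : left_integral l).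
Implicit Types (f : A) (x y z : H).

(** By uniqueness of integrals, l f is a multiple of l for each f. The factor is multiplicative in f
    and is evaluation at an element g, which is therefore group-like. *)
Lemma distinguished_grouplike :
  exists2 g : H, grouplike g & forall x, windl l x = (l x : K) *: g.
Proof.
have [x0 lx0] : exists x, l x = 1.
  have [u uE] := integral_reprl l0 lI (1 : A).
  by exists (u * 1); rewrite uE dual1 counit_one.
pose g := windl l x0.
have lf f : l * f = (f g : K) *: l.
  have lfI : left_integral (l * f) by move=> h; rewrite mulrA lI -scalerAl.
  have [c cE] := left_integral_unique l0 lI lfI.
  by rewrite /g windlE cE dualZ lx0 mulr1.
have lE x : windl l x = (l x : K) *: g.
  by apply: dual_inj => f; rewrite windlE lf dualZ linearZ /=; exact: mulrC.
exists g => //; rewrite /grouplike.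
have fM f f' : (f * f') g = f g * f' g.
  by rewrite /g windlE mulrA lf -scalerAl lf scalerA dualZ lx0 mulr1.

apply/andP; split; last by rewrite -dual1 /g windlE mulr1 lx0.
apply/eqP/tensor_dual_inj => f f'; rewrite -/(sw _ _) -dualM fM tliftE //; lin.
Qed.

(** Both sides equal S(x_1) x_2 z_1 l(x_3 z_2): cancel S(x_1) x_2 for the left one, apply
    [integral_sw] to x_2 z for the right one. *)
Lemma integral_sw_l x z :
  sw (fun a b => (l (x * b) : K) *: a) z = sw (fun a b => (l (b * z) : K) *: S a) x.
Proof.
rewrite -[LHS](sw_counitl (f := fun x => sw (fun a b => (l (x * b) : K) *: a) z)); last by lin.
symmetry.
transitivity (sw (fun a b => sw (fun b1 b2 => S a * sw (fun c d => (l (b2 * d) : K) *: (b1 * c)) z) b) x).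
  apply: eq_sw => a b; rewrite -[S a in LHS]mulr1 scalerAr -(integral_sw lI).
  rewrite (sw_lin _ _ (g := fun u => S a * u)); last by lin.
  rewrite swM; [|by lin|by lin]; apply: eq_sw => b1 b2.
  by rewrite (sw_lin _ _ (g := fun u => S a * u)); last by lin.
rewrite -sw_assoc; apply: eq_sw => a b.
transitivity (sw (fun a1 a2 => (S a1 * a2) * sw (fun c d => (l (b * d) : K) *: c) z) a).
  apply: eq_sw => a1 a2; rewrite -mulrA; congr (_ * _).
  rewrite [RHS](sw_lin _ _ (g := fun u => a2 * u)); last by lin.
  by apply: eq_sw => c d; rewrite scalerAr.
rewrite (sw_antipodel (f := fun u => u * _)); last by lin.
by rewrite mul1r.
Qed.

(** Stated on a basis, the property is boolean, as [xchoose] requires. *)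
Lemma nakayama_ex y : exists z, [forall i : 'I_(\dim {:H}),
  l (y * (vbasis {:H})`_i) == l ((vbasis {:H})`_i * z)].
Proof.
pose T : A := linfun (fun x => l (y * x) : K^o).
have TE x : T x = l (y * x) by rewrite linfunE //; lin.
by have [z zE] := integral_reprr l0 lI T; exists z; apply/forallP => i; rewrite zE TE.
Qed.

Definition nakayama y := xchoose (nakayama_ex y).

Lemma nakayamaE y x : l (y * x) = l (x * nakayama y).
Proof.
have /forallP zE := xchooseP (nakayama_ex y); rewrite (basisE x).
rewrite mulr_sumr mulr_suml !linear_sum; apply: eq_bigr => i _.
by rewrite -scalerAl -scalerAr !linearZ /= (eqP (zE i)).
Qed.

Lemma nakayama_uniq y z : (forall x, l (y * x) = l (x * z)) -> z = nakayama y.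
Proof.
move=> zE; apply/eqP; rewrite -subr_eq0; apply/eqP/(integral_nondegr l0 lI) => x.
by rewrite mulrBr linearB /= -zE nakayamaE subrr.
Qed.

Lemma nakayama_linear : linear nakayama.
Proof.
move=> a y z; symmetry; apply: nakayama_uniq => x.
by rewrite mulrDl mulrDr -scalerAl -scalerAr linearP [RHS]linearP /= (nakayamaE y) (nakayamaE z).
Qed.

Lemma nakayamaM y z : nakayama (y * z) = nakayama y * nakayama z.
Proof.
symmetry; apply: nakayama_uniq => x.
by rewrite -mulrA nakayamaE -mulrA nakayamaE mulrA.
Qed.

Lemma nakayama1 : nakayama 1 = 1.
Proof. by symmetry; apply: nakayama_uniq => x; rewrite mul1r mulr1. Qed.

Definition modular : A := linfun (fun y => counit (nakayama y) : K^o).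

Lemma modularE y : modular y = counit (nakayama y).
Proof. by rewrite linfunE // => a x z; rewrite nakayama_linear linearP. Qed.

Lemma modular_grouplike : grouplike modular.
Proof.
apply/grouplike_dualP; split=> [|a b]; first by rewrite modularE nakayama1 counit_one.
by rewrite !modularE nakayamaM counit_mul.
Qed.

(** Let nu = [nakayama]. Two uses of [integral_sw_l], joined by the Nakayama identity, turn l(x
    nu(y)_2) nu(y)_1 into l(x nu(y_2)) S^2(y_1). Taking x = u with l(u _) the counit extracts
    nu(y). *)
Lemma nakayama_antipode y : nakayama y = S (S (windr modular y)).
Proof.
have E x : sw (fun a b => (l (x * b) : K) *: a) (nakayama y) =
    sw (fun a b => (l (x * nakayama b) : K) *: S (S a)) y.
  rewrite integral_sw_l.
  transitivity (S (sw (fun a b => (l (y * b) : K) *: a) x)).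
    rewrite (sw_lin _ _ (g := S)); last by lin.
    by apply: eq_sw => a b; rewrite linearZ /= nakayamaE.
  rewrite integral_sw_l (sw_lin _ _ (g := S)); last by lin.
  by apply: eq_sw => a b; rewrite linearZ /= (nakayamaE b).
have [u uE] := integral_reprl l0 lI (1 : A).
rewrite -[LHS](sw_counitr (f := id)) //.
transitivity (sw (fun a b => (l (u * b) : K) *: a) (nakayama y)).
  by apply: eq_sw => a b; rewrite uE dual1.
rewrite E [RHS](sw_lin _ _ (g := fun z => S (S z))); last by lin.
by apply: eq_sw => a b; rewrite uE dual1 -modularE !linearZ.
Qed.

(** Composition with S exchanges the two sides of an integral and g corrects this: x |-> l(S(x) g)
    is again a left integral, hence a multiple of l. *)
Lemma integral_antipode g : grouplike g -> (forall x, windl l x = (l x : K) *: g) ->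
  exists2 c : K, c != 0 & forall x, l (S x * g) = c * l x.
Proof.
move=> gg lg; pose m : A := linfun (fun x => l (S x * g) : K^o).
have mE x : m x = l (S x * g) by rewrite linfunE //; lin.
have mI : left_integral m.
  move=> f; apply/lfunP=> x; rewrite dualM dualZ.
  have E : sw (fun a b => (l (S b * g) : K) *: a) x = (m x : K) *: 1.
    apply: antipode_inj; rewrite linearZ /= antipode1 (sw_lin _ _ (g := S)); last by lin.
    transitivity (((m x : K) *: g) * S g); last by rewrite -scalerAl grouplikeVr.
    rewrite mE -lg /windl.
    rewrite swM; [|by lin|by lin].
    rewrite sw_antipode; [|by lin|by lin].
    rewrite [RHS](sw_lin _ _ (g := fun z => z * S g)); last by lin.
    apply: eq_sw => a b; rewrite sw_grouplike //; [|by lin|by lin].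
    by rewrite -scalerAl -mulrA grouplikeVr // mulr1 linearZ.
  transitivity (f (sw (fun a b => (l (S b * g) : K) *: a) x)).
    rewrite (sw_lin _ _ (g := fun z => f z)); last by lin.
    by apply: eq_sw => a b; rewrite mE linearZ; exact: mulrC.
  by rewrite E linearZ /=; exact: mulrC.
have [c cE] := left_integral_unique l0 lI mI.
exists c => [|x]; last by rewrite -mE cE dualZ.
apply: contra_neq l0 => c0; apply/lfunP=> y; rewrite zero_lfunE.
have [x xE] := antipode_surj (y * S g).
by rewrite -[y]mulr1 -(grouplikeVl gg) mulrA -xE -mE cE c0 dualZ mul0r.
Qed.

End Radford.

(* l and l o S are integrals on opposite sides, so their Nakayama             *)
(* automorphisms, both computed from S^2, differ by conjugation by g.         *)
Theorem radford_S4 (K : fieldType) (H : hopfAlgType K) :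
  exists (g : H) (f : hopf_dual H), [/\ grouplike g, grouplike f &
    forall y : H, antipode g * y * g =
      iter 4 (@antipode K H) (windl (antipode f) (windr f y))].
Proof.
pose S := @antipode K H.
have [l l0 lI] := left_integral_exists H.
have [g gg lg] := distinguished_grouplike l0 lI.
have [c c0 lc] := integral_antipode l0 lI gg lg.
pose nu := nakayama l0 lI; pose f := modular l0 lI.
have gf : grouplike f := modular_grouplike l0 lI.
have nuE z : nu z = S (S (windr f z)) := nakayama_antipode l0 lI z.
have lnu y x : l (y * x) = l (x * nu y) := nakayamaE l0 lI y x.
exists g, f; split=> // y.
(* Paired with l(S(x) _), both sides give c l(y x): the left one since S(x) S(y) = S(y x), the right
   one by moving S(nu(y)), and then y, across l. *)
have SyE : S y * g = g * nu (S (nu y)).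
  apply/eqP; rewrite -subr_eq0; apply/eqP/(integral_nondegr l0 lI) => z.
  rewrite mulrBr linearB /=; apply/eqP; rewrite subr_eq0; apply/eqP.
  have [x <-] := antipode_surj z.
  by rewrite !mulrA -antipodeM lc lnu -lc antipodeM -mulrA lnu.
have windrS z : windr f (S z) = S (windl (antipode f) z).
  by apply: dual_inj => h; rewrite windrE -!dualS windlE antipodeM.
apply: antipode_inj; rewrite !antipodeM grouplike_antipodeK // mulrA.
rewrite -[X in X = _]mulrA SyE mulrA grouplikeVl // mul1r nuE nuE.
by rewrite windrS /= -(antipode2_windl _ (grouplikeS gf)).
Qed.

Lemma iter_comm_comp (T : Type) (f g : T -> T) n x :
  (forall x, f (g x) = g (f x)) ->
  iter n (fun x => f (g x)) x = iter n f (iter n g x).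
Proof.
move=> fg; have fgn m y : g (iter m f y) = iter m f (g y).
  by elim: m => //= m <-.
by elim: n => //= n ->; rewrite fgn.
Qed.

(** In Radford's formula S^4 commutes with the winding maps, and these, like the conjugation, become
    trivial in the N-th power. *)
Lemma antipode_finite_order (K : fieldType) (H : hopfAlgType K) N :
  (forall g : H, grouplike g -> g ^+ N = 1) ->
  (forall f : hopf_dual H, grouplike f -> f ^+ N = 1) ->
  forall y, iter (N * 4) (@antipode K H) y = y.
Proof.
move=> gN fN y; have [g [f [gg gf E]]] := radford_S4 H.
pose phi y := windl (antipode f) (windr f y).
have conjE : iter N (fun y => antipode g * y * g) y = y.
  have conjn n : iter n (fun y => antipode g * y * g) y = antipode g ^+ n * y * g ^+ n.
    elim: n => [|n /= ->]; first by rewrite !expr0 mul1r mulr1.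
    by rewrite [g ^+ n.+1]exprSr exprS !mulrA.
  by rewrite conjn !gN ?grouplikeS // mul1r mulr1.
rewrite -[in RHS]conjE.
transitivity (iter N (fun y => iter 4 (@antipode K H) (phi y)) y); last first.
  by apply: eq_iter => z; rewrite E.
rewrite (iter_comm_comp (f := iter 4 (@antipode K H)) (g := phi)); last first.
  by move=> z; rewrite /phi /= !(antipode2_windl _ (grouplikeS gf)) !(antipode2_windr _ gf).
rewrite /phi (iter_comm_comp N y (windlr (antipode f) f)).
rewrite iter_windr iter_windl !fN ?grouplikeS // windl1 windr1.
by rewrite iterM.
Qed.

(** * Orders of group-like elements *)

Lemma exprBn_comm_pchar (R : nzRingType) (p m : nat) (x y : R) :
  p \in [pchar R] -> GRing.comm x y ->
  (x - y) ^+ (p ^ m) = x ^+ (p ^ m) - y ^+ (p ^ m).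
Proof.
move=> pR xy; elim: m => [|m IH]; first by rewrite !expn0 !expr1.
rewrite expnSr !exprM IH -!(pFrobenius_autE pR) pFrobenius_autB_comm //.
by apply: commrX; apply/commr_sym/commrX/commr_sym.
Qed.

Lemma expr_pchar_inj (K : fieldType) (p m : nat) :
  p \in [pchar K] -> injective (fun x : K => x ^+ (p ^ m)).
Proof.
move=> pK x y /eqP; rewrite -subr_eq0 -(exprBn_comm_pchar _ pK (mulrC _ _)) expf_eq0 subr_eq0.
by case/andP=> _ /eqP.
Qed.

(** Let q = p^m. The product of the X - r^q over the distinct eigenvalues r kills A^q: by Frobenius
    it is the value at A of the product of the (X - r)^q, a multiple of the characteristic
    polynomial since q bounds all multiplicities. *)
Lemma diagonalizable_pchar_exp (K : closedFieldType) (p m n : nat) (A : 'M[K]_n.+1) :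
  p \in [pchar K] -> (n.+1 <= p ^ m)%N -> diagonalizable (A ^+ (p ^ m)).
Proof.
move=> pK le_n; set q := (p ^ m)%N.
have pKX : p \in [pchar {poly K}] by rewrite pchar_poly.
have [rs charE] := closed_field_poly_normal (char_poly A).
have /eqP lead1 := char_poly_monic A.
rewrite lead1 scale1r in charE.
have szrs : size rs = n.+1.
  by have := size_char_poly A; rewrite charE size_prod_XsubC => -[].
apply/diagonalizableP; exists [seq r ^+ q | r <- undup rs].
  by rewrite map_inj_uniq ?undup_uniq //; exact: expr_pchar_inj.
apply: mxminpoly_min; rewrite big_map rmorph_prod /=.
transitivity (horner_mx A (\prod_(r <- undup rs) ('X - r%:P) ^+ q)).
  rewrite rmorph_prod; apply: eq_bigr => r _.
  rewrite (exprBn_comm_pchar _ pKX (mulrC _ _)) !rmorphB /= !rmorphXn /= !horner_mx_X !horner_mx_C.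
  by rewrite -rmorphXn /=.
suff /dvdpP[u ->] : char_poly A %| \prod_(r <- undup rs) ('X - r%:P) ^+ q.
  by rewrite rmorphM /= Cayley_Hamilton mulr0.
rewrite charE -(@big_undup_iterop_count _ 1 _ _ rs).
elim: (undup rs) => [|r s IH]; first by rewrite !big_nil dvdpp.
rewrite !big_cons dvdp_mul //.
have -> : iterop (count_mem r rs) *%R ('X - r%:P) 1 = ('X - r%:P) ^+ count_mem r rs by [].
by rewrite dvdp_exp2l // (leq_trans _ le_n) // -szrs count_size.
Qed.

Lemma size_undup_count (T : eqType) (s : seq T) :
  size s = \sum_(x <- undup s) count_mem x s.
Proof.
rewrite -[LHS]sum1_size -(@big_undup_iterop_count _ 0%N addn); apply: eq_bigr => x _.
by rewrite Monoid.iteropE iter_addn mul1n addn0.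
Qed.

(* A value of maximal multiplicity M satisfies n M <= \sum_k #(x / d_k) <= n M,*)
(* so the values form a group on which the multiplicity is constantly M; its  *)
(* order divides p ^ m, hence it is trivial.                                  *)
Lemma eigenvalues_trivial (K : fieldType) (p m n : nat) (d : 'I_n -> K)
    (s : 'I_n * 'I_n -> 'I_n * 'I_n) :
  p \in [pchar K] -> n = (p ^ m)%N -> (forall i, d i != 0) -> injective s ->
  (forall ij, d ij.1 = d (s ij).1 * d (s ij).2) -> forall i, d i = 1.
Proof.
move=> pK nE d0 sI ds i0.
pose c x := #|[set i | d i == x]|.
(* There are n c(x) pairs (i, j) with d_i = x. The injection [s] sends them to pairs with d_k d_l =
   x, which the right side counts by k. *)
have c_le x : (n * c x <= \sum_k c (x / d k)%R)%N.
  have -> : (n * c x = #|setX [set i | d i == x] [set: 'I_n]|)%N.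
    by rewrite cardsX cardsT card_ord mulnC.
  have -> : (\sum_k c (x / d k)%R = #|[set ij : 'I_n * 'I_n | (d ij.1 * d ij.2 == x)%R]|)%N.
    rewrite -[RHS]sum1_card; under [RHS]eq_bigl => ij do rewrite inE.
    rewrite -(pair_big_dep xpredT (fun i j => d i * d j == x) (fun _ _ => 1%N)) /=.
    apply: eq_bigr => k _; rewrite /c -sum1_card; apply: eq_bigl => j.
    by rewrite inE -(inj_eq (mulfI (d0 k))) mulrCA mulfV ?mulr1.
  rewrite -[leqLHS](card_imset _ sI); apply/subset_leq_card/subsetP => kl.
  by case/imsetP => ij; rewrite !inE andbT => /eqP <- ->; rewrite -ds.
have [i1 _ i1max] := @arg_maxnP _ i0 xpredT (fun i => c (d i)) isT.
pose M := c (d i1).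
have cM x : (c x <= M)%N.
  have [/existsP[i /eqP<-]|] := boolP [exists i, d i == x]; first exact: i1max.
  rewrite negb_exists => /forallP nx; rewrite /c (_ : [set i | d i == x] = set0) ?cards0 //.
  by apply/setP => i; rewrite !inE; exact/negbTE.
have M0 : (0 < M)%N by apply/card_gt0P; exists i1; rewrite inE.
have cdiv j k : c (d j) = M -> c (d j / d k) = M.
  move=> cj; apply/eqP; rewrite eqn_leq cM leqNgt; apply/negP => lt.
  have := c_le (d j); rewrite cj leqNgt => /negP[].
  rewrite -[X in (_ < X * _)%N]card_ord -sum_nat_const (bigD1 k) //=.
  by rewrite [X in (_ < X)%N](bigD1 k) //= -addSn leq_add // leq_sum.
have c_ex x : c x = M -> exists l, d l = x.
  by move=> cx; have := M0; rewrite -cx => /card_gt0P[l]; rewrite inE => /eqP <-; exists l.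
have cE k : c (d k) = M.
  have [l lE] := c_ex _ (cdiv i1 k erefl).
  have := cdiv i1 l erefl; rewrite lE invf_div mulrC divfK //.
have ddiv j k : exists l, d l = d j / d k by apply/c_ex/cdiv/cE.
pose D := undup (codom d).
have DP x : reflect (exists i, d i = x) (x \in D).
  rewrite mem_undup; apply: (iffP codomP) => -[i]; first by move->; exists i.
  by move<-; exists i.
have szD : (size D * M = p ^ m)%N.
  rewrite -nE -[RHS]card_ord -(size_codom d) [RHS]size_undup_count -/D.
  rewrite (eq_big_seq (fun=> M)) => [|x /DP[i <-]].
    by rewrite big_const_seq count_predT iter_addn addn0 mulnC.
  rewrite -(cE i) -sum1_count /codom /image_mem big_map big_enum_cond /c -sum1_card.
  by apply: eq_bigl => j; rewrite inE.
have [b szDE] : exists b, size D = (p ^ b)%N.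
  have /dvdn_pfactor : (size D %| p ^ m)%N by rewrite -szD dvdn_mulr.
  by case=> [|b _ ->]; [exact: (pcharf_prime pK) | exists b].
have permD : perm_eq [seq d i0 * y | y <- D] D.
  have uD : uniq [seq d i0 * y | y <- D].
    by rewrite map_inj_uniq ?undup_uniq //; exact: mulfI.
  have sD : {subset [seq d i0 * y | y <- D] <= D}.
    move=> _ /mapP[_ /DP[l <-] ->]; apply/DP.
    have [e eE] := ddiv l l; have [l' l'E] := ddiv e l; have [k kE] := ddiv i0 l'.
    by exists k; rewrite kE l'E eE mulfV // mul1r invrK.
  apply: uniq_perm; rewrite ?undup_uniq // => x.
  by have [|_ ->] := uniq_min_size uD sD; rewrite ?size_map.
(* Multiplication by d_i0 permutes D, so its |D|-th power is 1; |D| is a power of p and Frobenius is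
   injective. *)
apply: (@expr_pchar_inj K p b pK); rewrite -szDE expr1n.
have : \prod_(y <- D) (d i0 * y) = \prod_(y <- D) y.
  by rewrite -[RHS](perm_big _ permD) big_map.
rewrite big_split big_const_seq count_predT iter_mulr_1.
have P0 : \prod_(y <- D) y != 0.
  by rewrite prodf_seq_neq0; apply/allP => _ /DP[l <-]; exact: d0.
by move/(canRL (mulfK P0)) => ->; rewrite mulfV.
Qed.

(** * Bases with dual functionals, and matrices of endomorphisms *)

Section Coframe.
Variables (K : fieldType) (V : vectType K) (n : nat).
Implicit Types (v : 'I_n -> V) (phi : 'I_n -> 'Hom(V, K^o)) (X : {vspace V}) (T : V -> V).

(** The functionals are defined on all of V, so endomorphisms of X can be handled as maps of V
    preserving X. *)
Definition coframe v phi X :=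
  [/\ forall i, v i \in X, forall i j, phi j (v i) = (i == j)%:R &
      forall x, x \in X -> x = \sum_i (phi i x : K) *: v i].

(** Row i holds the coordinates of T(v_i): matrices act on rows from the right, and the map applied
    first is the left factor. *)
Definition mxframe v phi T : 'M[K]_n := \matrix_(i, j) phi j (T (v i)).

Variables (v : 'I_n -> V) (phi : 'I_n -> 'Hom(V, K^o)) (X : {vspace V}).
Hypothesis vphi : coframe v phi X.

Lemma coframeE x : x \in X -> x = \sum_i (phi i x : K) *: v i.
Proof. by case: vphi => _ _; apply. Qed.

Lemma coframe_dual i j : phi j (v i) = (i == j)%:R.
Proof. by case: vphi. Qed.

Lemma coframe_mem i : v i \in X.
Proof. by case: vphi. Qed.

Lemma coframe_eq x y : x \in X -> y \in X -> (forall i, phi i x = phi i y) -> x = y.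
Proof.
move=> xX yX xy; rewrite (coframeE xX) (coframeE yX).
by apply: eq_bigr => i _; rewrite xy.
Qed.

Lemma mxframe_apply T x j : linear T -> x \in X ->
  phi j (T x) = \sum_i phi i x * mxframe v phi T i j.
Proof.
move=> Tl xX; rewrite {1}(coframeE xX) (lin_fsum _ Tl) linear_sum.
by apply: eq_bigr => i _; rewrite (linZ _ _ Tl) linearZ mxE.
Qed.

Lemma mxframe_comp T T' : linear T' -> (forall x, x \in X -> T x \in X) ->
  mxframe v phi (fun x => T' (T x)) = mxframe v phi T *m mxframe v phi T'.
Proof.
move=> T'l TX; apply/matrixP=> i j; rewrite !mxE mxframe_apply ?TX ?coframe_mem //.
by apply: eq_bigr => k _; rewrite [in RHS]mxE.
Qed.

Lemma mxframe_id : mxframe v phi id = 1%:M.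
Proof. by apply/matrixP=> i j; rewrite !mxE coframe_dual. Qed.

Lemma mxframe_inj T T' : (forall x, x \in X -> T x \in X) ->
  (forall x, x \in X -> T' x \in X) -> linear T -> linear T' ->
  mxframe v phi T = mxframe v phi T' -> forall x, x \in X -> T x = T' x.
Proof.
move=> TX T'X Tl T'l E x xX; apply: coframe_eq; rewrite ?TX ?T'X // => i.
by rewrite !mxframe_apply // E.
Qed.

End Coframe.

Lemma mxframe_iter (K : fieldType) (V : vectType K) (n q : nat) (v : 'I_n.+1 -> V)
    (phi : 'I_n.+1 -> 'Hom(V, K^o)) (X : {vspace V}) (T : V -> V) :
  coframe v phi X -> linear T -> (forall x, x \in X -> T x \in X) ->
  mxframe v phi (iter q T) = mxframe v phi T ^+ q.
Proof.
move=> vphi Tl TX; elim: q => [|q IH]; first exact: mxframe_id vphi.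
rewrite exprSr -IH -mulmxE -(mxframe_comp vphi) // => x xX.
by elim: q {IH} => //= q; exact: TX.
Qed.

Lemma coframe_basis (K : fieldType) (V : vectType K) n (b : n.-tuple V) (X : {vspace V}) :
  basis_of X b ->
  coframe (fun i => b`_i) (fun i => linfun (coord b i : V -> K^o)) X.
Proof.
move=> bX; split=> [i|i j|x xX].
- by rewrite (basis_mem bX) // mem_nth ?size_tuple.
- by rewrite lfunE /= coord_free ?(basis_free bX) // eq_sym.
- by rewrite {1}(coord_basis bX xX); apply: eq_bigr => i _; rewrite lfunE.
Qed.

Lemma coframe_vbasis (K : fieldType) (V : vectType K) n :
  \dim {:V} = n -> exists (v : 'I_n -> V) (phi : 'I_n -> 'Hom(V, K^o)), coframe v phi fullv.
Proof. by move<-; do 2!eexists; exact: coframe_basis (vbasisP _). Qed.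

Lemma eigenframe_pchar_exp (K : closedFieldType) (p m n : nat) (V : vectType K) (T : V -> V) :
  p \in [pchar K] -> linear T -> \dim {:V} = n -> (n <= p ^ m)%N ->
  exists (v : 'I_n -> V) (phi : 'I_n -> 'Hom(V, K^o)) (d : 'I_n -> K),
    coframe v phi fullv /\ forall i, iter (p ^ m) T (v i) = d i *: v i.
Proof.
move=> pK Tl dV nq; have [v [phi vphi]] := coframe_vbasis dV.
case: n nq dV v phi vphi => [|n] nq dV v phi vphi.
  by exists v, phi, (fun i => 0); split=> // -[].
have [P Punit] := diagonalizable_pchar_exp (mxframe v phi T) pK nq.
move/(diagonalizable_forLR Punit) => [d]; rewrite mxpoly.conjVmx // => dE.
rewrite -(mxframe_iter _ vphi Tl) in dE; last by move=> *; rewrite memvf.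
pose v' i := \sum_j P i j *: v j.
pose phi' k : 'Hom(V, K^o) := \sum_j (invmx P j k : K) *: phi j.
have phi'E k x : phi' k x = \sum_j phi j x * invmx P j k.
  rewrite /phi' sum_lfunE; apply: eq_bigr => j _.
  by rewrite scale_lfunE; exact: mulrC.
have phiv' i j : phi j (v' i) = P i j.
  rewrite /v' linear_sum (bigD1 j) //= linearZ /= (coframe_dual vphi) eqxx big1.
    by rewrite addr0; exact: mulr1.
  by move=> k /negPf kj; rewrite linearZ /= (coframe_dual vphi) kj; exact: mulr0.
have vP x : x = \sum_i (phi' i x : K) *: v' i.
  apply: (coframe_eq vphi); rewrite ?memvf // => j; rewrite linear_sum.
  transitivity (((\row_i phi i x) *m invmx P *m P) 0 j).
    by rewrite mulmxKV // mxE.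
  rewrite mxE; apply: eq_bigr => i _; rewrite linearZ /= phiv' phi'E mxE.
  by congr (_ * _); apply: eq_bigr => k _; rewrite mxE.
exists v', phi', (fun i => d 0 i); split.
  split=> [i|i j|x _]; rewrite ?memvf //.
  have /matrixP/(_ i j) := mulmxV Punit; rewrite !mxE => <-.
  by rewrite phi'E; apply: eq_bigr => k _; rewrite phiv'.
have iterl : linear (iter (p ^ m) T).
  by elim: (p ^ m)%N => [|k IH] a x y //=; rewrite IH Tl.
move=> i; apply: (coframe_eq vphi); rewrite ?memvf // => j.
rewrite (mxframe_apply vphi) ?memvf // linearZ /= phiv'.
transitivity ((P *m mxframe v phi (iter (p ^ m) T)) i j).
  by rewrite mxE; apply: eq_bigr => k _; rewrite phiv'.
by rewrite dE !mulmxA mulmxV // mul1mx mul_diag_mx mxE.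
Qed.

Lemma det_neq0_perm (F : fieldType) n (A : 'M[F]_n) :
  \det A != 0 -> exists s : {perm 'I_n}%type, forall i : 'I_n, A i (s i) != 0.
Proof.
move=> detA.
suff /existsP[s /forallP sP] : [exists s : {perm 'I_n}%type, [forall i, A i (s i) != 0]].
  by exists s.
apply: contraR detA => /existsPn noS.
apply/eqP; rewrite /determinant big1 // => s _.
have := noS s; rewrite negb_forall => /existsP[i /negPn/eqP Ai].
by rewrite (bigD1 i) //= Ai mul0r mulr0.
Qed.

Section GrouplikeOrder.
Variables (K : fieldType) (H : hopfAlgType K) (n : nat).
Variables (v : 'I_n -> H) (phi : 'I_n -> hopf_dual H).
Hypothesis vphi : coframe v phi fullv.
Local Notation S := (@antipode K H).

(* The matrix of the Galois map x (x) y |-> x_1 (x) x_2 y and of its inverse   *)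
(* x (x) y |-> x_1 (x) S(x_2) y.                                              *)
Definition galois (x y : H) (kl : 'I_n * 'I_n) : K^o :=
  sw (fun a b => phi kl.1 a * phi kl.2 (b * y) : K^o) x.
Definition galois_inv (x y : H) (kl : 'I_n * 'I_n) : K^o :=
  sw (fun a b => phi kl.1 a * phi kl.2 (S b * y) : K^o) x.

Lemma galoisK i j (kl : 'I_n * 'I_n) :
  \sum_ij galois (v i) (v j) ij * galois_inv (v ij.1) (v ij.2) kl =
  (i == kl.1)%:R * (j == kl.2)%:R.
Proof.
transitivity (sw (fun a b => galois_inv a (b * v j) kl) (v i)).
  rewrite -(pair_bigA _ (fun k l => galois (v i) (v j) (k, l) * galois_inv (v k) (v l) kl)) /=.
  transitivity (sw (fun a b => \sum_k \sum_l
    ((phi k a * phi l (b * v j)) * galois_inv (v k) (v l) kl : K^o)) (v i)).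
    rewrite sw_sum; apply: eq_bigr => k _; rewrite sw_sum; apply: eq_bigr => l _.
    by rewrite /galois /sw tlift_scalr.
  apply: eq_sw => a b.
  have l1 y : linear (fun x => galois_inv x y kl) by rewrite /galois_inv; lin.
  have l2 x : linear (fun y => galois_inv x y kl) by rewrite /galois_inv; lin.
  rewrite {2}(coframeE vphi (memvf a)) (lin_fsum _ (l1 _)); apply: eq_bigr => k _.
  rewrite (linZ _ _ (l1 _)) {2}(coframeE vphi (memvf (b * v j))) (lin_fsum _ (l2 _)).
  rewrite scaler_sumr; apply: eq_bigr => l _.
  by rewrite (linZ _ _ (l2 _)) scalerA.
rewrite /galois_inv sw_assoc.
transitivity (sw (fun a b => (counit b : K) *: (phi kl.1 a * phi kl.2 (v j) : K^o)) (v i)).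
  apply: eq_sw => a b.
  transitivity (sw (fun b1 b2 => phi kl.1 a * phi kl.2 (S b1 * b2 * v j) : K^o) b).
    by apply: eq_sw => b1 b2; rewrite mulrA.
  by rewrite (sw_antipodel (f := fun z => phi kl.1 a * phi kl.2 (z * v j) : K^o)) ?mul1r //; lin.
rewrite (sw_counitr (f := fun a => phi kl.1 a * phi kl.2 (v j) : K^o)); last by lin.
by rewrite !(coframe_dual vphi).
Qed.

(** The Galois map is invertible, so the expansion of its determinant has a nonzero term, which is
    [s]. *)
Lemma galois_perm : exists2 s : 'I_n * 'I_n -> 'I_n * 'I_n,
  injective s & forall ij, galois (v ij.1) (v ij.2) (s ij) != 0.
Proof.
pose N := #|{: 'I_n * 'I_n}|.
pose A : 'M[K]_N := \matrix_(x, y) galois (v (enum_val x).1) (v (enum_val x).2) (enum_val y).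
pose B : 'M[K]_N := \matrix_(x, y) galois_inv (v (enum_val x).1) (v (enum_val x).2) (enum_val y).
have AB : A *m B = 1%:M.
  apply/matrixP=> x y; rewrite !mxE.
  transitivity (\sum_ij galois (v (enum_val x).1) (v (enum_val x).2) ij *
      galois_inv (v ij.1) (v ij.2) (enum_val y)).
    rewrite [RHS](reindex (@enum_val _ {: 'I_n * 'I_n})) /=.
      by apply: eq_bigr => z _; rewrite !mxE.
    by exists enum_rank => z _; rewrite ?enum_valK ?enum_rankK.
  by rewrite galoisK -natrM mulnb -(inj_eq enum_val_inj).
have /det_neq0_perm[s sP] : \det A != 0.
  apply/eqP=> A0; have := congr1 determinant AB.
  by rewrite det_mulmx A0 mul0r det1 => /eqP; rewrite eq_sym oner_eq0.
exists (fun ij => enum_val (s (enum_rank ij))).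
  by move=> x y /enum_val_inj/perm_inj/enum_rank_inj.
by move=> ij; have := sP (enum_rank ij); rewrite mxE enum_rankK.
Qed.

(** For group-like h the Galois map carries h (x) 1 to h (x) h, so each nonzero entry forces d_i =
    d_k d_l. *)
Lemma galois_eigen h (d : 'I_n -> K) : grouplike h -> (forall i, h * v i = d i *: v i) ->
  forall i y kl, d i * galois (v i) y kl = d kl.1 * d kl.2 * galois (v i) y kl.
Proof.
move=> gh hv i y [k l] /=.
have phih a j : phi j (h * a) = d j * phi j a.
  rewrite {1}(coframeE vphi (memvf a)) mulr_sumr linear_sum (bigD1 j) //= big1.
    rewrite addr0 -scalerAr hv !linearZ /= (coframe_dual vphi) eqxx.
    by rewrite mulrC; congr (_ * _); exact: mulr1.
  move=> r /negPf rj; rewrite -scalerAr hv !linearZ /= (coframe_dual vphi) rj.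
  by rewrite -[d r *: 0]/(d r * 0) mulr0; exact: mulr0.
transitivity (galois (h * v i) y (k, l)).
  rewrite hv /galois.
  have gl : linear (sw (fun a b => phi k a * phi l (b * y) : K^o)) by lin.
  by rewrite (linZ _ _ gl).
rewrite /galois swM; [|by lin|by lin].
rewrite sw_grouplike //; [|by lin|by lin].
transitivity (sw (fun a b => d k * d l * (phi k a * phi l (b * y)) : K^o) (v i)).
  2: exact: tlift_scall.
apply: (@eq_sw _ _ K^o) => a b /=.
by rewrite -mulrA !phih mulrACA.
Qed.

End GrouplikeOrder.

(** Left multiplication by h = g^(p^m) is diagonalizable, and the nonzero Galois entries give its
    eigenvalues the relations that [eigenvalues_trivial] needs to make them all 1. *)
Theorem grouplike_pchar_exp (K : closedFieldType) (p m : nat) (H : hopfAlgType K) :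
  p \in [pchar K] -> \dim {:H} = (p ^ m)%N ->
  forall g : H, grouplike g -> g ^+ (p ^ m) = 1.
Proof.
move=> pK dH g gg; have gl : linear (fun x : H => g * x) by lin.
have [v [phi [d [vphi dE]]]] := eigenframe_pchar_exp pK gl dH (leqnn _).
pose h := g ^+ (p ^ m); have gh : grouplike h by exact: grouplikeX.
have hv i : h * v i = d i *: v i.
  rewrite -dE /h; elim: (p ^ m)%N => [|k IH]; first by rewrite expr0 mul1r.
  by rewrite exprS /= -IH mulrA.
have d0 i : d i != 0.
  apply/eqP=> di0; have := grouplikeVl gh => /(congr1 (fun z => z * v i)).
  rewrite -mulrA hv di0 scale0r mulr0 mul1r => /esym vi0.
  have := coframe_dual vphi i i; rewrite vi0 linear0 eqxx => /esym/eqP.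
  by rewrite oner_eq0.
have [s sI sP] := galois_perm vphi.
have d1 : forall i, d i = 1.
  apply: (eigenvalues_trivial pK erefl d0 sI) => ij.
  by apply: (mulIf (sP ij)); exact: (galois_eigen vphi gh hv).
rewrite -/h -[h]mulr1 [in LHS](coframeE vphi (memvf 1)) mulr_sumr.
rewrite [RHS](coframeE vphi (memvf 1)); apply: eq_bigr => i _.
by rewrite -scalerAr hv d1 scale1r.
Qed.

(** * Maschke's theorem and the trace of the squared antipode *)

Lemma ex_least (P : nat -> Prop) :
  (exists n, P n) -> exists2 n, P n & forall m, P m -> (n <= m)%N.
Proof.
case=> n; have [N] := ubnP n; elim: N n => // N IH n /ltnSE nN Pn.
have [[m [Pm mn]]|no] := classic (exists m, P m /\ (m < n)%N).
  exact: (IH m (leq_trans mn nN)).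
exists n => // m Pm; rewrite leqNgt; apply/negP => mn; apply: no; by exists m.
Qed.

Section SimpleIdeals.
Variables (K : fieldType) (A : falgType K).
Implicit Types (I J U : {vspace A}).

Lemma left_ideal_simple U : left_ideal U -> U != 0%VS ->
  exists2 I, simple_left_ideal I & (I <= U)%VS.
Proof.
move=> lU U0; pose P n := exists I, [/\ left_ideal I, I != 0%VS, (I <= U)%VS & \dim I = n].
have [|n [I [lI I0 IU dI]] nmin] := @ex_least P.
  by exists (\dim U), U; rewrite subvv.
exists I => //; split=> // J lJ JI.
have [->|J0] := eqVneq J 0%VS; [by left | right].
apply/eqP; rewrite eqEdim JI /= dI; apply: nmin; exists J; split=> //.
exact: subv_trans JI IU.
Qed.

Lemma left_ideal_cap I J : left_ideal I -> left_ideal J -> left_ideal (I :&: J)%VS.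
Proof. by move=> lI lJ a x; rewrite !memv_cap => /andP[/lI-> /lJ->]. Qed.

Lemma semisimple_of_complements :
  (forall I, left_ideal I -> exists J, [/\ left_ideal J, (I + J)%VS = fullv & (I :&: J = 0)%VS]) ->
  semisimple_algebra A.
Proof.
move=> compl.
suff dec U : left_ideal U -> exists s : seq {vspace A},
    [/\ forall I, I \in s -> simple_left_ideal I, (\sum_(I <- s) I)%VS = U
      & (\sum_(I <- s) \dim I)%N = \dim U].
  have [|s [ss sU sd]] := dec fullv; first by move=> a x _; rewrite memvf.
  exists (size s), (fun i => nth 0%VS s i); split=> [i||].
  - by apply: ss; rewrite mem_nth.
  - rewrite directvE /= -(big_mkord xpredT (fun i => nth 0%VS s i)) -(big_nth 0%VS xpredT id) sU.
    by rewrite -(big_mkord xpredT (fun i => \dim (nth 0%VS s i))) -(big_nth 0%VS xpredT (fun I => \dim I)) sd.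
  - by rewrite -(big_mkord xpredT (fun i => nth 0%VS s i)) -(big_nth 0%VS xpredT id) sU.
have [n] := ubnP (\dim U); elim: n U => // n IH U /ltnSE dU lU.
have [U0|U0] := eqVneq U 0%VS.
  by exists [::]; rewrite !big_nil U0 dimv0.
have [I sI IU] := left_ideal_simple lU U0; have [lI I0 _] := sI.
have [J [lJ IJ IJ0]] := compl I lI.
have lUJ : left_ideal (U :&: J)%VS by exact: left_ideal_cap.
have IUJ : (I + (U :&: J))%VS = U.
  apply: subv_anti; rewrite subv_add IU capvSl /=; apply/subvP => x xU.
  have : x \in (I + J)%VS by rewrite IJ memvf.
  case/memv_addP=> y yI [z zJ xE]; apply/memv_addP; exists y => //; exists z => //.
  rewrite memv_cap zJ andbT; have -> : z = x - y by rewrite xE addrC addKr.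
  by rewrite memvB // (subvP IU).
have dUJ : (\dim I + \dim (U :&: J))%N = \dim U.
  rewrite -[in RHS]IUJ dimv_disjoint_sum //; apply/eqP; rewrite -subv0 -IJ0.
  by rewrite capvS // capvSr.
have [||s [ss sU sd]] := IH (U :&: J)%VS.
- rewrite (leq_trans _ dU) // -dUJ -[X in (X < _)%N]add0n ltn_add2r lt0n.
  by rewrite dimv_eq0.
- exact: lUJ.
exists (I :: s); split=> [D||]; rewrite ?big_cons ?sU ?sd //.
by rewrite inE => /predU1P[->|/ss].
Qed.

End SimpleIdeals.

Section Maschke.
Variables (K : fieldType) (H : hopfAlgType K).
Local Notation S := (@antipode K H).

Lemma sw_mem (C : coalgType K) (U : vectType K) (X : {vspace U}) (F : C -> C -> U) x :
  (forall a b, F a b \in X) -> sw F x \in X.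
Proof.
by move=> FX; do 2!(apply: memv_suml => ? _); rewrite memvZ.
Qed.

Variable L : H.
Hypothesis LI : forall a : H, a * L = (counit a : K) *: L.

(** The Casimir property of L_1 (x) S(L_2): replace counit(c_1) L by c_1 L and cancel S(c_2) c_3. *)
Lemma integral_shift (U : vectType K) (G : H -> H -> U) c :
  (forall b, linear (G^~ b)) -> (forall a, linear (G a)) ->
  sw (fun a b => G (c * a) (S b)) L = sw (fun a b => G a (S b * c)) L.
Proof.
move=> G1 G2.
have G1' (V : vectType K) (f : V -> H) b : linear f -> linear (fun x => G (f x) b).
  by move=> fl a x y; rewrite fl G1.
have G2' (V : vectType K) (f : V -> H) a : linear f -> linear (fun x => G a (f x)).
  by move=> fl r x y; rewrite fl G2.
symmetry.
transitivity (sw (fun c1 c2 => sw (fun a b => G a (S b * c2)) (c1 * L)) c).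
  rewrite -[LHS](sw_counitl (f := fun c => sw (fun a b => G a (S b * c)) L)).
    by apply: eq_sw => a b; rewrite LI (linZ _ _ (lin_sw_arg _ (@lin_id K H))).
  by apply: lin_sw => a b; apply: G2'; lin.
transitivity (sw (fun c1 c2 => sw (fun c3 c4 =>
    sw (fun a b => G (c3 * a) (S (c4 * b) * c2)) L) c1) c).
  by apply: eq_sw => c1 c2; rewrite swM // => a; apply: G2'; lin.
rewrite sw_assoc.
transitivity (sw (fun c1 c2 => (counit c2 : K) *: sw (fun a b => G (c1 * a) (S b)) L) c).
  apply: eq_sw => c1 c2; rewrite -swZ [LHS]sw_exchange; apply: eq_sw => a b.
  transitivity (sw (fun c3 c4 => G (c1 * a) (S b * (S c3 * c4))) c2).
    by apply: eq_sw => c3 c4; rewrite antipodeM mulrA.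
  by rewrite (sw_antipodel (f := fun z => G (c1 * a) (S b * z))) ?mulr1 //; apply: G2'; lin.
rewrite (sw_counitr (f := fun c => sw (fun a b => G (c * a) (S b)) L)) //.
by apply: lin_sw => a b; apply: G1'; lin.
Qed.

Lemma maschke : (counit L : K) != 0 -> semisimple_algebra H.
Proof.
move=> L0; apply: semisimple_of_complements => I lI.
(* The linear projection onto I averaged over L: [integral_shift] makes it H-linear, and L_1 S(L_2)
   = counit(L) makes it the identity on I. *)
pose T x := (counit L : K)^-1 *: sw (fun a b => a * projv I (S b * x)) L.
have Tl : linear T by rewrite /T; lin.
have TI x : T x \in I.
  by rewrite memvZ // sw_mem // => a b; rewrite lI // memv_proj.
have TK x : x \in I -> T x = x.
  move=> xI; rewrite /T.
  transitivity ((counit L : K)^-1 *: sw (fun a b => a * S b * x) L).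
    by congr (_ *: _); apply: eq_sw => a b; rewrite projv_id ?lI // mulrA.
  rewrite (sw_antipoder (f := fun z => z * x)); last by lin.
  by rewrite mul1r scalerA mulVf // scale1r.
have Tmul c x : T (c * x) = c * T x.
  rewrite /T -scalerAr; congr (_ *: _).
  rewrite (sw_lin _ _ (g := fun z => c * z)); last by lin.
  transitivity (sw (fun a b => a * projv I (S b * c * x)) L).
    by apply: eq_sw => a b; rewrite mulrA.
  rewrite -(integral_shift (G := fun a z => a * projv I (z * x))); [|by lin|by lin].
  by apply: eq_sw => a b; rewrite mulrA.
exists (lker (linfun T)); split.
- move=> a x; rewrite !memv_ker !linfunE // Tmul => /eqP->.
  by rewrite mulr0.
- apply: subv_anti; rewrite subvf; apply/subvP => x _.
  rewrite -[x](subrK (T x)) addrC memv_add //.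
  by rewrite memv_ker linfunE // addrC -scaleN1r Tl scaleN1r addrC (TK (T x)) ?subrr.
- apply/eqP; rewrite -subv0; apply/subvP => x; rewrite memv_cap => /andP[xI].
  by rewrite memv_ker linfunE // TK // memv0.
Qed.
End Maschke.

Section TraceLemma.
Variables (K : fieldType) (H : hopfAlgType K).
Local Notation A := (hopf_dual H).
Local Notation S := (@antipode K H).
Local Notation e i := (vbasis {:H})`_i.
Local Notation dim := (\dim {:H}).

Lemma windlM (f : A) x y : grouplike f -> windl f (x * y) = windl f x * windl f y.
Proof.
move=> gf; rewrite /windl swM; [|by lin|by lin].
rewrite (sw_lin _ _ (g := fun z => z * _)); last by lin.
apply: eq_sw => a b; rewrite [RHS](sw_lin _ _ (g := fun z => _ * z)); last by lin.
by apply: eq_sw => c d; rewrite grouplike_dualM // -scalerAl -scalerAr scalerA.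
Qed.

Lemma sw_windl (U : vectType K) (F : H -> H -> U) (f : A) x :
  (forall b, linear (F^~ b)) ->
  sw (fun a b => F (windl f a) b) x = sw F (windl f x).
Proof.
move=> F1; rewrite [RHS](sw_lin _ _ (g := sw F)); last by lin.
transitivity (sw (fun a b => sw (fun b1 b2 => (f a : K) *: F b1 b2) b) x).
  rewrite -sw_assoc; apply: eq_sw => a b.
  rewrite /windl (sw_lin _ _ (g := F^~ b)) //; apply: eq_sw => a1 a2.
  by rewrite (linZ _ _ (F1 b)).
by apply: eq_sw => a b; rewrite swZ (linZ _ _ (lin_sw_arg _ (@lin_id K H))).
Qed.

Lemma sw_windr (U : vectType K) (F : H -> H -> U) (f : A) x :
  (forall a, linear (F a)) ->
  sw (fun a b => F a (windr f b)) x = sw F (windr f x).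
Proof.
move=> F2; rewrite [RHS](sw_lin _ _ (g := sw F)); last by lin.
transitivity (sw (fun a b => sw (fun a1 a2 => (f b : K) *: F a1 a2) a) x).
  rewrite sw_assoc; apply: eq_sw => a b.
  rewrite /windr (sw_lin _ _ (g := F a)) //; apply: eq_sw => b1 b2.
  by rewrite (linZ _ _ (F2 a)).
by apply: eq_sw => a b; rewrite swZ (linZ _ _ (lin_sw_arg _ (@lin_id K H))).
Qed.

(** On the canonical element, left multiplication by a on H equals its transpose on the dual, which
    is the cyclicity of the trace. *)
Lemma dual_basis_cyclic (U : vectType K) (B : A -> H -> U) a :
  (forall f, linear (B f)) -> (forall x, linear (B^~ x)) ->
  \sum_(k < dim) B (dual_basis k) (a * e k) =
  \sum_(k < dim) B (linfun (fun x => dual_basis k (a * x) : K^o)) (e k).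
Proof.
move=> B1 B2.
transitivity (\sum_(k < dim) \sum_(j < dim) (dual_basis j (a * e k) : K) *: B (dual_basis k) (e j)).
  apply: eq_bigr => k _; rewrite {1}(basisE (a * e k)) (lin_fsum _ (B1 _)).
  by apply: eq_bigr => j _; rewrite (linZ _ _ (B1 _)).
rewrite exchange_big; apply: eq_bigr => j _.
rewrite [in RHS](dual_basisE (linfun _)) (lin_fsum _ (B2 _)); apply: eq_bigr => k _.
by rewrite (linZ _ _ (B2 _)) [in RHS]linfunE //; lin.
Qed.

(* Radford's trace element: Lam below satisfies a * Lam = chi^-1(a) Lam, and  *)
(* its counit is the trace in question.                                       *)
Theorem antipode2_trace (chi : A) c : ~ semisimple_algebra H -> grouplike chi ->
  \sum_(k < dim) dual_basis k (S (S (windl chi (e k))) * c) = 0 :> K.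
Proof.
move=> nss gchi; pose V z := S (S (windl chi z)).
have Vl (W : vectType K) (f : W -> H) : linear f -> linear (fun x => V (f x)).
  move=> fl; do 2!apply: lin_comp; exact: lin_sw_arg.
pose chi' : A := antipode chi; have gchi' : grouplike chi' by exact: grouplikeS.
pose U z := S (windr chi' z).
have Ul (W : vectType K) (f : W -> H) : linear f -> linear (fun x => U (f x)).
  move=> fl; apply: lin_comp; exact: lin_sw_arg.
have UV a : sw (fun a1 a2 => U a2 * V a1) a = (counit a : K) *: 1.
  transitivity (S (sw (fun a1 a2 => S (windl chi a1) * windr chi' a2) a)).
    rewrite (sw_lin _ _ (g := S)); last by lin.
    by apply: eq_sw => a1 a2; rewrite antipodeM.
  rewrite (sw_windl (F := fun a1 a2 => S a1 * windr chi' a2)); last by lin.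
  rewrite (sw_windr (F := fun a1 a2 => S a1 * a2)); last by lin.
  rewrite (sw_antipodel (f := id)) // linearZ /= antipode1; congr (_ *: _).
  by rewrite -!dual1 windrE mul1r windlE grouplikeVr.
have aU a : sw (fun a1 a2 => a1 * U a2) a = (chi' a : K) *: 1.
  transitivity (sw (fun a1 a2 => sw (fun b1 b2 => (chi' b2 : K) *: (a1 * S b1)) a2) a).
    apply: eq_sw => a1 a2; rewrite /U /windr (sw_lin _ _ (g := fun z => a1 * S z)); last by lin.
    by apply: eq_sw => b1 b2; rewrite linearZ -scalerAr.
  rewrite -sw_assoc.
  transitivity (sw (fun a1 a2 => (counit a1 : K) *: ((chi' a2 : K) *: (1 : H))) a).
    apply: eq_sw => a1 a2; rewrite swZ (sw_antipoder (f := id)) //.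
    by rewrite !scalerA mulrC.
  by rewrite (sw_counitl (f := fun z => (chi' z : K) *: (1 : H))) //; lin.
pose G u (f : A) z := sw (fun x b => (f (u * V b * c) : K) *: x) z.
have G1 u f : linear (G u f).
  by rewrite /G; lin.
have G2 u z : linear (fun f => G u f z).
  by move=> r f g; rewrite /G -swZ /sw -tliftD; apply: eq_tlift => x b; rewrite dualD dualZ scalerDl scalerA.
pose Lam := \sum_(k < dim) G 1 (dual_basis k) (e k).
(* Insert U(a_3) V(a_2), a counit, under the functional, merge V(a_2) V(b) into V(a_2 b), and move
   a_1 across the canonical element: this leaves a_1 U(a_2) = chi^-1(a). *)
have LamE a : a * Lam = (chi' a : K) *: Lam.
  transitivity (sw (fun a1 a2 => \sum_(k < dim) G (U a2) (dual_basis k) (a1 * e k)) a).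
    rewrite sw_sum /Lam mulr_sumr; apply: eq_bigr => k _; set f := dual_basis k.
    symmetry.
    transitivity (sw (fun a1 a2 => sw (fun q r =>
        sw (fun x b => (f (U r * V q * V b * c) : K) *: (a1 * x)) (e k)) a2) a).
      rewrite -sw_assoc; apply: eq_sw => a1 a2.
      rewrite /G swM; [|by lin|by move=> x; apply: lin_scalel; apply: lin_lfun; apply: lin_mull; apply: lin_mulr; apply: Vl; lin].
      apply: eq_sw => p q; apply: eq_sw => x b.
      by rewrite /V windlM // !antipodeM !mulrA.
    transitivity (sw (fun a1 a2 => (counit a2 : K) *:
        sw (fun x b => (f (V b * c) : K) *: (a1 * x)) (e k)) a).
      apply: eq_sw => a1 a2; rewrite -swZ [LHS]sw_exchange; apply: eq_sw => x b.
      rewrite -(sw_lin (g := fun z => (f (z * V b * c) : K) *: (a1 * x)) (fun q r => U r * V q)); last by lin.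
      by rewrite UV -!scalerAl mul1r linearZ scalerA.
    rewrite (sw_counitr (f := fun a1 => sw (fun x b => (f (V b * c) : K) *: (a1 * x)) (e k))); last by lin.
    rewrite /G (sw_lin _ _ (g := fun z => a * z)); last by lin.
    by apply: eq_sw => x b; rewrite mul1r scalerAr.
  transitivity (sw (fun a1 a2 => \sum_(k < dim) G (a1 * U a2) (dual_basis k) (e k)) a).
    apply: eq_sw => a1 a2; rewrite (dual_basis_cyclic (B := G (U a2))) //.
    apply: eq_bigr => k _; apply: eq_sw => x b.
    by rewrite linfunE ?mulrA //; lin.
  rewrite sw_sum /Lam scaler_sumr; apply: eq_bigr => k _.
  have G3 f z : linear (fun u => G u f z) by rewrite /G; lin.
  rewrite -(sw_lin (g := fun u => G u (dual_basis k) (e k)) (fun a1 a2 => a1 * U a2)) // aU.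
  by rewrite (linZ _ _ (G3 _ _)).
have eLam : (counit Lam : K) = \sum_(k < dim) dual_basis k (V (e k) * c).
  rewrite /Lam linear_sum; apply: eq_bigr => k _.
  rewrite /G (sw_lin _ _ (g := counit)); last by lin.
  rewrite -[RHS](sw_counitl (f := fun b => dual_basis k (V b * c))); last first.
    by apply: lin_lfun; apply: lin_mull; apply: Vl; lin.
  by apply: (@eq_sw _ _ K^o) => x b; rewrite linearZ mul1r; exact: mulrC.
apply/eqP; rewrite -[X in X == _]eLam; apply: contra_notT nss => eL0.
(* When counit(Lam) is nonzero, taking counits in [LamE] shows that chi^-1 is the counit, so Lam is
   an integral. *)
apply: (maschke (L := Lam)) => // a; rewrite LamE; congr (_ *: _).
have := congr1 counit (LamE a); rewrite counit_mul linearZ /= => /(mulIf eL0).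
by move->.
Qed.
End TraceLemma.

(** * Freeness over a p-group of group-like elements *)

Lemma coframe_exists (K : fieldType) (V : vectType K) (w : V) (X : {vspace V}) :
  w \in X -> w != 0 -> exists n (v : 'I_n.+1 -> V) (phi : 'I_n.+1 -> 'Hom(V, K^o)),
    coframe v phi X /\ v ord0 = w.
Proof.
move=> wX w0; set Y := (X :\: <[w]>)%VS.
exists (\dim Y).
pose b : (\dim Y).+1.-tuple V := [tuple of w :: vbasis Y].
have bX : basis_of X b.
  have -> : X = (<[w]> + Y)%VS.
    rewrite addvC addv_diff; apply/esym/addv_idPl.
    by rewrite -memvE.
  rewrite -[tval b]/([:: w] ++ vbasis Y) cat_basis ?seq1_basis ?vbasisP //.
  by rewrite directv_addE /= !directvE /= !eqxx /=; rewrite capvC capv_diff.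
by exists (fun i => b`_i), (fun i => linfun (coord b i : V -> K^o)); split; first exact: coframe_basis.
Qed.

Lemma pgroup_fixed_vector (K : fieldType) (p : nat) (gT : finGroupType)
    (W : vectType K) (act : gT -> W -> W) (X : {vspace W}) :
  p \in [pchar K] -> (p.-group [set: gT])%g -> (forall g, linear (act g)) ->
  (forall x, act 1%g x = x) -> (forall g h x, act (g * h)%g x = act g (act h x)) ->
  (forall g x, x \in X -> act g x \in X) -> X != 0%VS ->
  exists x, [/\ x \in X, x != 0 & forall g, act g x = x].
Proof.
move=> pK pG actl act1 actM actX X0.
have vphi := coframe_basis (vbasisP X).
set v := (fun i => _) in vphi; set phi := (fun i => _) in vphi.
pose r (g : gT) := mxframe v phi (act g^-1%g).
have rP : mx_repr [set: gT] r.
  split=> [|g h _ _].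
    rewrite /r invg1 -(mxframe_id vphi); apply/matrixP => i j; rewrite !mxE.
    by rewrite act1.
  rewrite /r -(mxframe_comp vphi) //; last exact: actX.
  by apply/matrixP=> i j; rewrite !mxE invMg actM.
pose rG := MxRepresentation rP.
have /rowV0Pn[u uf u0] : rfix_mx rG [set: gT] != 0.
  by apply: (rfix_pgroup_pchar pK) => //; rewrite lt0n dimv_eq0.
pose x := \sum_i u 0 i *: v i.
have xX : x \in X by apply: memv_suml => i _; rewrite memvZ // (coframe_mem vphi).
have phix i : phi i x = u 0 i.
  rewrite /x linear_sum (bigD1 i) //= linearZ /= (coframe_dual vphi) eqxx big1.
    by rewrite addr0; exact: mulr1.
  by move=> k /negPf kj; rewrite linearZ /= (coframe_dual vphi) kj; exact: mulr0.
exists x; split=> //.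
  by apply: contra_neq u0 => x0; apply/rowP => i; rewrite -phix x0 linear0 mxE.
move=> g; apply: (coframe_eq vphi) => [||i]; rewrite ?actX // (mxframe_apply vphi) //.
have /rfix_mxP/(_ g^-1%g (in_setT _)) := uf.
move/rowP/(_ i); rewrite mxE phix => <-; apply: eq_bigr => k _.
by rewrite phix /= /r invgK.
Qed.

Lemma prescribe_dual (K : fieldType) (V : vectType K) (I : finType) (b : I -> V) (t : I -> K) :
  (forall c : I -> K, \sum_i c i *: b i = 0 -> forall i, c i = 0) ->
  exists f : 'Hom(V, K^o), forall i, f (b i) = t i.
Proof.
move=> bI; pose Psi (c : {ffun I -> K^o}) : V := \sum_i (c i : K) *: b i.
have Pl : linear Psi.
  move=> a c c'; rewrite scaler_sumr -big_split; apply: eq_bigr => i _.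
  by rewrite !ffunE scalerDl scalerA.
have ker0 : lker (linfun Psi) == 0%VS.
  rewrite -subv0; apply/subvP=> c; rewrite memv_ker linfunE // memv0 => /eqP/bI c0.
  by apply/eqP/ffunP => i; rewrite ffunE; exact: c0.
pose F (v : V) : K^o := \sum_i ((linfun Psi)^-1%VF v i * t i).
have Fl : linear F.
  move=> a u v; rewrite scaler_sumr -big_split; apply: eq_bigr => i _.
  by rewrite linearP !ffunE mulrDl; congr (_ + _); exact/esym/mulrA.
exists (linfun F) => i; rewrite linfunE // /F.
pose d : {ffun I -> K^o} := [ffun j => (j == i)%:R].
have -> : b i = linfun Psi d.
  rewrite linfunE // /Psi (bigD1 i) //= ffunE eqxx scale1r big1 ?addr0 // => j /negPf ji.
  by rewrite ffunE ji scale0r.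
rewrite lker0_lfunK // (bigD1 i) //= ffunE eqxx mul1r big1 ?addr0 // => j /negPf ji.
by rewrite ffunE ji mul0r.
Qed.

Section GrouplikeIndependence.
Variables (K : fieldType) (A : hopfAlgType K) (I : finType) (iota : I -> A).
Hypotheses (iota_inj : injective iota) (iotaG : forall i, grouplike (iota i)).

(** Dedekind's argument: [windl f] scales the k-th term of a relation by f(iota k). Subtracting
    f(iota j) times the relation removes the term j and keeps the term i if f separates the two. *)
Lemma grouplike_independent (c : I -> K) :
  \sum_i c i *: iota i = 0 -> forall i, c i = 0.
Proof.
have [n] := ubnP #|[set i | c i != 0]|; elim: n c => // n IH c /ltnSE cn c0 i.
apply/eqP; apply: contraT => ci.
have twist (f : hopf_dual A) : \sum_j (c j * f (iota j)) *: iota j = 0.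
  transitivity (linfun (windl f) (\sum_j c j *: iota j)); last by rewrite c0 linear0.
  rewrite linear_sum; apply: eq_bigr => j _.
  rewrite linearZ /= (linfunE _ (windl_linear f)) /windl sw_grouplike ?scalerA //; lin.
have [j cj ji] : exists2 j, c j != 0 & j != i.
  apply/exists_inP; apply: contraT; rewrite negb_exists_in => /forall_inP cj.
  have /eqP := c0; rewrite (bigD1 i) //= big1 => [|j ji].
    by rewrite addr0 scaler_eq0 (negPf ci) (negPf (grouplike_neq0 (iotaG i))).
  by have /contraTeq-> := cj j; rewrite ?scale0r.
have [f fij] : exists f : hopf_dual A, f (iota j) != f (iota i).
  apply: NNPP => nof; have /iota_inj/eqP : iota j = iota i; last by rewrite (negPf ji).
  apply: dual_inj => f; apply/eqP; apply: contraT => fij.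
  by case: nof; exists f.
pose c' k := c k * (f (iota k) - f (iota j)).
have c'0 : \sum_k c' k *: iota k = 0.
  transitivity (\sum_k ((c k * f (iota k)) *: iota k - f (iota j) *: (c k *: iota k))).
    by apply: eq_bigr => k _; rewrite /c' mulrBr scalerBl scalerA [f _ * _ in RHS]mulrC.
  by rewrite big_split /= twist sumrN -scaler_sumr c0 scaler0 subrr.
have /IH/(_ c'0 i)/eqP : (#|[set k | c' k != 0%R]| < n)%N.
  apply: leq_trans cn; apply: proper_card; apply/properP; split.
    by apply/subsetP => k; rewrite !inE; apply: contra_neq => ck; rewrite /c' ck mul0r.
  by exists j; rewrite !inE ?cj // /c' subrr mulr0 eqxx.
by rewrite mulf_eq0 (negPf ci) subr_eq0 eq_sym (negPf fij).
Qed.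
End GrouplikeIndependence.

Lemma linear_kernel_neq0 (K : fieldType) (V U : vectType K) (f : V -> U) :
  linear f -> (\dim {:U} < \dim {:V})%N -> exists2 x, x != 0 & f x = 0.
Proof.
move=> fl dUV; have k0 : lker (linfun f) != 0%VS.
  apply: contraTneq dUV => k0; rewrite -leqNgt.
  by have := limg_ker_dim (linfun f) fullv; rewrite k0 capv0 dimv0 add0n => <-; rewrite dimvS ?subvf.
exists (vpick (lker (linfun f))); first by rewrite vpick0.
by apply/eqP; rewrite -linfunE // -memv_ker memv_pick.
Qed.

Section Freeness.
Variables (K : fieldType) (A : hopfAlgType K) (p : nat) (gT : finGroupType).
Variable iota : gT -> A.
Hypotheses (iota_inj : injective iota) (iotaG : forall g, grouplike (iota g)).
Hypotheses (iota1 : iota 1%g = 1) (iotaM : forall g h, iota (g * h)%g = iota g * iota h).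
Hypotheses (pK : p \in [pchar K]) (pG : (p.-group [set: gT])%g).
Local Notation S := (@antipode K A).

Let N := \sum_g iota g.

Lemma norm_neq0 : N != 0.
Proof.
apply/eqP=> N0; have := grouplike_independent iota_inj iotaG (c := fun=> 1).
under eq_bigr do rewrite scale1r.
by move/(_ N0 1%g)/eqP; rewrite oner_eq0.
Qed.

(* A nonzero relation module contains a relation fixed by the p-group, whose  *)
(* coefficients are then multiples of N.                                      *)
Lemma norm_independent n (v : 'I_n -> A) :
  (forall c : 'I_n -> K, \sum_i c i *: (N * v i) = 0 -> forall i, c i = 0) ->
  forall c : gT * 'I_n -> K,
    \sum_x c x *: (iota x.1 * v x.2) = 0 -> forall x, c x = 0.
Proof.
move=> vN c c0 x.
pose W := {ffun gT * 'I_n -> K^o}.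
pose Phi (c : W) : A := \sum_x (c x : K) *: (iota x.1 * v x.2).
have Phil : linear Phi.
  move=> a d d'; rewrite scaler_sumr -big_split; apply: eq_bigr => y _.
  by rewrite !ffunE scalerDl scalerA.
pose act g (d : W) : W := [ffun y => d (g^-1 * y.1, y.2)%g].
have actl g : linear (act g) by move=> a d d'; apply/ffunP => y; rewrite !ffunE.
have Phi_act g d : Phi (act g d) = iota g * Phi d.
  rewrite /Phi mulr_sumr (reindex_inj (h := fun y : gT * 'I_n => (g * y.1, y.2)%g)) /=.
    apply: eq_bigr => -[h i] _ /=; rewrite ffunE /= mulKg iotaM -scalerAr.
    by rewrite mulrA.
  by move=> [h i] [h' i'] [/mulgI -> ->].
apply/eqP; apply: contraT => cx.
pose X := lker (linfun Phi).
pose cf : W := [ffun y => c y : K^o].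
have cX : cf \in X.
  rewrite /X memv_ker linfunE // /Phi; apply/eqP; rewrite -[RHS]c0.
  by apply: eq_bigr => y _; rewrite ffunE.
have [||||d [dX d0 dfix]] := @pgroup_fixed_vector K p gT W act X pK pG actl.
- by move=> d; apply/ffunP => -[h i]; rewrite ffunE /= invg1 mul1g.
- by move=> g h d; apply/ffunP => -[k i]; rewrite !ffunE /= invMg mulgA.
- by move=> g d; rewrite /X !memv_ker !linfunE // Phi_act => /eqP ->; rewrite mulr0.
- apply: contraNneq cx => X0; move: cX; rewrite X0 memv0 => /eqP/ffunP/(_ x).
  by rewrite !ffunE => ->.
- have dE g i : d (g, i) = d (1%g, i).
    by rewrite -[in LHS](dfix g) ffunE /= mulVg.
  case/eqP: d0; apply/ffunP => -[g i]; rewrite dE ffunE.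
  apply: (vN (fun i => d (1%g, i))).
  move: dX; rewrite /X memv_ker linfunE // => /eqP dX; rewrite -[RHS]dX /Phi.
  transitivity (\sum_(y : gT * 'I_n) (d (y.1, y.2) : K) *: (iota y.1 * v y.2)); last first.
    by apply: eq_bigr => -[h j] _.
  rewrite -(pair_bigA _ (fun g i => (d (g, i) : K) *: (iota g * v i))) /= exchange_big.
  apply: eq_bigr => j _; rewrite /N mulr_suml scaler_sumr; apply: eq_bigr => h _.
  by rewrite [in RHS]dE.
Qed.

(** windl f (g x_1) is f(g x_1) g x_2, after which x_2 S(x_3) cancels. *)
Lemma windl_galois (f : hopf_dual A) g a b :
  sw (fun x y => windl f (iota g * x) * (S y * b)) a = (f (iota g * a) : K) *: (iota g * b).
Proof.
transitivity (sw (fun x y => sw (fun y1 y2 =>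
    (f (iota g * x) : K) *: (iota g * (y1 * S y2) * b)) y) a).
  rewrite -sw_assoc; apply: eq_sw => x y.
  rewrite /windl swM; [|by lin|by lin].
  rewrite sw_grouplike //; [|by lin|by lin].
  rewrite (sw_lin _ _ (g := fun z => z * (S y * b))); last by lin.
  by apply: eq_sw => x1 x2; rewrite -scalerAl !mulrA.
transitivity (sw (fun x y => (counit y : K) *: ((f (iota g * x) : K) *: (iota g * b))) a).
  apply: eq_sw => x y.
  by rewrite (sw_antipoder (f := fun z => (f (iota g * x) : K) *: (iota g * z * b))) ?mulr1 //; lin.
by rewrite (sw_counitr (f := fun x => (f (iota g * x) : K) *: (iota g * b))) //; lin.
Qed.

(* The Nichols-Zoeller argument: x (x) y |-> x_1 (x) S(x_2) y turns the        *)
(* diagonal action on A (x) A into the action on the first factor, and the    *)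
(* rank of N on A (x) A exceeds r dim A if the free module on v is not A.     *)
Theorem grouplike_free : exists n (v : 'I_n.+1 -> A),
  [/\ v ord0 = 1,
     forall c : gT * 'I_n.+1 -> K,
       \sum_x c x *: (iota x.1 * v x.2) = 0 -> forall x, c x = 0
   & forall u, exists c : gT * 'I_n.+1 -> K, u = \sum_x c x *: (iota x.1 * v x.2)].
Proof.
have Nl : linear (fun a : A => N * a) by lin.
pose LN : 'End(A) := linfun (fun a : A => N * a).
have LNE a : LN a = N * a by rewrite linfunE.
have NX a : N * a \in limg LN by rewrite -LNE memv_img ?memvf.
have N1 : N * 1 != 0 by rewrite mulr1 norm_neq0.
have [n [w [psi [wpsi w0]]]] := coframe_exists (NX 1) N1.
(* Preimages under multiplication by N of a basis of N A, with 1 chosen above N itself. *)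
pose v (i : 'I_n.+1) := if i == ord0 then 1 else (LN^-1)%VF (w i).
have Nv i : N * v i = w i.
  rewrite /v; case: eqP => [->|_]; first by rewrite w0.
  by rewrite -LNE limg_lfunVK // (coframe_mem wpsi).
have vI : forall c : gT * 'I_n.+1 -> K,
    \sum_x c x *: (iota x.1 * v x.2) = 0 -> forall x, c x = 0.
  apply: norm_independent => c c0 i.
  have := congr1 (psi i) c0; rewrite linear0 linear_sum (bigD1 i) //= big1 => [|j ji].
    by rewrite addr0 linearZ /= Nv (coframe_dual wpsi) eqxx => <-; exact/esym/mulr1.
  by rewrite linearZ /= Nv (coframe_dual wpsi) (negPf ji); exact: mulr0.
exists n, v; split=> [||u]; [by rewrite /v eqxx | exact: vI |].
apply: NNPP => nu.
(* A vector u outside the span provides one more unknown c than there are equations, so [Xi] has a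
   nonzero kernel vector (a, c). *)
pose D := ({ffun 'I_n.+1 -> A} * K^o)%type.
pose E := {ffun 'I_n.+1 -> A}.
pose Xi0 (d : D) (i : 'I_n.+1) : A :=
  \sum_j sw (fun x y => (psi i (N * x) : K) *: (S y * v j)) (d.1 j) + (d.2 : K) *: ((psi i N : K) *: u).
pose Xi (d : D) : E := [ffun i => Xi0 d i].
have Xil : linear Xi.
  move=> r d d'; apply/ffunP => i; rewrite !ffunE /Xi0 scalerDr scaler_sumr addrACA -big_split /=.
  congr (_ + _); last by rewrite scalerDl !scalerA mulrA.
  apply: eq_bigr => j _.
  rewrite !ffunE -[sw _ _]/((fun z => sw (fun x y => (psi i (N * x) : K) *: (S y * v j)) z) _).
  have sl : linear (sw (fun x y => (psi i (N * x) : K) *: (S y * v j))) by lin.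
  by rewrite sl.
have dimD : (\dim {:E} < \dim {:D})%N.
  by rewrite !dimvf /dim /= /dim /= addn1.
have [[a c] d0 Xid] := linear_kernel_neq0 Xil dimD.
have Xi00 i : Xi0 (a, c) i = 0 by have /ffunP/(_ i) := Xid; rewrite !ffunE.
(* Multiply the i-th equation by windl f (w_i) and sum: as the w_i span N A, this reassembles windl
   f (N x), and [windl_galois] gives a relation among the g v_j and g u. *)
have rel (f : hopf_dual A) :
    \sum_x (f (iota x.1 * a x.2) : K) *: (iota x.1 * v x.2) +
    (c : K) *: \sum_g (f (iota g) : K) *: (iota g * u) = 0.
  transitivity (\sum_i windl f (w i) * Xi0 (a, c) i); last first.
    by rewrite big1 // => i _; rewrite Xi00 mulr0.
  have wf x : x \in limg LN -> windl f x = \sum_i (psi i x : K) *: windl f (w i).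
    move=> xX; rewrite {1}(coframeE wpsi xX) (lin_fsum _ (windl_linear f)).
    by apply: eq_bigr => i _; rewrite (linZ _ _ (windl_linear f)).
  transitivity (\sum_j sw (fun x y => windl f (N * x) * (S y * v j)) (a j) + (c : K) *: (windl f N * u)).
    congr (_ + _ *: _); last first.
      rewrite (lin_fsum _ (windl_linear f)) mulr_suml; apply: eq_bigr => g _.
      by rewrite /windl sw_grouplike -?scalerAl //; lin.
    rewrite -(pair_bigA _ (fun g j => (f (iota g * a j) : K) *: (iota g * v j))) /= exchange_big.
    apply: eq_bigr => j _.
    transitivity (\sum_g sw (fun x y => windl f (iota g * x) * (S y * v j)) (a j)).
      by apply: eq_bigr => g _; rewrite windl_galois.
    rewrite -sw_sum; apply: eq_sw => x y.
    by rewrite -mulr_suml -(lin_fsum _ (windl_linear f)) -mulr_suml.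
  transitivity (\sum_i (\sum_j sw (fun x y => (psi i (N * x) : K) *: windl f (w i) * (S y * v j)) (a j) +
      (c : K) *: ((psi i N : K) *: windl f (w i) * u))).
    rewrite big_split [in RHS]exchange_big /=; congr (_ + _).
      apply: eq_bigr => j _; rewrite -sw_sum; apply: eq_sw => x y.
      by rewrite -mulr_suml -wf.
    by rewrite -scaler_sumr -mulr_suml -wf // -[N]mulr1.
  apply: eq_bigr => i _; rewrite /Xi0 mulrDr mulr_sumr; congr (_ + _).
    apply: eq_bigr => j _; rewrite [RHS](sw_lin _ _ (g := fun z => windl f (w i) * z)); last by lin.
    by apply: eq_sw => x y; rewrite -scalerAl scalerAr.
  by rewrite -!scalerAr -scalerAl.
have c0 : c = 0.
  apply/eqP; apply: contraT => c0.
  (* An f that is 1 at the identity and 0 at the other group elements isolates c u, which puts u in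
     the span. *)
  have [f fE] := prescribe_dual (fun g => (g == 1%g)%:R) (grouplike_independent iota_inj iotaG).
  case: nu; exists (fun x => - (c : K)^-1 * f (iota x.1 * a x.2)).
  have := rel f; rewrite [X in _ + _ *: X](bigD1 (1%g : gT)) //= [X in _ + _ *: (_ + X)]big1 => [|g /negPf g1]; last first.
    by rewrite fE g1 scale0r.
  rewrite addr0 fE eqxx scale1r iota1 mul1r => /eqP.
  rewrite addrC addr_eq0 => /eqP cuE.
  transitivity ((c : K)^-1 *: ((c : K) *: u)); first by rewrite scalerA mulVf ?scale1r.
  rewrite cuE scalerN -scaleNr scaler_sumr; apply: eq_bigr => x _.
  by rewrite scalerA.
case/eqP: d0; congr pair; last exact: c0.
apply/ffunP => j; rewrite ffunE; apply: dual_eq0 => f.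
have := rel f; rewrite c0 scale0r addr0 => /vI/(_ (1%g, j)) /=.
by rewrite iota1 mul1r.
Qed.

End Freeness.

(** * Traces in characteristic p *)

Lemma mxtrace_nilpotent (K : closedFieldType) m (M : 'M[K]_m.+1) k :
  M ^+ k = 0 -> \tr M = 0.
Proof.
move=> Mk; have [rs charE] := closed_field_poly_normal (char_poly M).
have /eqP lead1 := char_poly_monic M.
rewrite lead1 scale1r in charE.
have szrs : size rs = m.+1.
  by have := size_char_poly M; rewrite charE size_prod_XsubC => -[].
have rs0 r : r \in rs -> r = 0.
  move=> rrs; have : root (char_poly M) r by rewrite charE root_prod_XsubC.
  rewrite -eigenvalue_root_char => /eigenvalueP[u uM u0].
  have uMj j : u *m M ^+ j = r ^+ j *: u.
    elim: j => [|j IH]; first by rewrite !expr0 mulmx1 scale1r.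
    by rewrite exprSr -mulmxE mulmxA IH -scalemxAl uM scalerA exprSr.
  have /eqP := uMj k; rewrite Mk mulmx0 eq_sym scaler_eq0 (negPf u0) orbF.
  by rewrite expf_eq0 => /andP[_ /eqP].
have charX : char_poly M = 'X^(m.+1).
  rewrite charE (eq_big_seq (fun=> 'X)) => [|r /rs0 ->]; last by rewrite subr0.
  by rewrite big_const_seq count_predT iter_mulr_1 szrs.
by have := char_poly_trace M (ltn0Sn m); rewrite charX coefXn /= ltn_eqF // => /esym/eqP;
  rewrite oppr_eq0 => /eqP.
Qed.

(** In a rank factorization E = C B, idempotence means B C = 1, of size the rank. *)
Lemma mxtrace_idempotent (K : fieldType) m (E : 'M[K]_m) :
  E *m E = E -> \tr E = (\rank E)%:R.
Proof.
move=> EE; have := EE; rewrite -{1 2 3}(mulmx_base E) !mulmxA => E2.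
have : row_base E *m col_base E = 1%:M.
  apply: (row_free_inj (row_base_free E)); rewrite mul1mx.
  apply: (row_full_inj (col_base_full E)).
  by rewrite !mulmxA.
move=> E1; rewrite -{1}(mulmx_base E) mxtrace_mulC E1 mxtrace1 //.
Qed.

(** The rank is nonzero, divisible by p because the trace is 0, and at most p. *)
Lemma rank_pchar_idempotent (K : fieldType) p m (E : 'M[K]_m.+1) :
  p \in [pchar K] -> p = m.+1 -> E *m E = E -> \tr E = 0 -> E != 0 -> E = 1%:M.
Proof.
move=> pK pm EE tr0 E0.
have rE : \rank E = m.+1.
  apply/eqP; rewrite eqn_leq rank_leq_row -[X in (X <= _)%N]pm dvdn_leq ?lt0n ?mxrank_eq0 //.
  by rewrite (dvdn_pcharf pK) -mxtrace_idempotent // tr0.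
have uE : E \in unitmx by rewrite -row_free_unit /row_free rE.
by rewrite -[LHS](mulKmx uE) EE mulVmx.
Qed.

Lemma pchar_matrix (K : fieldType) p m : p \in [pchar K] -> p \in [pchar 'M[K]_m.+1].
Proof. exact: (rmorph_pchar (@scalar_mx K m.+1)). Qed.

(** For odd p, M = Z U with Z = M^(p^b) an involution and U unipotent commuting with it, so tr Z =
    tr M = 0. The projector E = (1 + Z)/2 then has trace p/2 = 0 and fixes u, hence E = 1 and Z = 1.
    For p = 2 the exponent is already a power of p. *)
Lemma trace0_unipotent (K : closedFieldType) p b m (M : 'M[K]_m.+1) (u : 'rV[K]_m.+1) :
  p \in [pchar K] -> p = m.+1 -> M ^+ (2 * p ^ b) = 1 -> \tr M = 0 ->
  u != 0 -> u *m M = u -> exists c, M ^+ (p ^ c) = 1.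
Proof.
move=> pK pm M1 tr0 u0 uM.
have [p2|p2] := eqVneq p 2%N; first by exists b.+1; rewrite expnS [X in (X * _)%N]p2.
have two0 : (2%:R : K) != 0.
  apply: contra p2; rewrite -(dvdn_pcharf pK) dvdn_prime2 ?(pcharf_prime pK) //.
pose Z := M ^+ (p ^ b); have ZZ : Z * Z = 1 by rewrite -expr2 -exprM mulnC.
have MZ : M * Z = Z * M by rewrite /Z -exprS exprSr.
pose U := M * Z.
have oddq : odd (p ^ b).
  by rewrite oddX; have [|->] := even_prime (pcharf_prime pK); rewrite ?orbT // => /eqP; rewrite (negPf p2).
have Uq : U ^+ (p ^ b) = 1.
  rewrite /U exprMn_comm // -/Z -[X in Z ^+ X]odd_double_half oddq exprS -mul2n exprM.
  by rewrite expr2 ZZ expr1n mulr1.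
have MZU : M = Z * U by rewrite /U mulrA -MZ -mulrA ZZ mulr1.
have ZU : GRing.comm Z (U - 1).
  apply: commrB; last exact: commr1.
  by rewrite /GRing.comm -MZU /U -mulrA ZZ mulr1.
have trZ : \tr Z = 0.
  rewrite -[RHS]tr0 [in RHS]MZU -[U in RHS](subrK 1) mulrDr mulr1 mxtraceD.
  rewrite [X in _ = X + _](@mxtrace_nilpotent _ _ _ (p ^ b)) ?add0r //.
  rewrite exprMn_comm // (exprBn_comm_pchar _ (pchar_matrix m pK)) ?Uq ?expr1n ?subrr ?mulr0 //.
  exact: commr1.
pose E := 2%:R^-1 *: (1 + Z).
have EE : E *m E = E.
  rewrite mulmxE /E -scalerAl -scalerAr mulrDr mulr1 mulrDl mul1r ZZ.
  by rewrite [Z + 1]addrC -mulr2n -scaler_nat [2%:R^-1 *: (2%:R *: _)]scalerA mulVf // scale1r.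
have uE : u *m E = u.
  have uZ : u *m Z = u.
    rewrite /Z; elim: (p ^ b)%N => [|j IH]; first by rewrite expr0 mulmx1.
    by rewrite exprSr -mulmxE mulmxA IH.
  rewrite /E -scalemxAr mulmxDr uZ mulmx1 -mulr2n -scaler_nat scalerA mulVf //.
  exact: scale1r.
have E1 : E = 1%:M.
  apply: (rank_pchar_idempotent pK pm EE).
    by rewrite /E mxtraceZ mxtraceD trZ mxtrace1 -pm (pcharf0 pK) addr0 mulr0.
  by apply: contra_neq u0 => E0; rewrite -uE E0 mulmx0.
exists b; rewrite -/Z; have : 2%:R *: E = 1 + Z by rewrite /E scalerA mulfV // scale1r.
by rewrite E1 scaler_nat mulr2n => /addrI.
Qed.

(** T and E commute, so (T - E)^(p^b) = T^(p^b) - E by Frobenius; thus T - E is nilpotent. *)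
Lemma trace_of_unipotent_corner (K : closedFieldType) p b m (E T : 'M[K]_m.+1) k :
  p \in [pchar K] -> E *m E = E -> E *m T = T -> T *m E = T ->
  (T ^+ (p ^ b) - E) ^+ k = 0 -> \tr T = \tr E.
Proof.
move=> pK EE ET TE nil; apply/eqP; rewrite -subr_eq0 -raddfB; apply/eqP.
apply: (@mxtrace_nilpotent _ _ _ (p ^ b * k)).
rewrite exprM (exprBn_comm_pchar _ (pchar_matrix m pK)); last by rewrite /GRing.comm -!mulmxE ET TE.
have Ej j : E ^+ j.+1 = E by elim: j => [|j IH]; rewrite ?expr1 // exprS IH -mulmxE.
by rewrite -(prednK (n := p ^ b)) ?Ej ?prednK ?expn_gt0 ?prime_gt0 ?(pcharf_prime pK).
Qed.

(** * Coinvariants *)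

Lemma linear_inj_dim (K : fieldType) (V U : vectType K) (f : V -> U) :
  linear f -> (forall x, f x = 0 -> x = 0) -> (\dim {:V} <= \dim {:U})%N.
Proof.
move=> fl fi; rewrite leqNgt; apply/negP => /(linear_kernel_neq0 fl)[x x0 /fi/eqP].
by rewrite (negPf x0).
Qed.

Section Coinvariants.
Variables (K : fieldType) (H : hopfAlgType K) (gT : finGroupType).
Local Notation A := (hopf_dual H).
Local Notation S := (@antipode K H).
Variables (iota : gT -> A) (n : nat) (v : 'I_n.+1 -> A).
Hypotheses (iotaG : forall g, grouplike (iota g)).
Hypotheses (iota1 : iota 1%g = 1) (iotaM : forall g h, iota (g * h)%g = iota g * iota h).
Hypotheses (v0 : v ord0 = 1).
Hypothesis vI : forall c : gT * 'I_n.+1 -> K,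
  \sum_x c x *: (iota x.1 * v x.2) = 0 -> forall x, c x = 0.
Hypothesis vS : forall u, exists c : gT * 'I_n.+1 -> K,
  u = \sum_x c x *: (iota x.1 * v x.2).

Let W := {ffun gT * 'I_n.+1 -> K^o}.

Lemma dim_coeffs : \dim {:W} = (#|gT| * n.+1)%N.
Proof. by rewrite dimvf /dim /= /dim /= muln1 card_prod card_ord. Qed.

Lemma free_eq x y : (forall g i, (iota g * v i) x = (iota g * v i) y) -> x = y.
Proof.
move=> xy; apply: dual_inj => f; have [c ->] := vS f.
by rewrite !sum_lfunE; apply: eq_bigr => -[g i] _; rewrite !dualZ xy.
Qed.

Lemma free_dim : (#|gT| * n.+1)%N = \dim {:H}.
Proof.
rewrite -dim_coeffs; apply/eqP; rewrite eqn_leq; apply/andP; split.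
  rewrite -(dual_dim H).
  apply: (@linear_inj_dim _ _ _ (fun c : W => \sum_x (c x : K) *: (iota x.1 * v x.2))).
    move=> a c d; rewrite scaler_sumr -big_split; apply: eq_bigr => x _.
    by rewrite !ffunE scalerDl scalerA.
  by move=> c /vI c0; apply/ffunP => x; rewrite ffunE; exact: c0.
apply: (@linear_inj_dim _ _ _ (fun x : H => [ffun y => (iota y.1 * v y.2) x] : W)).
  by move=> a x y; apply/ffunP => z; rewrite !ffunE linearP.
move=> x /ffunP x0; apply: free_eq => g i.
by have := x0 (g, i); rewrite !ffunE linear0.
Qed.

Lemma free_prescribe (t : gT * 'I_n.+1 -> K) :
  exists x, forall g i, (iota g * v i) x = t (g, i).
Proof.
have [|||x xE] := @linear_inj_surj _ _ _ (fun x : H => [ffun y => (iota y.1 * v y.2) x] : W)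
    _ _ _ [ffun y => t y].
- by move=> a x y; apply/ffunP => z; rewrite !ffunE linearP.
- move=> x /ffunP x0; apply: free_eq => g i.
  by have := x0 (g, i); rewrite !ffunE linear0.
- by rewrite dim_coeffs free_dim.
by exists x => g i; have /ffunP/(_ (g, i)) := xE; rewrite !ffunE.
Qed.

Lemma windl_iotaM g h x : windl (iota g) (windl (iota h) x) = windl (iota (h * g)%g) x.
Proof. by rewrite windl_comp iotaM. Qed.

(* The coinvariants of the surjection of H onto the functions on gT.          *)
Definition coinv : {vspace H} :=
  (\bigcap_g lker (linfun (fun x : H => (windl (iota g) x - x)%R)))%VS.

Lemma coinvP x : reflect (forall g, windl (iota g) x = x) (x \in coinv).
Proof.
have fl g : linear (fun x : H => windl (iota g) x - x).
  by move=> a y z; rewrite windl_linear scalerBr opprD addrACA.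
rewrite memvE; apply: (iffP subv_bigcapP) => xR g.
  have := xR g isT; rewrite -memvE memv_ker linfunE // subr_eq0.
  by move/eqP.
by move=> _; rewrite -memvE memv_ker linfunE // xR subrr.
Qed.

Lemma coinv1 : 1 \in coinv.
Proof.
apply/coinvP => g; rewrite /windl sw1; [|by lin|by lin].
by rewrite (grouplike_dual1 (iotaG g)) scale1r.
Qed.

Lemma coinvM x y : x \in coinv -> y \in coinv -> x * y \in coinv.
Proof.
by move=> /coinvP xR /coinvP yR; apply/coinvP => g; rewrite windlM // xR yR.
Qed.

Lemma coinv_antipode2 x : x \in coinv -> S (S x) \in coinv.
Proof. by move=> /coinvP xR; apply/coinvP => g; rewrite -antipode2_windl // xR. Qed.

Definition avg x : H := \sum_g windl (iota g) x.

Lemma avg_linear : linear avg.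
Proof.
move=> a x y; rewrite /avg scaler_sumr -big_split; apply: eq_bigr => g _.
exact: windl_linear.
Qed.

Lemma avg_coinv x : avg x \in coinv.
Proof.
apply/coinvP => g; rewrite /avg (lin_fsum _ (windl_linear _)).
rewrite [RHS](reindex_inj (mulIg g)); apply: eq_bigr => h _.
exact: windl_iotaM.
Qed.

Lemma avgMr x y : y \in coinv -> avg (x * y) = avg x * y.
Proof.
move=> /coinvP yR; rewrite /avg mulr_suml; apply: eq_bigr => g _.
by rewrite windlM // yR.
Qed.

Lemma avgMl x y : x \in coinv -> avg (x * y) = x * avg y.
Proof.
move=> /coinvP xR; rewrite /avg mulr_sumr; apply: eq_bigr => g _.
by rewrite windlM // xR.
Qed.

(** On an invariant x the functional g v_j takes the value v_j(x) for every g. Since values on the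
    free basis can be prescribed, the v_j are coordinates on [coinv], whose dimension is the rank of
    A over the group algebra. *)
Lemma coinv_coframe : exists r : 'I_n.+1 -> H, coframe r v coinv.
Proof.
have rex (i : 'I_n.+1) : exists x : H, [forall y, (iota y.1 * v y.2) x == (i == y.2)%:R].
  have [x xE] := free_prescribe (fun y => (i == y.2)%:R).
  by exists x; apply/forallP => -[g j]; rewrite xE.
pose r i := xchoose (rex i).
have rE g i j : (iota g * v j) (r i) = (i == j)%:R.
  by have /forallP/(_ (g, j))/eqP := xchooseP (rex i).
have rR i : r i \in coinv.
  by apply/coinvP => g; apply: free_eq => h j; rewrite windlE mulrA -iotaM !rE.
have r1 i j : v j (r i) = (i == j)%:R by rewrite -(rE 1%g) iota1 mul1r.
exists r; split=> // x xR; apply: free_eq => g j.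
have inv y : y \in coinv -> (iota g * v j) y = v j y.
  by move=> /coinvP/(_ g) yR; rewrite -windlE yR.
rewrite inv // linear_sum (bigD1 j) //= big1 => [|i /negPf ij].
  by rewrite addr0 linearZ /= rE eqxx; exact/esym/mulr1.
by rewrite linearZ /= rE ij; exact: mulr0.
Qed.

(** Freeness allows (g v_j)(x0) to be v_j(1) for g = 1 and 0 otherwise, which leaves one term in
    each value of the average. *)
Lemma avg_section : exists2 x0, avg x0 = 1 & forall g, iota g x0 = (g == 1%g)%:R.
Proof.
have [x0 xE] := free_prescribe (fun y => (y.1 == 1%g)%:R * v y.2 1).
exists x0.
  apply: free_eq => h j; rewrite /avg linear_sum.
  transitivity (v j 1); last first.
    rewrite dualM sw1; [|by lin|by lin].
    by rewrite (grouplike_dual1 (iotaG h)) mul1r.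
  rewrite (bigD1 h^-1%g) //= big1 => [|g gh]; rewrite windlE mulrA -iotaM xE /=.
    by rewrite addr0 mulVg eqxx mul1r.
  by rewrite -eq_invg_mul (inv_eq invgK) (negPf gh) mul0r.
by move=> g; have := xE g ord0; rewrite v0 mulr1 dual1 counit_one mulr1.
Qed.

(* Summing the vanishing traces over the group replaces H by the image of avg.*)
Lemma coinv_trace (r : 'I_n.+1 -> H) c : ~ semisimple_algebra H -> coframe r v coinv ->
  c \in coinv -> \sum_i v i (S (S (r i * c))) = 0 :> K.
Proof.
move=> nss rv cR; have [x0 x01 _] := avg_section.
have SSl : linear (fun x => S (S x)) by lin.
pose P x := S (S (avg x)).
have Pl : linear P by move=> a x y; rewrite /P avg_linear SSl.
have PR x : P x \in coinv by rewrite coinv_antipode2 ?avg_coinv.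
pose e (k : 'I_(\dim {:H})) := (vbasis {:H})`_k.
transitivity (\sum_i v i (P (r i * (x0 * c)))).
  apply: eq_bigr => i _; rewrite /P avgMl ?avgMr ?x01 ?mul1r //.
  exact: coframe_mem rv i.
(* Cyclicity of the trace for x |-> x x0 c from R to H, followed by P from H to R. *)
transitivity (\sum_k dual_basis k (P (e k) * (x0 * c))).
  transitivity (\sum_i \sum_k (dual_basis k (r i * (x0 * c)) * v i (P (e k)))).
    apply: eq_bigr => i _; rewrite {1}(basisE (r i * _)) (lin_fsum _ Pl) linear_sum.
    by apply: eq_bigr => k _; rewrite (linZ _ _ Pl) linearZ.
  rewrite exchange_big; apply: eq_bigr => k _ /=.
  rewrite {2}(coframeE rv (PR (e k))) mulr_suml linear_sum; apply: eq_bigr => i _.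
  by rewrite -scalerAl linearZ mulrC.
transitivity (\sum_g \sum_k dual_basis k (S (S (windl (iota g) (e k))) * (x0 * c))).
  rewrite exchange_big; apply: eq_bigr => k _.
  rewrite /P /avg (lin_fsum _ SSl) mulr_suml linear_sum //.
rewrite big1 // => g _; exact: (antipode2_trace (x0 * c) nss (iotaG g)).
Qed.

End Coinvariants.

(** * Idempotents in a finite-dimensional subalgebra *)

Section Fitting.
Variables (K : fieldType) (A : falgType K) (R : {vspace A}).
Hypotheses (R1 : 1 \in R) (RM : forall x y, x \in R -> y \in R -> x * y \in R).

Lemma subalgX x k : x \in R -> x ^+ k \in R.
Proof. by move=> xR; elim: k => [|k IH]; rewrite ?expr0 // exprS RM. Qed.

(** A linear relation among the powers of y, divided by its lowest coefficient, reads y^i = y^(i+1)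
    z with z a polynomial in y. For m = i + 1 the element y^m z^m is the idempotent, and it fixes
    y^m <> 0. *)
Lemma fitting_idempotent y : y \in R -> (forall k, y ^+ k != 0) ->
  exists f z, [/\ z \in R, f = y * z, f = z * y, f * f = f & f != 0].
Proof.
move=> yR yN; set d := \dim {:A}.
pose Psi (c : {ffun 'I_d.+1 -> K^o}) : A := \sum_i (c i : K) *: y ^+ i.
have Pl : linear Psi.
  move=> a c c'; rewrite scaler_sumr -big_split; apply: eq_bigr => i _.
  by rewrite !ffunE scalerDl scalerA.
have [|c c0 Pc] := linear_kernel_neq0 Pl.
  by rewrite [X in (_ < X)%N]dimvf /dim /= /dim /= muln1 card_ord.
have [i1 ci1] : exists i, c i != 0.
  apply/existsP; apply: contraR c0 => /existsPn c0; apply/eqP/ffunP => i.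
  by rewrite ffunE; apply/eqP/negPn/c0.
have [i0 ci0 i0min] := @arg_minnP _ i1 (fun i => c i != 0) (fun i => nat_of_ord i) ci1.
pose z : A := - (c i0 : K)^-1 *: \sum_(i < d.+1 | (i0 < i)%N) (c i : K) *: y ^+ (i - i0).-1.
have zR : z \in R.
  by rewrite memvZ // memv_suml // => i _; rewrite memvZ // subalgX.
have yz : GRing.comm y z.
  rewrite /GRing.comm /z -scalerAr -scalerAl; congr (_ *: _).
  rewrite mulr_sumr mulr_suml; apply: eq_bigr => i _.
  by rewrite -scalerAr -scalerAl -exprS -exprSr.
have yE : y ^+ i0 = y ^+ i0.+1 * z.
  have := Pc; rewrite /Psi (bigD1 i0) //= => /eqP; rewrite addr_eq0 => /eqP cE.
  transitivity ((c i0 : K)^-1 *: ((c i0 : K) *: y ^+ i0)).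
    by rewrite scalerA mulVf ?scale1r.
  rewrite cE scalerN -scaleNr /z -scalerAr; congr (_ *: _).
  rewrite mulr_sumr (bigID (fun i : 'I_d.+1 => (i0 < i)%N)) /= addrC big1 => [|i].
    rewrite add0r; apply: eq_big => [i|i /andP[_ ii0]].
      by rewrite andbC; have [->|] := eqVneq i i0; rewrite ?ltnn ?andbT.
    by rewrite -scalerAr -exprD addSn -addnS prednK ?subn_gt0 // subnKC // ltnW.
  case/andP=> ii0; rewrite -leqNgt leq_eqVlt (negPf ii0 : (i == i0 :> nat) = false) /= => lt.
  have [->|/i0min] := eqVneq (c i) 0; first by rewrite scale0r.
  by rewrite leqNgt lt.
set m := i0.+1.
have yzm k : y ^+ m * (y * z) ^+ k = y ^+ m.
  elim: k => [|k IH]; first by rewrite expr0 mulr1.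
  by rewrite exprSr mulrA IH mulrA -exprSr /m exprS -mulrA -yE -exprS.
have yzX j k : y ^+ j * z ^+ k = z ^+ k * y ^+ j.
  exact/commrX/commr_sym/commrX/commr_sym.
have ym : y ^+ m * (y ^+ m * z ^+ m) = y ^+ m by rewrite -exprMn_comm.
exists (y ^+ m * z ^+ m), (y ^+ i0 * z ^+ m); split.
- by rewrite RM ?subalgX.
- by rewrite mulrA -exprS.
- by rewrite -mulrA -(yzX 1%N) mulrA -exprSr.
- by rewrite {1}yzX -mulrA ym -yzX.
- by apply: contra_neq (yN m) => f0; rewrite -ym f0 mulr0.
Qed.

(** Choose e with A e of least dimension. A y in e R e that is not nilpotent, with eps(y) = 0,
    yields by Fitting a nonzero idempotent f in e R e with eps(f) = 0, and A (e - f) is smaller than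
    A e. *)
Lemma minimal_idempotent (eps : A -> K) :
  eps 1 = 1 -> (forall x y, eps (x * y) = eps x * eps y) ->
  (forall x y, eps (x - y) = eps x - eps y) ->
  exists e, [/\ e \in R, e * e = e, eps e = 1 &
    forall y, y \in R -> e * y = y -> y * e = y -> eps y = 0 -> exists k, y ^+ k = 0].
Proof.
move=> eps1 epsM epsB.
pose ideal e := limg (amulr e : 'End(A)).
pose P k := exists e, [/\ e \in R, e * e = e, eps e = 1 & \dim (ideal e) = k].
have [|k [e [eR ee e1 dk]] kmin] := @ex_least P.
  by exists (\dim (ideal 1)), 1; rewrite mulr1.
exists e; split=> // y yR ey ye y0; apply: NNPP => ynil.
have [k' | f [z [zR fyz fzy ff f0]]] := fitting_idempotent yR.
  by apply/eqP => yk; apply: ynil; exists k'.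
have ef : e * f = f by rewrite fyz mulrA ey.
have fe : f * e = f by rewrite fzy -mulrA ye.
pose e' := e - f.
have e'e' : e' * e' = e' by rewrite /e' mulrBl !mulrBr ee ef fe ff subrr subr0.
have fe' : f * e' = 0 by rewrite mulrBr fe ff subrr.
have fR : f \in R by rewrite fyz RM.
have : (k <= \dim (ideal e'))%N.
  apply: kmin; exists e'; split=> //; first by rewrite memvB.
  by rewrite epsB e1 fyz epsM y0 mul0r subr0.
rewrite leqNgt -dk => /negP[].
have sub : (ideal e' <= ideal e)%VS.
  apply/subvP => _ /memv_imgP[x _ ->]; rewrite lfunE /=.
  have -> : x * e' = amulr e (x * e') by rewrite lfunE /= -mulrA mulrBl ee fe.
  by rewrite memv_img ?memvf.
rewrite ltn_neqAle dimvS // andbT; apply: contra f0 => dE.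
have /eqP E : ideal e' == ideal e by rewrite eqEdim sub (eqP dE) leqnn.
have fE : f = amulr e f by rewrite lfunE /= fe.
have : f \in ideal e by rewrite fE memv_img ?memvf.
rewrite -E => /memv_imgP[x _]; rewrite lfunE /= => fx.
by apply/eqP; rewrite -fe' [in RHS]fx -mulrA e'e' -fx.
Qed.

End Fitting.

(** * Nilpotence of the augmentation ideal of the coinvariants *)

Section CoinvariantsNil.
Variables (K : closedFieldType) (H : hopfAlgType K) (gT : finGroupType) (p : nat).
Local Notation A := (hopf_dual H).
Local Notation S := (@antipode K H).
Variables (iota : gT -> A) (n : nat) (v : 'I_n.+1 -> A).
Hypotheses (iotaG : forall g, grouplike (iota g)).
Hypotheses (iota1 : iota 1%g = 1) (iotaM : forall g h, iota (g * h)%g = iota g * iota h).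
Hypotheses (v0 : v ord0 = 1).
Hypothesis vI : forall c : gT * 'I_n.+1 -> K,
  \sum_x c x *: (iota x.1 * v x.2) = 0 -> forall x, c x = 0.
Hypothesis vS : forall u, exists c : gT * 'I_n.+1 -> K,
  u = \sum_x c x *: (iota x.1 * v x.2).
Hypotheses (pK : p \in [pchar K]) (pn : p = n.+1) (nss : ~ semisimple_algebra H).
Local Notation R := (coinv iota).

(** On R both s = S^2 and t(x) = s(x e) e have trace 0, for e a minimal idempotent of augmentation
    1. The first makes s^q = 1 for a power q of p, so t^q is right multiplication by some w in e R
    e. Minimality makes w - e nilpotent, hence right multiplication by e also has trace 0; as dim R
    = p, e = 1, and minimality of e = 1 is the claim. *)
Theorem coinv_nil b : (forall y, iter (p ^ b * 4) S y = y) ->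
  forall y, y \in R -> counit y = 0 -> exists k, y ^+ k = 0.
Proof.
move=> Sb; have [r rv] := coinv_coframe iota1 iotaM vI vS.
have R1 := coinv1 iotaG; have RM := coinvM iotaG.
pose s x := S (S x).
have sl : linear s by rewrite /s; lin.
have sR x : x \in R -> s x \in R by exact: coinv_antipode2.
have sM x y : s (x * y) = s x * s y by rewrite /s !antipodeM.
have s1 : s 1 = 1 by rewrite /s !antipode1.
have seps x : counit (s x) = counit x by rewrite /s !counit_antipode.
have iterR (T : H -> H) k x : (forall x, x \in R -> T x \in R) -> x \in R -> iter k T x \in R.
  by move=> TR xR; elim: k => //= k; exact: TR.
have iterl (T : H -> H) k : linear T -> linear (iter k T).
  by move=> Tl; elim: k => [|k IH] a x y //=; rewrite IH Tl.
have siter k x : iter k s x = iter (k * 2) S x.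
  by elim: k => //= k ->.
have tr c : c \in R -> \sum_i v i (s (r i * c)) = 0 :> K.
  by move=> cR; apply: (coinv_trace iotaG iotaM v0 vI vS nss rv).
pose M := mxframe r v s.
have Miter k : mxframe r v (iter k s) = M ^+ k by exact: mxframe_iter rv sl sR.
have trM : \tr M = 0.
  by rewrite -[RHS](tr 1) //; apply: eq_bigr => i _; rewrite mxE mulr1.
have M1 : M ^+ (2 * p ^ b) = 1.
  rewrite -Miter -[RHS](mxframe_id rv); apply/matrixP => i j; rewrite !mxE.
  by rewrite siter -mulnA mulnC -mulnA Sb.
pose u : 'rV[K]_n.+1 := \row_i v i 1.
have u0 : u != 0.
  apply: contra_neq (oner_neq0 H) => u0; rewrite (coframeE rv R1) big1 // => i _.
  by have /rowP/(_ i) := u0; rewrite !mxE => ->; rewrite scale0r.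
have uM : u *m M = u.
  apply/rowP => j; rewrite !mxE -[in RHS]s1 (mxframe_apply rv) //.
  by apply: eq_bigr => i _; rewrite mxE.
have [c Mc] := trace0_unipotent pK pn M1 trM u0 uM.
have sc x : x \in R -> iter (p ^ c) s x = x.
  move=> xR; apply: (mxframe_inj rv (T' := id)) => //; first by move=> z; exact: iterR.
    exact: iterl.
  by rewrite Miter Mc (mxframe_id rv).
have [e [eR ee e1 enil]] := minimal_idempotent R1 RM (eps := @counit K H)
  counit_one (@counit_mul K H) (raddfB (@counit K H)).
pose E := mxframe r v (fun x => x * e).
have Rel (z : H) : linear (fun x : H => x * z) by lin.
have ReR z : z \in R -> forall x, x \in R -> x * z \in R by move=> zR x xR; exact: RM.
have EE : E *m E = E.
  rewrite -(mxframe_comp rv) //; last exact: ReR.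
  by apply/matrixP=> i j; rewrite !mxE -mulrA ee.
pose t x := s (x * e) * e.
have tl : linear t by rewrite /t; apply: lin_mull => a x y; rewrite Rel sl.
have tR x : x \in R -> t x \in R by move=> xR; rewrite /t RM ?sR ?RM.
pose T := mxframe r v t.
have ET : E *m T = T.
  rewrite -(mxframe_comp rv) //; last exact: ReR.
  by apply/matrixP=> i j; rewrite !mxE /t -[_ * e * e]mulrA ee.
have TE : T *m E = T.
  rewrite -(mxframe_comp rv) //.
  by apply/matrixP=> i j; rewrite !mxE /t -mulrA ee.
have trT : \tr T = 0.
  pose P := mxframe r v (fun x => s (x * e)).
  have sel : linear (fun x => s (x * e)) by move=> a x y; rewrite Rel sl.
  have PE : T = P *m E by rewrite -(mxframe_comp rv) // => x xR; rewrite sR ?RM.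
  have EP : E *m P = P.
    rewrite -(mxframe_comp rv) //; last exact: ReR.
    by apply/matrixP=> i j; rewrite !mxE -mulrA ee.
  by rewrite PE mxtrace_mulC EP -[RHS](tr e eR); apply: eq_bigr => i _; rewrite mxE.
pose w k := iter k t 1.
have wR k : w k \in R by exact: iterR.
have tw k x : iter k t x = iter k s x * w k.
  elim: k => [|k IH]; first by rewrite /w /= mulr1.
  by rewrite /w /= IH {1}/t -mulrA sM mulrA.
have weps k : counit (w k) = 1.
  elim: k => [|k IH]; first exact: counit_one.
  by rewrite /w /= /t counit_mul seps counit_mul e1 !mulr1.
have q0 : (0 < p ^ c)%N by rewrite expn_gt0 prime_gt0 ?(pcharf_prime pK).
set q := (p ^ c)%N in sc q0 *.
have we : w q * e = w q by rewrite /w -(prednK q0) /= /t -[in LHS]mulrA ee.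
(* Since t(e) = t(1), t^q(e) is w_q; it is also s^q(e) w_q = e w_q. *)
have ew : e * w q = w q.
  rewrite -{1}(sc e eR) -tw /w -(prednK q0) !iterSr; congr (iter _ _ _).
  by rewrite /t ee mul1r.
have [||||k wk] := enil (w q - e).
- by rewrite memvB.
- by rewrite mulrBr ew ee.
- by rewrite mulrBl we ee.
- by rewrite linearB /= weps e1 subrr.
have TqE : T ^+ q - E = mxframe r v (fun x => x * (w q - e)).
  rewrite -(mxframe_iter q rv tl tR); apply/matrixP=> i j; rewrite !mxE.
  by rewrite tw sc ?(coframe_mem rv) // mulrBr linearB.
have Tnil : (T ^+ q - E) ^+ k = 0.
  rewrite TqE -(mxframe_iter k rv (Rel _) (ReR _ _)) ?memvB //.
  apply/matrixP=> i j; rewrite !mxE.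
  suff -> : iter k (fun x => x * (w q - e)) (r i) = r i * (w q - e) ^+ k.
    by rewrite wk mulr0 linear0.
  by elim: (k) => [|l IH] /=; rewrite ?expr0 ?mulr1 // IH -mulrA exprSr.
have trE : \tr E = 0 by rewrite -(trace_of_unipotent_corner pK EE ET TE Tnil).
have E1 : E = 1%:M.
  apply: (rank_pchar_idempotent pK pn EE trE).
  have : e != 0 by apply: contra_eq_neq e1 => ->; rewrite linear0 eq_sym oner_neq0.
  apply: contra_neq => E0; rewrite -[e]mul1r.
  apply: (mxframe_inj rv (T' := fun=> 0) (ReR e eR)) => //.
  - by move=> x _; rewrite mem0v.
  - by move=> a x y; rewrite scaler0 addr0.
  - by rewrite -/E E0; apply/matrixP=> i j; rewrite !mxE linear0.
have {}e1 : e = 1.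
  rewrite -[e]mul1r; apply: (mxframe_inj rv (T' := id) (ReR e eR)) => //.
  by rewrite -/E E1 (mxframe_id rv).
by move=> y yR y0; apply: enil; rewrite ?e1 ?mul1r ?mulr1.
Qed.
End CoinvariantsNil.

(** * Simple subcoalgebras of the dual *)

Section GrouplikeGroup.
Variables (K : fieldType) (A : hopfAlgType K) (s : seq A).
Hypothesis sP : forall g, (g \in s) = grouplike g.

Definition grouplikes of (forall g, (g \in s) = grouplike g) := seq_sub s.
Local Notation G := (grouplikes sP).

HB.instance Definition _ := Finite.copy G (seq_sub s).

Lemma grouplikesP (x : G) : grouplike (ssval x).
Proof. by rewrite -sP ssvalP. Qed.

Lemma grouplikes_mem g : grouplike g -> g \in s.
Proof. by rewrite sP. Qed.

Definition grouplikes_mul (x y : G) : G :=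
  SeqSub (grouplikes_mem (grouplikeM (grouplikesP x) (grouplikesP y))).
Definition grouplikes_one : G := SeqSub (grouplikes_mem (grouplike1 A)).
Definition grouplikes_inv (x : G) : G :=
  SeqSub (grouplikes_mem (grouplikeS (grouplikesP x))).

Lemma grouplikes_mulA : associative grouplikes_mul.
Proof. by move=> x y z; apply: val_inj; rewrite /= mulrA. Qed.

Lemma grouplikes_mul1 : left_id grouplikes_one grouplikes_mul.
Proof. by move=> x; apply: val_inj; rewrite /= mul1r. Qed.

Lemma grouplikes_mulV : left_inverse grouplikes_one grouplikes_inv grouplikes_mul.
Proof. by move=> x; apply: val_inj; rewrite /= grouplikeVl ?grouplikesP. Qed.

HB.instance Definition _ :=
  Finite_isGroup.Build G grouplikes_mulA grouplikes_mul1 grouplikes_mulV.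

End GrouplikeGroup.

Lemma grouplike_group (K : fieldType) (A : hopfAlgType K) m :
  grouplike_order A m -> exists (gT : finGroupType) (iota : gT -> A),
    [/\ injective iota, forall g, grouplike (iota g),
        forall x, grouplike x -> exists g, iota g = x,
        iota 1%g = 1 /\ forall g h, iota (g * h)%g = iota g * iota h & #|gT| = m].
Proof.
case=> s [us sP sm]; exists (grouplikes sP), (@ssval _ s); split=> //.
- exact: val_inj.
- exact: grouplikesP.
- by move=> x gx; exists (SeqSub (grouplikes_mem sP gx)).
- by rewrite card_seq_sub.
Qed.

Section Subcoalgebra.
Variables (K : fieldType) (C : coalgType K).

Lemma grouplike_subcoalgebra (g : C) : grouplike g -> subcoalgebra <[g]>%VS.
Proof.
case/andP=> /eqP gE _ x /vlineP[k ->].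
by rewrite linearZ /= gE memvZ // tensv_mem // memv_line.
Qed.

Lemma grouplike_simple (g : C) : grouplike g -> simple_subcoalgebra <[g]>%VS.
Proof.
move=> gg; have g0 : g != 0.
  apply/eqP=> g0; case/andP: gg => _; rewrite g0 linear0 eq_sym.
  by rewrite oner_eq0.
split=> [||E _ Eg]; first exact: grouplike_subcoalgebra.
  by rewrite -dimv_eq0 dim_vline g0.
have [->|E0] := eqVneq E 0%VS; [by left | right].
by apply/eqP; rewrite eqEdim Eg dim_vline g0 lt0n dimv_eq0.
Qed.

Lemma pointed_of_simple :
  (forall D : {vspace C}, simple_subcoalgebra D -> exists2 g, grouplike g & D = <[g]>%VS) ->
  pointed C.
Proof.
move=> simpleP x; split=> [[ds dsP]|[s /allP sG]]; last first.
  rewrite span_def => xs; exists [seq <[g]>%VS | g <- s]; last by rewrite big_map.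
  by move=> _ /mapP[g /sG gg ->]; exact: grouplike_simple.
have [s sG ds_s] : exists2 s : seq C, all (@grouplike K C) s & (\sum_(D <- ds) D <= <<s>>)%VS.
  elim: ds dsP => [|D ds IH] dsP; first by exists [::]; rewrite // big_nil sub0v.
  have [|s sG dss] := IH; first by move=> E Eds; apply: dsP; rewrite inE Eds orbT.
  have [g gg DE] := simpleP _ (dsP _ (mem_head _ _)).
  exists (g :: s); rewrite /= ?gg // big_cons span_cons DE.
  by rewrite addvS.
by move=> xds; exists s => //; exact: (subvP ds_s).
Qed.
End Subcoalgebra.

Section RightAction.
Variables (K : fieldType) (H : hopfAlgType K).
Local Notation A := (hopf_dual H).
Implicit Types (f : A) (x y : H) (D : {vspace A}).

Definition lhit y f : A := linfun (fun z => f (y * z) : K^o).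

Lemma lhitE y f z : lhit y f z = f (y * z).
Proof. by rewrite linfunE //; lin. Qed.

Lemma lhitM x y f : lhit x (lhit y f) = lhit (y * x) f.
Proof. by apply/lfunP => z; rewrite !lhitE mulrA. Qed.

Lemma lhit_linear f : linear (lhit^~ f).
Proof.
move=> a x y; apply/lfunP => z.
by rewrite !(lhitE, dualD, dualZ) mulrDl -scalerAl linearP.
Qed.

Lemma lhit_linearr y : linear (lhit y).
Proof. by move=> a f g; apply/lfunP => z; rewrite !(lhitE, dualD, dualZ). Qed.

Lemma lhit1 f : lhit 1 f = f.
Proof. by apply/lfunP => z; rewrite lhitE mul1r. Qed.

(** f(y _) is f_1(y) f_2, the image of the coproduct of f under a map taking D (x) D into D. *)
Lemma subcoalgebra_lhit D f y : subcoalgebra D -> f \in D -> lhit y f \in D.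
Proof.
move=> sD fD; pose L (X : tensor A A) : A := tlift (fun g h : A => (g y : K) *: h) X.
have Ll : linear L by apply: lin_tlift_arg; exact: lin_id.
have -> : lhit y f = L (comul f).
  apply/lfunP => z; rewrite lhitE -dual_sw.
  rewrite [RHS](tlift_linP (g := fun h : A => h z : K^o)).
    by apply: eq_tlift => g h; rewrite dualZ.
  by move=> c g h; rewrite dualD dualZ.
have : (tensv D D <= linfun L @^-1: D)%VS.
  apply/span_subvP => _ /allpairsP[[g h] /= [gD hD ->]].
  rewrite -memv_preim linfunE // /L tliftE.
  - by rewrite memvZ // vbasis_mem.
  - by move=> h'; apply: lin_scalel; apply: lin_eval; exact: lin_id.
  - by move=> g'; apply: lin_scaler; exact: lin_id.
move/subvP/(_ _ (sD f fD)); rewrite -memv_preim linfunE //.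
Qed.
End RightAction.

(* In a minimal nonzero R-submodule X of D, f R^+ is 0 or X, and f = f r with  *)
(* r nilpotent is impossible.                                                 *)
Lemma nil_augmentation_invariant (K : fieldType) (H : hopfAlgType K) (R : {vspace H})
    (D : {vspace hopf_dual H}) :
  1 \in R -> (forall x y, x \in R -> y \in R -> x * y \in R) ->
  (forall y, y \in R -> counit y = 0 -> exists k, y ^+ k = 0) ->
  D != 0%VS -> (forall r f, r \in R -> f \in D -> lhit r f \in D) ->
  exists f, [/\ f \in D, f != 0 & forall r, r \in R -> lhit r f = (counit r : K) *: f].
Proof.
move=> R1 RM Rnil D0 DR.
pose P k := exists X : {vspace hopf_dual H}, [/\ X != 0%VS, (X <= D)%VS,
  forall r f, r \in R -> f \in X -> lhit r f \in X & \dim X = k].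
have [|k [X [X0 XD XR dX]] kmin] := @ex_least P.
  by exists (\dim D), D; rewrite subvv.
pose f := vpick X; have fX : f \in X by exact: memv_pick.
have f0 : f != 0 by rewrite vpick0.
exists f; split=> //; first exact: (subvP XD).
pose Rp := (R :&: lker (linfun (@counit K H)))%VS.
have RpP r : r \in Rp = (r \in R) && (counit r == 0).
  by rewrite memv_cap memv_ker lfunE.
have ann r : r \in Rp -> lhit r f = 0.
  move=> rRp; apply/eqP; apply: contraT => rf0.
  pose Y := (linfun (fun r : H => lhit r f) @: Rp)%VS.
  have YE g : g \in Y -> exists2 r, r \in Rp & g = lhit r f.
    by case/memv_imgP=> r' r'R ->; exists r'; rewrite // linfunE //; exact: lhit_linear.
  have lY r' : r' \in Rp -> lhit r' f \in Y.
    by move=> r'R; rewrite -(linfunE r' (lhit_linear f)) memv_img.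
  have YX : (Y <= X)%VS.
    by apply/subvP => g /YE[r' + ->]; rewrite RpP => /andP[r'R _]; exact: XR.
  have XY : X = Y.
    apply/eqP; rewrite eq_sym eqEdim YX dX kmin //; exists Y; split=> //.
    - by apply: contra rf0 => /eqP Y0; move: (lY _ rRp); rewrite Y0 memv0.
    - exact: subv_trans YX XD.
    - move=> r1 g r1R /YE[r2]; rewrite RpP => /andP[r2R /eqP r20] ->.
      by rewrite lhitM lY // RpP RM //= counit_mul r20 mul0r.
  have [r' + fE] : exists2 r', r' \in Rp & f = lhit r' f by apply: YE; rewrite -XY.
  rewrite RpP => /andP[r'R /eqP r'0]; have [j r'j] := Rnil _ r'R r'0.
  have fj : f = lhit (r' ^+ j) f.
    elim: (j) => [|i IH]; first by rewrite expr0 lhit1.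
    by rewrite exprSr -lhitM -IH.
  case/eqP: f0; rewrite fj r'j; apply/lfunP => z.
  by rewrite lhitE mul0r linear0 zero_lfunE.
move=> r rR; have := ann (r - (counit r : K) *: 1).
rewrite RpP memvB ?memvZ // linearB /= linearZ /= counit_one => /(_ _)/eqP.
have -> : counit r - (counit r : K^o) *: (1 : K^o) == 0 by rewrite subr_eq0; apply/eqP/esym/mulr1.
move=> /(_ isT).
have -> : r - (counit r : K) *: 1 = - (counit r : K) *: 1 + r by rewrite addrC scaleNr.
by rewrite lhit_linear lhit1 scaleNr addrC subr_eq0 => /eqP.
Qed.

Section Final.
Variables (K : fieldType) (H : hopfAlgType K) (gT : finGroupType).
Local Notation A := (hopf_dual H).
Local Notation S := (@antipode K H).
Variables (iota : gT -> A) (n : nat) (v : 'I_n.+1 -> A).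
Hypotheses (iotaG : forall g, grouplike (iota g)).
Hypotheses (iota1 : iota 1%g = 1) (iotaM : forall g h, iota (g * h)%g = iota g * iota h).
Hypotheses (v0 : v ord0 = 1).
Hypothesis vI : forall c : gT * 'I_n.+1 -> K,
  \sum_x c x *: (iota x.1 * v x.2) = 0 -> forall x, c x = 0.
Hypothesis vS : forall u, exists c : gT * 'I_n.+1 -> K,
  u = \sum_x c x *: (iota x.1 * v x.2).
Local Notation R := (coinv iota).

Lemma antipode_iota g : antipode (iota g) = iota g^-1%g.
Proof.
rewrite -[LHS]mul1r -iota1 -(mulVg g) iotaM -mulrA grouplikeVr ?iotaG // mulr1 //.
Qed.

(** As g(x0) is 1 for g = 1 and 0 otherwise, avg(x0 h_1) lies in R with the counit of h_1, so
    f(S(h)) = f(avg(x0 h_1) S(h_2)). The average is the sum of the windl_g(x0) windl_g(h_1), and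
    windl_g(h_1) S(h_2) collapses to g(h): the coefficient of g in S(f) is (g f)(x0). *)
Lemma invariant_grouplike_span (f : A) :
  (forall r, r \in R -> lhit r f = (counit r : K) *: f) ->
  exists c : gT -> K, antipode f = \sum_g c g *: iota g.
Proof.
move=> fR; have [x0 x01 x0E] := avg_section iotaG iotaM v0 vI vS.
exists (fun g => (iota g * f) x0); apply/lfunP => h; rewrite dualS sum_lfunE.
transitivity (sw (fun a b => f (avg iota (x0 * a) * S b) : K^o) h).
  transitivity (sw (fun a b => (counit a : K) *: (f (S b) : K^o)) h).
    by rewrite (sw_counitl (f := fun b => f (S b) : K^o)) //; lin.
  apply: (@eq_sw _ _ K^o) => a b; rewrite -lhitE fR ?avg_coinv // dualZ.
  congr (_ * _); rewrite /avg linear_sum (bigD1 1%g) //= big1 => [|g /negPf g1].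
    by rewrite iota1 windl1 counit_mul -[counit x0]dual1 -iota1 x0E eqxx mul1r addr0.
  by rewrite -dual1 windlE mulr1 (grouplike_dualM _ _ (iotaG g)) x0E g1 mul0r.
transitivity (\sum_g sw (fun a b => f (windl (iota g) x0 * (windl (iota g) a * S b)) : K^o) h).
  rewrite -sw_sum; apply: (@eq_sw _ _ K^o) => a b.
  rewrite /avg mulr_suml linear_sum; apply: eq_bigr => g _.
  by rewrite windlM // mulrA.
apply: eq_bigr => g _.
rewrite (sw_windl (F := fun a b => f (windl (iota g) x0 * (a * S b)) : K^o)); last by lin.
rewrite (sw_antipoder (f := fun z => f (windl (iota g) x0 * z) : K^o)); last by lin.
rewrite mulr1 windlE dualZ -dual1 windlE mulr1; exact: mulrC.
Qed.

(** S inverts group-likes and so preserves their span, and f is a further iterate of S applied to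
    S(f). *)
Lemma finite_order_grouplike_span (f : A) k (c : gT -> K) :
  (forall y, iter k.+1 S y = y) -> antipode f = \sum_g c g *: iota g ->
  exists c' : gT -> K, f = \sum_g c' g *: iota g.
Proof.
move=> Sk fE.
have span_iter j : exists c' : gT -> K, iter j.+1 (@antipode K A) f = \sum_g c' g *: iota g.
  elim: j => [|j [c' IH]]; first by exists c.
  exists (fun g => c' g^-1%g); rewrite iterS IH linear_sum [RHS](reindex_inj invg_inj).
  by apply: eq_bigr => g _; rewrite invgK linearZ /= -antipode_iota.
have [c' c'E] := span_iter k; exists c'; rewrite -c'E; apply/lfunP => y.
rewrite -[in LHS](Sk y); elim: (k.+1) y => [|j IH] y //.
by rewrite iterSr IH iterS dualS.
Qed.

Lemma simple_subcoalgebra_grouplike k (D : {vspace A}) :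
  (forall y, y \in R -> counit y = 0 -> exists k, y ^+ k = 0) ->
  (forall y, iter k.+1 S y = y) -> simple_subcoalgebra D ->
  exists2 g, grouplike g & D = <[g]>%VS.
Proof.
move=> Rnil Sk [sD D0 Dmin].
have [|f [fD f0 fR]] := nil_augmentation_invariant (coinv1 iotaG) (coinvM iotaG) Rnil D0.
  by move=> r f _; exact: subcoalgebra_lhit.
have [c cE] := invariant_grouplike_span fR.
have {c cE} [c cE] := finite_order_grouplike_span Sk cE.
have [g cg] : exists g, c g != 0.
  apply/existsP; apply: contraR f0 => /existsPn c0; rewrite cE big1 // => g _.
  by have /negPn/eqP-> := c0 g; rewrite scale0r.
have [y yE] := free_prescribe vI vS (fun x => (x.1 == g)%:R).
have iy h : iota h y = (h == g)%:R by have := yE h ord0; rewrite v0 mulr1.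
(* For y with g(y) = 1 and h(y) = 0 at the other group-likes h, f(y _) is c_g g, and D is stable
   under this action. *)
have gD : iota g \in D.
  have -> : iota g = (c g)^-1 *: lhit y f.
    rewrite cE (lin_fsum _ (lhit_linearr y)) (bigD1 g) //= big1 => [|h /negPf hg].
      rewrite addr0 (linZ _ _ (lhit_linearr y)) scalerA mulVf // scale1r.
      by apply/lfunP => z; rewrite lhitE grouplike_dualM // iy eqxx mul1r.
    rewrite (linZ _ _ (lhit_linearr y)); apply/lfunP => z.
    by rewrite dualZ lhitE grouplike_dualM // iy hg mul0r mulr0 zero_lfunE.
  by rewrite memvZ // subcoalgebra_lhit.
exists (iota g) => //.
have gsD : (<[iota g]> <= D)%VS by rewrite -memvE.
case: (Dmin _ (grouplike_subcoalgebra (iotaG g)) gsD) => // /eqP.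
by rewrite -dimv_eq0 dim_vline (grouplike_neq0 (iotaG g)).
Qed.

End Final.

Theorem theorem3p4 (K : closedFieldType) (p n : nat) (H : hopfAlgType K)
    (hp : p \in [pchar K]) (hn : (1 <= n)%N)
    (hdim : \dim {:H} = (p ^ n)%N)
    (hss : ~ semisimple_algebra H)
    (hG : grouplike_order (hopf_dual H) (p ^ (n - 1))%N) :
  pointed (hopf_dual H).
Proof.
have p0 : (0 < p)%N by rewrite prime_gt0 ?(pcharf_prime hp).
have hdim' : \dim {:hopf_dual H} = (p ^ n)%N by rewrite dual_dim.
have [gT [iota [iota_inj iotaG _ [iota1 iotaM] cardG]]] := grouplike_group hG.
have pG : (p.-group [set: gT])%g.
  by rewrite /pgroup cardsT cardG pnatX pnat_id ?(pcharf_prime hp).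
have [r [v [v0 vI vS]]] := grouplike_free iota_inj iotaG iota1 iotaM hp pG.
(* Compare |G| (r + 1) = dim H = |G| p. *)
have pr : p = r.+1.
  have := free_dim vI vS; rewrite cardG hdim -{2}(subnK hn) addn1 expnSr.
  by move/eqP; rewrite eqn_pmul2l ?expn_gt0 ?p0 // => /eqP.
have Sn y : iter (p ^ n * 4) (@antipode K H) y = y.
  exact: (antipode_finite_order (grouplike_pchar_exp hp hdim) (grouplike_pchar_exp hp hdim')).
have Rnil := coinv_nil iotaG iota1 iotaM v0 vI vS hp pr hss Sn.
apply: pointed_of_simple => D.
have q0 : (0 < p ^ n * 4)%N by rewrite muln_gt0 expn_gt0 p0.
apply: (simple_subcoalgebra_grouplike iotaG iota1 iotaM v0 vI vS Rnil (k := (p ^ n * 4).-1)).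
by rewrite prednK.
Qed.
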